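(* Let $N\ge1$ and let $\Omega\subset\mathbb{R}^N$ be a bounded open set of class $C^2$. For every $\mu>0$ there is exactly one positive and bounded weak solution $u\in\mathbb{H}(\Omega)$ of $$L_\Delta u=-\mu\ln(|u|)\,u\ \text{ in }\Omega,\qquad u=0\ \text{ in }\mathbb{R}^N\setminus\Omega .$$
   Context: Positive means $u>0$ in $\Omega$; $\ln(|u|)u$ is understood as $0$ where $u=0$. Constants: $c_N=\pi^{-N/2}\Gamma(N/2)$, $\rho_N=2\ln2+\Psi(N/2)-\gamma$, with $\Psi=\Gamma'/\Gamma$ and $\gamma=-\Gamma'(1)$. $L_\Delta$ is the logarithmic Laplacian (Fourier symbol $2\ln|\xi|$). $\mathbb{H}(\Omega)$ is the space of $u\in L^2(\mathbb{R}^N)$ with $u=0$ in $\mathbb{R}^N\setminus\Omega$ and $\iint_{|x-y|\le1}\frac{|u(x)-u(y)|^2}{|x-y|^N}dx\,dy<\infty$. The bilinear form is $\mathcal{E}_L(u,v)=\frac{c_N}{2}\int_{\mathbb{R}^N}\int_{B_1(x)}\frac{(u(x)-u(y))(v(x)-v(y))}{|x-y|^N}dy\,dx-c_N\iint_{|x-y|\ge1}\frac{u(x)v(y)}{|x-y|^N}dx\,dy+\rho_N\int_{\mathbb{R}^N}uv\,dx$, where $B_1(x)$ is the open unit ball centered at $x$. A weak solution of the problem is $u\in\mathbb{H}(\Omega)$ with $\mathcal{E}_L(u,v)=-\mu\int_\Omega uv\ln(|u|)\,dx$ for all $v\in\mathbb{H}(\Omega)$. *)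

(* Defs.v *)
From HB Require Import structures.
From mathcomp Require Import all_boot all_order all_algebra.
From mathcomp Require Import all_classical all_reals all_analysis.
Set Implicit Arguments.
Unset Strict Implicit.
Unset Printing Implicit Defensive.
Import Order.TTheory GRing.Theory Num.Theory numFieldNormedType.Exports.
Local Open Scope classical_set_scope.
Local Open Scope ring_scope.

Definition rV_display : measure_display -> measure_display.
Proof. exact. Qed.

(* The sigma-algebra generated by the coordinates; over the reals it is the
   Borel sigma-algebra. *)
Section rV_measurable.
Context {d} {T : measurableType d} (N : nat).

Let coord (i : 'I_N) (x : 'rV[T]_N) : T := x ord0 i.

Let rV_measurable : set (set 'rV[T]_N) := g_sigma_preimage coord.

Let rV_set0 : rV_measurable set0.
Proof. exact: sigma_algebra0. Qed.

Let rV_setC A : rV_measurable A -> rV_measurable (~` A).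
Proof. exact: sigma_algebraC. Qed.

Let rV_bigcup (F : (set 'rV[T]_N)^nat) :
  (forall i, rV_measurable (F i)) -> rV_measurable (\bigcup_i F i).
Proof. exact: sigma_algebra_bigcup. Qed.

HB.instance Definition _ := @isMeasurable.Build (rV_display d)
  'rV[T]_N rV_measurable rV_set0 rV_setC rV_bigcup.

End rV_measurable.


Lemma measurable_coord d (T : measurableType d) N (i : 'I_N) :
  measurable_fun [set: 'rV[T]_N] (fun x => x ord0 i).
Proof.
move=> _ Y mY; rewrite setTI; apply: sub_sigma_algebra => /=.
rewrite -bigcup_seq/=; exists i => /=; first by rewrite mem_index_enum.
by exists Y => //; rewrite setTI.
Qed.

Lemma measurable_fun_rV d1 d2 (T1 : measurableType d1) (T2 : measurableType d2)
    N (f : T1 -> 'rV[T2]_N) :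
  (forall i, measurable_fun [set: T1] (fun x => f x ord0 i)) ->
  measurable_fun [set: T1] f.
Proof.
move=> mf _ Y mY; rewrite setTI.
suff : g_sigma_preimage (fun i => (fun v : 'rV[T2]_N => v ord0 i) \o f)
    `<=` measurable.
  rewrite g_sigma_preimage_comp => fS; apply: fS.
  by exists Y => //; rewrite setTI.
apply: smallest_sub; first exact: sigma_algebra_measurable.
move=> A; rewrite -bigcup_seq /= => -[i _ [B mB <-]].
exact: mf.
Qed.

Definition cons_rV (T : Type) N (p : T * 'rV[T]_N) : 'rV[T]_N.+1 :=
  row_mx (const_mx p.1 : 'rV_1) p.2.

Lemma measurable_cons_rV d (T : measurableType d) N :
  measurable_fun [set: T * 'rV[T]_N] (@cons_rV T N).
Proof.
apply: measurable_fun_rV => i.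
case: (split_ordP (i : 'I_(1 + N))) => [j ->|j ->].
- rewrite [X in measurable_fun _ X](_ : _ = fst); first exact: measurable_fst.
  by apply/funext => p; rewrite /cons_rV (@row_mxEl _ _ 1) mxE.
- rewrite [X in measurable_fun _ X](_ : _ = (fun v : 'rV[T]_N => v ord0 j) \o snd).
    exact: (measurableT_comp (measurable_coord j) measurable_snd).
  by apply/funext => p; rewrite /cons_rV (@row_mxEr _ _ 1).
Qed.

Definition uncons_rV (T : Type) N (x : 'rV[T]_N.+1) : T * 'rV[T]_N :=
  (x ord0 ord0, rsubmx (x : 'rV_(1 + N))).

Lemma cons_rVK (T : Type) N : cancel (@cons_rV T N) (@uncons_rV T N).
Proof.
move=> [a v]; rewrite /uncons_rV /cons_rV row_mxKr; congr pair.
have -> : ord0 = lshift N (@ord0 0) :> 'I_(1 + N) by exact/val_inj.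
by rewrite (@row_mxEl _ _ 1) mxE.
Qed.

Lemma measurable_uncons_rV d (T : measurableType d) N :
  measurable_fun [set: 'rV[T]_N.+1] (@uncons_rV T N).
Proof.
apply: measurable_fun_pair; first exact: measurable_coord.
apply: measurable_fun_rV => i.
rewrite [X in measurable_fun _ X](_ : _ =
    (fun v : 'rV[T]_(1 + N) => v ord0 (rshift 1 i))).
  exact: measurable_coord.
by apply/funext => v; rewrite mxE.
Qed.

Section lebesgue_step.
Context {R : realType} (N : nat).
Variable m : {sigma_finite_measure set 'rV[R]_N -> \bar R}.

Definition lebesgue_step : set 'rV[R]_N.+1 -> \bar R :=
  pushforward (@lebesgue_measure R \x m)%E (@cons_rV R N).

Let preimage_measurable (A : set 'rV[R]_N.+1) : measurable A ->
  @measurable _ (measurableTypeR R * 'rV[R]_N)%type (@cons_rV R N @^-1` A).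
Proof.
by move=> mA; rewrite -[X in measurable X]setTI; exact: measurable_cons_rV.
Qed.

Let lebesgue_step0 : lebesgue_step set0 = 0%E.
Proof. by rewrite /lebesgue_step /pushforward preimage_set0 measure0. Qed.

Let lebesgue_step_ge0 A : (0 <= lebesgue_step A)%E.
Proof. exact: (@measure_ge0 _ _ _ (@lebesgue_measure R \x m)%E). Qed.

Let lebesgue_step_sigma_additive : semi_sigma_additive lebesgue_step.
Proof.
move=> F mF tF mUF; rewrite /lebesgue_step /pushforward preimage_bigcup.
apply: (@measure_semi_sigma_additive _ _ _ (@lebesgue_measure R \x m)%E).
- by move=> n; exact: preimage_measurable.
- apply/trivIsetP => /= i j _ _ ij; rewrite -preimage_setI.
  by move/trivIsetP : tF => /(_ _ _ _ _ ij) ->//; rewrite preimage_set0.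
- by rewrite -preimage_bigcup; exact: preimage_measurable.
Qed.

HB.instance Definition _ := isMeasure.Build _ _ _ lebesgue_step
  lebesgue_step0 lebesgue_step_ge0 lebesgue_step_sigma_additive.

Let lebesgue_step_sigma_finite : sigma_finite setT lebesgue_step.
Proof.
have /sigma_finiteP[F [TF ndF Foo]] := sigma_finiteT (@lebesgue_measure R).
have /sigma_finiteP[G [TG ndG Goo]] := sigma_finiteT m.
exists (fun n => @uncons_rV R N @^-1` (F n `*` G n)).
  rewrite -preimage_bigcup -[LHS](preimage_setT (@uncons_rV R N)).
  congr (_ @^-1` _).
  rewrite -setXTT TF TG predeqE => -[x y]; split => [[]|].
    move=> [/= n _ Fnx] [k _ Gky]; exists (maxn n k) => //; split.
    - by move: x Fnx; exact/subsetPset/ndF/leq_maxl.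
    - by move: y Gky; exact/subsetPset/ndG/leq_maxr.
  by move=> [n _ []/= ? ?]; split; exists n.
move=> k; have [? ?] := Foo k; have [? ?] := Goo k; split.
  rewrite -[X in measurable X]setTI.
  by apply: measurable_uncons_rV => //; exact: measurableX.
rewrite /lebesgue_step /pushforward -comp_preimage.
rewrite (_ : _ \o _ = id); last by apply/funext; exact: cons_rVK.
by rewrite preimage_id product_measure1E// lte_mul_pinfty// ge0_fin_numE.
Qed.

HB.instance Definition _ := @Measure_isSigmaFinite.Build _ _ _ lebesgue_step
  lebesgue_step_sigma_finite.
End lebesgue_step.

Fixpoint lebesgue_rV (R : realType) (N : nat) :
    {sigma_finite_measure set 'rV[R]_N -> \bar R} :=
  if N is N'.+1 then lebesgue_step (lebesgue_rV R N')
  else \d_(0 : 'rV[R]_0).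

Lemma lebesgue_rV_box (R : realType) N (A : 'I_N -> set R) :
  (forall i, measurable (A i)) ->
  lebesgue_rV R N [set x | forall i, A i (x ord0 i)] =
  (\prod_(i < N) @lebesgue_measure R (A i))%E.
Proof.
elim: N A => [|N IH] A mA.
  rewrite big_ord0 (_ : [set _ | _] = setT) /= ?diracT//.
  by apply/seteqP; split => // x _ [].
rewrite big_ord_recl -IH//= /lebesgue_step /pushforward.
rewrite -product_measure1E//; last first.
  rewrite [X in measurable X](_ : _ = \big[setI/setT]_(i < N)
      ((fun x : 'rV[R]_N => x ord0 i) @^-1` A (lift ord0 i))).
    apply: bigsetI_measurable => i _; rewrite -[X in measurable X]setTI.
    exact: measurable_coord.
  rewrite -bigcap_seq; apply/seteqP; split => [x Ax i _|x Ax i]; first exact: Ax.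
  by apply: Ax; rewrite /= mem_index_enum.
  exact: mA.
congr ((_ \x _)%E _); apply/seteqP; split => [[a v] Aav|[a v] [Aa Av] i] /=.
  split => [|i] /=.
    have := Aav ord0.
    have -> : ord0 = lshift N (@ord0 0) :> 'I_(1 + N) by exact/val_inj.
    by rewrite /cons_rV (@row_mxEl _ _ 1) mxE.
  have := Aav (lift ord0 i).
  have -> : lift ord0 i = rshift 1 i :> 'I_(1 + N) by exact/val_inj.
  by rewrite /cons_rV (@row_mxEr _ _ 1).
case: (unliftP ord0 i) => [j ->|->].
  have -> : lift ord0 j = rshift 1 j :> 'I_(1 + N) by exact/val_inj.
  rewrite /cons_rV (@row_mxEr _ _ 1).
  have -> : rshift 1 j = lift ord0 j :> 'I_(1 + N) by exact/val_inj.
  exact: Av.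
have -> : ord0 = lshift N (@ord0 0) :> 'I_(1 + N) by exact/val_inj.
rewrite /cons_rV (@row_mxEl _ _ 1) mxE.
have -> // : lshift N (@ord0 0) = ord0 :> 'I_(1 + N) by exact/val_inj.
Qed.

Section constants.
Context (R : realType).

Definition Gamma (s : R) : R :=
  \int[lebesgue_measure]_(t in `]0, +oo[) (t `^ (s - 1) * expR (- t)).

Definition digamma (s : R) : R := derive1 Gamma s / Gamma s.

Definition euler_gamma : R := - derive1 Gamma 1.

Definition c_ (N : nat) : R := pi `^ (- (N%:R / 2)) * Gamma (N%:R / 2).

Definition rho_ (N : nat) : R := 2 * ln 2 + digamma (N%:R / 2) - euler_gamma.

End constants.

Section domains.
Context (R : realType) (N : nat).
Implicit Types (x : 'rV[R]_N) (f : 'rV[R]_N -> R).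

(* The norm of the library on ['rV[R]_N] is the sup norm. *)
Definition enorm x : R := Num.sqrt (\sum_i x ord0 i ^+ 2).

Definition partial (i : 'I_N) f x : R := 'D_(delta_mx ord0 i) f x.

Definition C1 f := forall i : 'I_N,
  (forall x, derivable f x (delta_mx ord0 i)) /\ continuous (partial i f).

Definition C2 f := C1 f /\ forall i, C1 (partial i f).

End domains.

(* Near each boundary point, and up to relabelling and reorienting the
   coordinate axes, the set is the strict epigraph of a C^2 function: here [i]
   is the coordinate playing the role of the last one, [s] its orientation, and
   [col' i x] consists of the other coordinates of [x]. *)
Definition class_C2 (R : realType) (N : nat) (Omega : set 'rV[R]_N) :=
  forall x0, (closure Omega `\` interior Omega) x0 ->
  exists (r : R) (i : 'I_N) (s : bool) (g : 'rV[R]_N.-1 -> R),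
    [/\ 0 < r, C2 g &
      forall x, enorm (x - x0) < r ->
        Omega x <-> g (col' i x) < (-1) ^+ s * x ord0 i].

Section weak_solutions.
Context (R : realType) (N : nat).
Local Notation leb := (lebesgue_rV R N).
Implicit Types (Omega : set 'rV[R]_N) (u v : 'rV[R]_N -> R).

(* Elements of L^2 are represented by functions, to be considered up to
   equality almost everywhere. *)
Definition HH Omega u :=
  [/\ u \in Lfun leb 2%:E,
      {ae leb, forall x, ~ Omega x -> u x = 0} &
      (\int[leb \x leb]_(z in [set z | (enorm (z.1 - z.2) <= 1)%R])
        (`|u z.1 - u z.2| ^+ 2 / enorm (z.1 - z.2) ^+ N)%:E < +oo)%E].

Definition E_L u v : R :=
  c_ R N / 2 *
    \int[leb]_x \int[leb]_(y in [set y | enorm (x - y) < 1])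
      ((u x - u y) * (v x - v y) / enorm (x - y) ^+ N)
  - c_ R N *
    \int[(leb \x leb)%E]_(z in [set z | 1 <= enorm (z.1 - z.2)])
      (u z.1 * v z.2 / enorm (z.1 - z.2) ^+ N)
  + rho_ R N * \int[leb]_x (u x * v x).

(* [ln 0] has a finite value in the library, so that [u x * v x * ln `|u x|]
   is 0 where [u] vanishes. *)
Definition weak_solution Omega (mu : R) u :=
  HH Omega u /\
  forall v, HH Omega v ->
    E_L u v = - mu * \int[leb]_(x in Omega) (u x * v x * ln `|u x|).

Definition positive_in Omega u := {ae leb, forall x, Omega x -> 0 < u x}.

Definition ae_bounded u := exists M : R, {ae leb, forall x, `|u x| <= M}.

End weak_solutions.

(* Main.v *)
Require Import Defs.
From HB Require Import structures.
From mathcomp Require Import all_boot all_order all_algebra.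
From mathcomp Require Import all_classical all_reals all_analysis.
From mathcomp Require Import measurable_realfun ring lra.
Import Order.TTheory GRing.Theory Num.Theory numFieldNormedType.Exports.
Set Implicit Arguments.
Unset Strict Implicit.
Unset Printing Implicit Defensive.
Local Open Scope classical_set_scope.
Local Open Scope ring_scope.

(** Weak solutions are the critical points of the action
      [J u = E_L u u / 2 + mu * \int (u ^ 2 / 2 * ln |u| - u ^ 2 / 4)],
    which is strictly convex as a function of [u ^ 2] on nonnegative
    functions: [(sqrt a - sqrt b) ^ 2] is jointly convex (the near part of
    [E_L]), [- sqrt (a * b)] is convex (the far part, which enters with a
    negative sign), the [L^2] part is linear, and [a * ln a] is strictly
    convex. Everything below rests on this and on the shape of [s * ln s] at
    [0] and at infinity.

    Existence. Among functions with values in [0, M] the action is bounded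
    below, and by [action_midpoint] minimizing sequences are Cauchy in
    [L^2], so that strict convexity takes the place of a compact embedding;
    Fatou's lemma for the near part then gives [exists_minimizer]. The
    constraint [u <= M] is not felt if [M] is large: at high values the
    slope of the potential exceeds anything that the far part can gain, so
    truncating [u + t * phi] at [M] changes the first order expansion of the
    action by [O (t ^ 2)] only ([truncated_potential_le]). Hence the
    minimizer satisfies the equation against every [phi] of finite energy,
    bounded or not ([euler_lagrange]).

    Positivity. The slope of [a * ln a] at [0] is [-oo]. If the minimizer
    vanished on a subset of positive measure, moving [u ^ 2] slightly
    towards the square of a bump function that is positive in the domain
    would lower the action ([minimizer_positive]).

    Uniqueness. Let [u] and [v] be positive bounded solutions. Testing the
    equation of [u] with [v ^ 2 / (u + e)], the discrete Picone inequality
    bounds the near part by that of [v] ([solution_picone]); comparing with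
    the equation of [v] tested with [v] and letting [e] tend to [0] leads to
    [\int v ^ 2 * (ln v - ln u) <= 0]. Adding the same inequality with [u]
    and [v] exchanged, [\int (v ^ 2 - u ^ 2) * (ln v - ln u) <= 0], and the
    integrand is positive unless [u = v] ([solution_unique]).

    This argument is carried out on a sigma-finite measure space with two
    kernels, one nonnegative and one with values in [0, 1]. The last parts
    supply what is specific to the logarithmic Laplacian: the constant [c_N]
    is positive, the bump function [min (1, dist (x, complement))] has
    finite energy, and the function space and the form [E_L] are instances
    of the abstract ones up to changes on null sets. *)

(** * Pointwise inequalities *)

Section pointwise.
Context {R : realType}.
Implicit Types a b p q s t u v x y M : R.

Lemma le_ln_sub1 x : 0 < x -> ln x <= x - 1.
Proof.
move=> x0; have -> : ln x = ln (1 + (x - 1)) by congr ln; ring.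
by apply: le_ln1Dx; lra.
Qed.

Lemma normr_mul_le_sqr a b : `|a * b| <= a ^+ 2 + b ^+ 2.
Proof.
have := sqr_ge0 (a + b); have := sqr_ge0 (a - b).
have := sqr_ge0 a; have := sqr_ge0 b.
rewrite ler_norml => *; apply/andP; split; lra.
Qed.

(** The tangent line of the logarithm at [s], multiplied by [u ^+ 2]: in this form
    the bound survives at [u = 0]. *)
Lemma sq_ln_ge u s : 0 <= u -> 0 < s -> u ^+ 2 - u * s <= u ^+ 2 * (ln u - ln s).
Proof.
rewrite le_eqVlt => /orP[/eqP <-|u0] s0; first by rewrite expr0n/= !mul0r subr0.
have h : ln s - ln u <= s / u - 1.
  by rewrite -ln_div ?posrE//; apply: le_ln_sub1; exact: divr_gt0.
have : u ^+ 2 * (ln s - ln u) <= u ^+ 2 * (s / u - 1).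
  by apply: ler_wpM2l => //; exact: sqr_ge0.
have -> : u ^+ 2 * (s / u - 1) = u * s - u ^+ 2 by field; rewrite gt_eqF.
lra.
Qed.

Lemma abs_mul_ln_le a : 0 <= a -> `|a * ln a| <= 1 + a ^+ 2.
Proof.
rewrite le_eqVlt => /orP[/eqP <-|a0]; first by rewrite mul0r normr0; lra.
have h1 : ln a <= a - 1 := le_ln_sub1 a0.
have h2 : ln a^-1 <= a^-1 - 1 by apply: le_ln_sub1; rewrite invr_gt0.
rewrite lnV ?posrE// in h2.
have h3 : a * (- ln a) <= a * (a^-1 - 1) by apply: ler_wpM2l => //; exact: ltW.
have h4 : a * ln a <= a * (a - 1) by apply: ler_wpM2l => //; exact: ltW.
have h5 : a * (a^-1 - 1) = 1 - a by field; rewrite gt_eqF.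
rewrite ler_norml; apply/andP; split; nra.
Qed.

(** The curves [t |-> sqmean t u v] are the segments in the variable [u ^+ 2].
    The action below is convex along them. *)
Definition sqmean t u v := Num.sqrt ((1 - t) * u ^+ 2 + t * v ^+ 2).

Section sqmean.
Variable t : R.
Hypothesis t01 : 0 <= t <= 1.

Lemma sqmean_ge0 u v : 0 <= sqmean t u v.
Proof. exact: sqrtr_ge0. Qed.

Lemma sqr_sqmean u v : sqmean t u v ^+ 2 = (1 - t) * u ^+ 2 + t * v ^+ 2.
Proof.
rewrite sqr_sqrtr//; have /andP[t0 t1] := t01.
by apply: addr_ge0; apply: mulr_ge0; rewrite ?sqr_ge0// subr_ge0.
Qed.

Lemma sqmean_le M u v : 0 <= u <= M -> 0 <= v <= M -> sqmean t u v <= M.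
Proof.
move=> /andP[u0 uM] /andP[v0 vM]; have /andP[t0 t1] := t01.
have M0 : 0 <= M by lra.
rewrite -(@ler_pXn2r _ 2)// ?nnegrE ?sqmean_ge0// sqr_sqmean.
have : u ^+ 2 <= M ^+ 2 by rewrite ler_pXn2r.
have : v ^+ 2 <= M ^+ 2 by rewrite ler_pXn2r.
nra.
Qed.

(** Cauchy-Schwarz in the weights [1 - t] and [t]. It makes the product
    [u(x) u(y)] concave in [u ^+ 2], hence the far part of the action convex. *)
Lemma sqmeanM_ge u v u' v' : 0 <= u -> 0 <= v -> 0 <= u' -> 0 <= v' ->
  (1 - t) * (u * u') + t * (v * v') <= sqmean t u v * sqmean t u' v'.
Proof.
move=> u0 v0 u'0 v'0; have /andP[t0 t1] := t01.
have t1' : 0 <= 1 - t by lra.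
rewrite -(@ler_pXn2r _ 2)// ?nnegrE; last 2 first.
- by apply: addr_ge0; apply: mulr_ge0 => //; apply: mulr_ge0.
- by apply: mulr_ge0; exact: sqmean_ge0.
rewrite exprMn !sqr_sqmean -subr_ge0.
have -> : ((1 - t) * u ^+ 2 + t * v ^+ 2) * ((1 - t) * u' ^+ 2 + t * v' ^+ 2) -
  ((1 - t) * (u * u') + t * (v * v')) ^+ 2 =
  (1 - t) * t * (u * v' - v * u') ^+ 2 by ring.
by rewrite mulr_ge0 ?sqr_ge0// mulr_ge0.
Qed.

(** Squares are interpolated linearly, so after expanding both sides this is
    the previous inequality: the near part of the action is convex as well. *)
Lemma sqmean_contract u v u' v' : 0 <= u -> 0 <= v -> 0 <= u' -> 0 <= v' ->
  (sqmean t u v - sqmean t u' v') ^+ 2 <=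
  (1 - t) * (u - u') ^+ 2 + t * (v - v') ^+ 2.
Proof.
move=> u0 v0 u'0 v'0.
have := sqmeanM_ge u0 v0 u'0 v'0.
have := sqr_sqmean u v; have := sqr_sqmean u' v'.
move: (sqmean t u v) (sqmean t u' v') => s s'.
nra.
Qed.

(** Both end points are compared with the tangent at [sqmean t u v]; the
    quadratic terms recombine because squares are interpolated linearly. *)
Lemma sqmean_entropy u v : 0 <= u -> 0 <= v -> 0 < sqmean t u v ->
  sqmean t u v * (sqmean t u v - ((1 - t) * u + t * v)) <=
  (1 - t) * (u ^+ 2 * ln u) + t * (v ^+ 2 * ln v) -
  sqmean t u v ^+ 2 * ln (sqmean t u v).
Proof.
move=> u0 v0 s0; have /andP[t0 t1] := t01.
have := sq_ln_ge u0 s0; have := sq_ln_ge v0 s0.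
have := sqr_sqmean u v; set s := sqmean t u v in s0 *.
move=> ss hv hu.
have t1' : 0 <= 1 - t by lra.
have := ler_wpM2l t1' hu; have := ler_wpM2l t0 hv => {hu hv}.
have e1 : s ^+ 2 * ln s = (1 - t) * (u ^+ 2 * ln s) + t * (v ^+ 2 * ln s).
  by rewrite ss; ring.
rewrite e1 => h1 h2.
have e2 : s * (s - ((1 - t) * u + t * v)) =
  (1 - t) * u ^+ 2 + t * v ^+ 2 - s * ((1 - t) * u + t * v) by rewrite -ss; ring.
rewrite e2.
lra.
Qed.

Lemma le_sqmean u v : 0 <= u -> 0 <= v -> (1 - t) * u + t * v <= sqmean t u v.
Proof.
move=> u0 v0; have := sqmeanM_ge u0 v0 ler01 ler01.
by rewrite !mulr1 /(sqmean t 1 1) expr1n !mulr1 subrK sqrtr1 mulr1.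
Qed.

Lemma sqmean_entropy_ge0 u v : 0 <= u -> 0 <= v ->
  sqmean t u v ^+ 2 * ln (sqmean t u v) <=
  (1 - t) * (u ^+ 2 * ln u) + t * (v ^+ 2 * ln v).
Proof.
move=> u0 v0; have := sqmean_ge0 u v; rewrite le_eqVlt => /orP[/eqP s0|s0].
  have := sqr_sqmean u v; rewrite -s0 expr0n/= mul0r => e.
  have /andP[t0 t1] := t01.
  have h1 : 0 <= (1 - t) * u ^+ 2 by rewrite mulr_ge0 ?sqr_ge0// subr_ge0.
  have h2 : 0 <= t * v ^+ 2 by rewrite mulr_ge0 ?sqr_ge0.
  have e1 : (1 - t) * u ^+ 2 = 0 by lra.
  have e2 : t * v ^+ 2 = 0 by lra.
  have -> : (1 - t) * (u ^+ 2 * ln u) = (1 - t) * u ^+ 2 * ln u by ring.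
  have -> : t * (v ^+ 2 * ln v) = t * v ^+ 2 * ln v by ring.
  by rewrite e1 e2 !mul0r addr0.
have := sqmean_entropy u0 v0 s0; have := le_sqmean u0 v0 => h1.
have : 0 <= sqmean t u v * (sqmean t u v - ((1 - t) * u + t * v)).
  by rewrite mulr_ge0 ?sqmean_ge0// subr_ge0.
lra.
Qed.

(** Starting from [0] the gain over linear interpolation is of order [t * ln t],
    which is much larger than [t]. This is what makes minimizers positive. *)
Lemma sqmean_entropy_at0 v : 0 < t -> 0 < v ->
  sqmean t 0 v ^+ 2 * ln (sqmean t 0 v) = t * (v ^+ 2 * ln v) + t * ln t / 2 * v ^+ 2.
Proof.
move=> t0 v0.
have tv : 0 < t * v ^+ 2 by rewrite mulr_gt0// exprn_gt0.
have s2 : sqmean t 0 v ^+ 2 = t * v ^+ 2 by rewrite sqr_sqmean expr0n/= mulr0 add0r.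
have s0 : 0 < sqmean t 0 v.
  by rewrite lt_neqAle eq_sym sqmean_ge0 andbT -sqrf_eq0 s2 gt_eqF.
have : ln (sqmean t 0 v ^+ 2) = ln t + 2 * ln v.
  by rewrite s2 lnM ?posrE// ?exprn_gt0// lnXn// mulr_natl.
rewrite lnXn// -[_ *+ 2]mulr_natl => e; rewrite s2.
have -> : ln (sqmean t 0 v) = (ln t + 2 * ln v) / 2 by rewrite -e mulrC mulKf.
by field.
Qed.

End sqmean.

Lemma half01 : 0 <= (2^-1 : R) <= 1.
Proof. by apply/andP; split; lra. Qed.

(** A quantitative form of strict convexity. It turns closeness of the values of
    the action into closeness in [L^2], and so replaces compactness. *)
Lemma sqmean_half_entropy u v : 0 <= u -> 0 <= v ->
  sqmean 2^-1 u v ^+ 2 * ln (sqmean 2^-1 u v) + (u - v) ^+ 2 / 8 <=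
  2^-1 * (u ^+ 2 * ln u) + 2^-1 * (v ^+ 2 * ln v).
Proof.
move=> u0 v0; have := sqmean_ge0 2^-1 u v; rewrite le_eqVlt => /orP[/eqP s0|s0].
  have := sqr_sqmean half01 u v; rewrite -s0 expr0n/= mul0r => e.
  have ue : u = 0 by nra.
  have ve : v = 0 by nra.
  by rewrite ue ve; lra.
have := sqmean_entropy half01 u0 v0 s0; have := le_sqmean half01 u0 v0.
have := sqr_sqmean half01 u v.
move: (sqmean 2^-1 u v) s0 => s s0 e h1 h2.
suff : (u - v) ^+ 2 / 8 <= s * (s - ((1 - 2^-1) * u + 2^-1 * v)) by lra.
have -> : s * (s - ((1 - 2^-1) * u + 2^-1 * v)) = s * (2 * s - (u + v)) / 2 by field.
have -> : (u - v) ^+ 2 = (2 * s - (u + v)) * (2 * s + (u + v)).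
  have -> : (2 * s - (u + v)) * (2 * s + (u + v)) = 4 * s ^+ 2 - (u + v) ^+ 2 by ring.
  by rewrite e; field.
nra.
Qed.

(** The even primitive of [s |-> s * ln `|s|] that vanishes at [0]. *)
Definition entropy s := s ^+ 2 / 2 * ln `|s| - s ^+ 2 / 4.

(** The derivative [s * ln s] has slope [ln s + 1], which is bounded above on
    [0, M] although it tends to [-oo] at [0]; hence the remainder of the first
    order expansion is at most quadratic, uniformly in [a]. The proof compares
    with [ln b] when [b > a / 2] and with [ln a] otherwise. *)
Lemma entropy_bregman_pos M a b : 1 <= M -> 0 <= a <= M -> 0 <= b <= M ->
  entropy b <= entropy a + a * ln a * (b - a) + (ln M / 2 + 1) * (b - a) ^+ 2.
Proof.
move=> M1 /andP[a0 aM] /andP[b0 bM]; rewrite /entropy !ger0_norm//.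
have lM : 0 <= ln M by exact: ln_ge0.
have lnle x : 0 <= x <= M -> ln x <= ln M.
  move=> /andP[]; rewrite le_eqVlt => /orP[/eqP <-|x0] xM; first by rewrite ln0.
  by rewrite ler_ln// posrE; lra.
have la := lnle a; rewrite a0 aM in la; have {la} := la isT => la.
have lb := lnle b; rewrite b0 bM in lb; have {lb} := lb isT => lb.
have Db : (b - a) ^+ 2 * ln b <= (b - a) ^+ 2 * ln M.
  by rewrite ler_wpM2l// sqr_ge0.
have Da : (b - a) ^+ 2 * ln a <= (b - a) ^+ 2 * ln M.
  by rewrite ler_wpM2l// sqr_ge0.
have [ba|ba] := lerP b (a / 2).
  have h : b ^+ 2 * (ln b - ln a) <= 0.
    have [->|bn0] := eqVneq b 0; first by rewrite expr0n/= mul0r.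
    have bp : 0 < b by rewrite lt_neqAle eq_sym bn0.
    rewrite pmulr_rle0 ?exprn_gt0// subr_le0 ler_ln ?posrE//; lra.
  have hq : (a ^+ 2 - b ^+ 2) / 4 <= (b - a) ^+ 2 by nra.
  lra.
move: a0; rewrite le_eqVlt => /orP[/eqP a0|a0].
  rewrite -a0 !subr0 in Db *; nra.
have h : ln b - ln a <= b / a - 1.
  by rewrite -ln_div ?posrE; [apply: le_ln_sub1; apply: divr_gt0; lra|lra|lra].
have h1 : (a * b - a ^+ 2 / 2) * (ln b - ln a) <= (a * b - a ^+ 2 / 2) * (b / a - 1).
  by apply: ler_wpM2l => //; nra.
have e : (a * b - a ^+ 2 / 2) * (b / a - 1) = (b - a / 2) * (b - a).
  by field; rewrite gt_eqF.
rewrite e in h1.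
have := sqr_ge0 (b - a); lra.
Qed.

Lemma entropy_bregman M a b : 1 <= M -> 0 <= a <= M -> `|b| <= M ->
  entropy b <= entropy a + a * ln a * (b - a) + (ln M / 2 + 1) * (b - a) ^+ 2.
Proof.
move=> M1 aM bM; have [b0|b0] := lerP 0 b.
  by apply: entropy_bregman_pos => //; rewrite b0 -(ger0_norm b0).
have -> : entropy b = entropy `|b| by rewrite /entropy normr_id real_normK ?num_real.
apply: le_trans (entropy_bregman_pos M1 aM _) _; first by rewrite normr_ge0.
have lM : 0 <= ln M by exact: ln_ge0.
have /andP[a0 aM'] := aM.
have la : a * ln a <= a * ln M.
  move: a0; rewrite le_eqVlt => /orP[/eqP <-|a0]; first by rewrite !mul0r.
  by rewrite ler_pM2l// ler_ln ?posrE//; lra.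
rewrite ltr0_norm// in bM *.
nra.
Qed.

Lemma entropy0 : entropy 0 = 0.
Proof. by rewrite /entropy expr0n/= !mul0r subrr. Qed.

Lemma abs_entropy_le s : 0 <= s -> `|entropy s| <= s * (1 + s ^+ 2) + s ^+ 2.
Proof.
move=> s0; rewrite /entropy (ger0_norm s0).
have h := abs_mul_ln_le s0.
apply: le_trans (ler_normB _ _) _.
have -> : s ^+ 2 / 2 * ln s = s / 2 * (s * ln s) by field.
rewrite normrM ger0_norm ?divr_ge0// [X in _ + X]ger0_norm ?divr_ge0 ?sqr_ge0//.
have : s / 2 * `|s * ln s| <= s / 2 * (1 + s ^+ 2) by rewrite ler_wpM2l ?divr_ge0.
nra.
Qed.

(** The discrete Picone inequality: the difference of the two sides is a square
    over a positive number. *)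
Lemma picone p q a b : 0 < p -> 0 < q ->
  (p - q) * (a ^+ 2 / p - b ^+ 2 / q) <= (a - b) ^+ 2.
Proof.
move=> p0 q0; rewrite -subr_ge0.
have -> : (a - b) ^+ 2 - (p - q) * (a ^+ 2 / p - b ^+ 2 / q) =
  (q * a - p * b) ^+ 2 / (p * q) by field; rewrite !gt_eqF.
by rewrite divr_ge0 ?sqr_ge0// mulr_ge0// ltW.
Qed.

Lemma normr_min_sub M a b :
  `|Num.min `|a| M - Num.min `|b| M| <= `|a - b|.
Proof.
have h1 := lerB_dist a b; have h2 := lerB_dist b a; rewrite (distrC b) in h2.
have h3 := normr_ge0 (a - b).
rewrite ler_norml; case: (leP `|a| M) => ?; case: (leP `|b| M) => ?;
 apply/andP; split; lra.
Qed.

(** Controls what the far part of the form, which favours large values, can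
    lose under truncation at level [M]. *)
Lemma mul_le_min M a b : 0 <= M ->
  a * b <= Num.min `|a| M * Num.min `|b| M + (`|a| - Num.min `|a| M) * `|b|
    + `|a| * (`|b| - Num.min `|b| M).
Proof.
move=> M0; apply: le_trans (ler_norm _) _; rewrite normrM.
have := normr_ge0 a; have := normr_ge0 b; move: `|a| `|b| => x y y0 x0.
case: (leP x M) => ?; case: (leP y M) => ?; nra.
Qed.

End pointwise.

(** * The zero-order potential and truncation *)

Section competitor.
Context {R : realType}.
Variables (rho mu : R).
Hypothesis mu0 : 0 < mu.
Implicit Types a b s M A c V : R.

Definition potential s := rho / 2 * s ^+ 2 + mu * entropy s.
Definition dpotential s := rho * s + mu * (s * ln s).

Lemma potential_bregman M a b : 1 <= M -> 0 <= a <= M -> `|b| <= M ->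
  potential b <= potential a + dpotential a * (b - a) +
    (`|rho| + mu * (ln M / 2 + 1)) * (b - a) ^+ 2.
Proof.
move=> M1 aM bM; rewrite /potential /dpotential.
have := ler_wpM2l (ltW mu0) (entropy_bregman M1 aM bM) => h.
have h1 : rho * (b - a) ^+ 2 <= `|rho| * (b - a) ^+ 2.
  by rewrite ler_wpM2r ?sqr_ge0// ler_norm.
have h2 : 0 <= `|rho| * (b - a) ^+ 2 by rewrite mulr_ge0 ?sqr_ge0.
lra.
Qed.

Lemma normr_potential_le M a : 0 <= a <= M ->
  `|potential a| <= `|rho| * M ^+ 2 + mu * (M * (1 + M ^+ 2) + M ^+ 2).
Proof.
move=> /andP[a0 aM]; apply: le_trans (ler_normD _ _) _.
have a2 : a ^+ 2 <= M ^+ 2 by rewrite ler_pXn2r// nnegrE; lra.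
have -> : `|rho / 2 * a ^+ 2| = `|rho| / 2 * a ^+ 2.
  by rewrite normrM (ger0_norm (sqr_ge0 a)) normrM normfV (@ger0_norm _ 2).
rewrite (normrM mu) (gtr0_norm mu0) lerD//.
  have := sqr_ge0 a; by have := normr_ge0 rho; nra.
rewrite ler_pM2l//; apply: le_trans (abs_entropy_le a0) _.
have := sqr_ge0 a; nra.
Qed.

Lemma normr_dpotential_le M a : 0 <= a <= M ->
  `|dpotential a| <= `|rho| * M + mu * (1 + M ^+ 2).
Proof.
move=> /andP[a0 aM]; apply: le_trans (ler_normD _ _) _.
have a2 : a ^+ 2 <= M ^+ 2 by rewrite ler_pXn2r// nnegrE; lra.
rewrite ![`|_ * _|]normrM (gtr0_norm mu0) (ger0_norm a0) lerD//.
  by rewrite ler_wpM2l.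
rewrite ler_pM2l// -{1}(ger0_norm a0) -normrM.
apply: le_trans (abs_mul_ln_le a0) _; lra.
Qed.

(** Truncating [b] at [M] costs the far part at most [A] times the excess over
    [M]. When the slope of the potential near [M] is at least [A], lowering [b] to
    [M] pays for that cost, so that the first order expansion at [a] still has a
    quadratic remainder, for all real [b] and not only for [`|b| <= M]. *)
Lemma truncated_potential_le M A : 2 <= M -> 0 <= A ->
  (forall a, M - 1 <= a <= M -> A <= dpotential a) ->
  exists K, 0 <= K /\ forall a b, 0 <= a <= M ->
    potential (Num.min `|b| M) + A * (`|b| - Num.min `|b| M) <=
    potential a + dpotential a * (b - a) + K * (b - a) ^+ 2.
Proof.
move=> M2 A0 HA.
have M1 : 1 <= M by lra.
pose K0 := `|rho| + mu * (ln M / 2 + 1).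
pose B := `|rho| * M ^+ 2 + mu * (M * (1 + M ^+ 2) + M ^+ 2).
pose B' := `|rho| * M + mu * (1 + M ^+ 2).
have K00 : 0 <= K0.
  have := mulr_ge0 (ltW mu0) (ln_ge0 M1); have := normr_ge0 rho; rewrite /K0.
  by have := mu0; lra.
have B0 : 0 <= B.
  by apply: le_trans (normr_ge0 (potential 0)) _; apply: normr_potential_le; lra.
have B'0 : 0 <= B'.
  by apply: le_trans (normr_ge0 (dpotential 0)) _; apply: normr_dpotential_le; lra.
(* [K0] serves while [b - a] is small; the other terms bound everything crudely
   when [`|b - a| >= 1]. *)
exists (K0 + (2 * B + A + B')); split; first lra.
move=> a b aM.
have q0 : 0 <= (2 * B + A + B') * (b - a) ^+ 2.
  by rewrite mulr_ge0 ?sqr_ge0//; lra.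
case: (leP `|b| M) => bM.
  have -> : potential `|b| = potential b.
    by rewrite /potential /entropy normr_id real_normK ?num_real.
  have := potential_bregman M1 aM bM; rewrite -/K0; lra.
have /andP[a0 aM'] := aM.
have MM : `|M| <= M by rewrite ger0_norm//; lra.
case: (ltP `|b - a| 1) => [ba1|ba1].
  have b0 : M < b.
    move: bM ba1; case: (lerP 0 b) => b0; first by rewrite ger0_norm.
    rewrite ltr0_norm// ltr_norml => ? /andP[]; lra.
  rewrite ltr_norml in ba1; have /andP[ba2 ba3] := ba1.
  have -> : `|b| = b by rewrite ger0_norm//; lra.
  have h := potential_bregman M1 aM MM; rewrite -/K0 in h.
  have h2 : A * (b - M) <= dpotential a * (b - M).
    by rewrite ler_wpM2r//; [lra|apply: HA; lra].
  have h3 : K0 * (M - a) ^+ 2 <= K0 * (b - a) ^+ 2.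
    by rewrite ler_wpM2l// ler_pXn2r// ?nnegrE; lra.
  lra.
have h1 : `|potential M| <= B by apply: normr_potential_le; lra.
have h2 : `|potential a| <= B by apply: normr_potential_le; lra.
have h3 : `|dpotential a| <= B' by apply: normr_dpotential_le; lra.
have h4 : `|b| - M <= `|b - a| by have := lerB_dist b a; rewrite (ger0_norm a0); lra.
have h5 : - (dpotential a * (b - a)) <= B' * `|b - a|.
  rewrite -normrN in h3.
  by apply: le_trans (ler_norm _) _; rewrite normrN normrM ler_wpM2r// -normrN.
have h6 : A * (`|b| - M) <= A * `|b - a| by rewrite ler_wpM2l.
rewrite ler_norml in h1; rewrite ler_norml in h2.
have h7 : `|b - a| <= (b - a) ^+ 2.
  by rewrite -(real_normK (num_real (b - a))) ler_eXnr.
have h8 : 1 <= (b - a) ^+ 2 by apply: le_trans ba1 h7.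
have h9 := ler_wpM2l A0 h7.
have h10 := ler_wpM2l B'0 h7.
have h11 := ler_wpM2l B0 h8.
have h12 : 0 <= K0 * (b - a) ^+ 2 by rewrite mulr_ge0 ?sqr_ge0.
lra.
Qed.

(** The slope [s * ln s] outgrows the linear bound [c * (M * V + 1)] on the far
    part of functions with values in [0, M] on a set of measure [V]. *)
Lemma exists_truncation_level c V : 0 <= c -> 0 <= V -> exists M, 2 <= M /\
  forall a, M - 1 <= a <= M -> c * (M * V + 1) <= dpotential a.
Proof.
move=> c0 V0; pose X := Num.max 0 ((2 * c * (V + 1) - rho) / mu).
have X0 : 0 <= X by rewrite le_max lexx.
have e1 : 1 <= expR X by rewrite -expR0 ler_expR.
(* On [M - 1, M] the slope is at least [a * (rho + mu * X)] and [M <= 2 * a]. *)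
exists (expR X + 1); split; first lra.
move=> a /andP[]; rewrite addrK => aX aM; rewrite /dpotential.
have a0 : 0 < a by lra.
have h : 2 * c * (V + 1) <= rho + mu * ln a.
  have : X <= ln a by rewrite -[X]expRK ler_ln ?posrE// expR_gt0.
  rewrite /X ge_max => /andP[_]; rewrite ler_pdivrMr//; lra.
have h' := ler_wpM2l (ltW a0) h.
have -> : rho * a + mu * (a * ln a) = a * (rho + mu * ln a) by ring.
apply: le_trans h'.
have : 0 <= c * V by rewrite mulr_ge0.
nra.
Qed.

End competitor.

(** * Measurability and integrability of real functions *)

Section measurability.
Context {d} {T : measurableType d} {R : realType}.
Implicit Types f g : T -> R.

Lemma measurable_fun_inv f : (forall x, 0 <= f x) ->
  measurable_fun setT f -> measurable_fun setT (fun x => (f x)^-1).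
Proof.
move=> f0 mf.
rewrite (_ : (fun x => (f x)^-1) = (@powR R ^~ (-1)) \o f); last first.
  by apply/funext => x /=; rewrite powR_inv1.
exact: measurableT_comp.
Qed.

Lemma measurable_fun_sqrt f :
  measurable_fun setT f -> measurable_fun setT (fun x => Num.sqrt (f x)).
Proof.
move=> mf; apply: (measurableT_comp _ mf).
by apply: continuous_measurable_fun; exact: sqrt_continuous.
Qed.

Lemma measurable_fun_ln f :
  measurable_fun setT f -> measurable_fun setT (fun x => ln (f x)).
Proof. by move=> mf; exact: (measurableT_comp (@measurable_ln R) mf). Qed.

Lemma measurable_fun_normr f :
  measurable_fun setT f -> measurable_fun setT (fun x => `|f x|).
Proof. by move=> mf; exact: (measurableT_comp (@normr_measurable R setT) mf). Qed.

End measurability.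

Lemma measurable_fun_fst d d' (T : measurableType d) (T' : measurableType d')
  (R : realType) (f : T -> R) :
  measurable_fun setT f -> measurable_fun setT (fun z : T * T' => f z.1).
Proof. by move=> mf; exact: (measurableT_comp mf measurable_fst). Qed.

Lemma measurable_fun_snd d d' (T : measurableType d) (T' : measurableType d')
  (R : realType) (f : T' -> R) :
  measurable_fun setT f -> measurable_fun setT (fun z : T * T' => f z.2).
Proof. by move=> mf; exact: (measurableT_comp mf measurable_snd). Qed.

Ltac mfun := repeat first
  [ assumption | exact: measurable_cst | exact: measurable_id
  | apply: measurable_funB | apply: measurable_funN
  | apply: measurable_funD
  | apply: measurable_funM | apply: measurable_funX | apply: measurable_minr | apply: measurable_maxr
  | apply: measurable_fun_normr
  | apply: measurable_fun_ln | apply: measurable_fun_sqrt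
  | apply: measurable_fun_fst | apply: measurable_fun_snd ].

Notation itg mu f := (mu.-integrable [set: _] (EFin \o f)).

Section integrals.
Context {d} {T : measurableType d} {R : realType}.
Variable mu : {measure set T -> \bar R}.
Implicit Types f g : T -> R.

Lemma itg_measurable f : itg mu f -> measurable_fun setT f.
Proof. by move=> /integrableP[/measurable_EFinP]. Qed.

Lemma itg_dom g f : measurable_fun setT f -> itg mu g ->
  (forall x, `|f x| <= g x) -> itg mu f.
Proof.
move=> mf ig fg; apply: (le_integrable measurableT _ _ ig).
  exact/measurable_EFinP.
by move=> x _ /=; rewrite lee_fin (le_trans (fg x))// ler_norm.
Qed.

Lemma itgD f g : itg mu f -> itg mu g -> itg mu (fun x => f x + g x).
Proof. by move=> hf hg; exact: (integrableD measurableT hf hg). Qed.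

Lemma itgZ k f : itg mu f -> itg mu (fun x => k * f x).
Proof. by move=> hf; exact: (integrableZl measurableT k hf). Qed.

Lemma itgN f : itg mu f -> itg mu (fun x => - f x).
Proof.
move=> hf; rewrite (_ : (fun _ => _) = (fun x => -1 * f x)); first exact: itgZ.
by apply/funext => x; rewrite mulN1r.
Qed.

Lemma itgB f g : itg mu f -> itg mu g -> itg mu (fun x => f x - g x).
Proof. by move=> hf hg; apply: itgD => //; exact: itgN. Qed.

Lemma itg_norm f : itg mu f -> itg mu (fun x => `|f x|).
Proof. by move=> hf; exact: (integrable_norm hf). Qed.

Lemma itg_ge0P f : measurable_fun setT f -> (forall x, 0 <= f x) ->
  itg mu f <-> (\int[mu]_x (f x)%:E < +oo)%E.
Proof.
move=> mf f0; split => [/integrableP[_]|h].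
  by under eq_integral do rewrite /= ger0_norm//.
apply/integrableP; split; first exact/measurable_EFinP.
by under eq_integral do rewrite /= ger0_norm//.
Qed.

Lemma itg_indic A : measurable A -> (mu A < +oo)%E -> itg mu (\1_A : T -> R).
Proof.
move=> mA A0; apply/itg_ge0P => //; try exact: measurable_indic.
by rewrite integral_indic// setIT.
Qed.

Lemma RintD f g : itg mu f -> itg mu g ->
  \int[mu]_x (f x + g x) = \int[mu]_x f x + \int[mu]_x g x.
Proof. by move=> hf hg; exact: RintegralD. Qed.

Lemma RintB f g : itg mu f -> itg mu g ->
  \int[mu]_x (f x - g x) = \int[mu]_x f x - \int[mu]_x g x.
Proof. by move=> hf hg; exact: RintegralB. Qed.

Lemma RintZ k f : itg mu f -> \int[mu]_x (k * f x) = k * \int[mu]_x f x.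
Proof. by move=> hf; exact: RintegralZl. Qed.

Lemma le_Rint f g : itg mu f -> itg mu g -> (forall x, f x <= g x) ->
  \int[mu]_x f x <= \int[mu]_x g x.
Proof. by move=> hf hg fg; apply: le_Rintegral. Qed.

Lemma EFin_Rint f : itg mu f -> (\int[mu]_x (f x)%:E)%E = (\int[mu]_x f x)%:E.
Proof. by move=> hf; rewrite /Rintegral fineK//; exact: integrable_fin_num. Qed.

Lemma Rint_ge0 f : (forall x, 0 <= f x) -> 0 <= \int[mu]_x f x.
Proof. by move=> f0; exact: Rintegral_ge0. Qed.

Lemma Rint_eq0_ae f : itg mu f -> (forall x, 0 <= f x) -> \int[mu]_x f x <= 0 ->
  {ae mu, forall x, f x = 0}.
Proof.
move=> hf f0 h.
have : (\int[mu]_x `|(EFin \o f) x|)%E = 0%E.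
  under eq_integral do rewrite /= ger0_norm//.
  by rewrite EFin_Rint//; congr EFin; apply/le_anti; rewrite h Rint_ge0.
have mf : measurable_fun setT (EFin \o f).
  by apply/measurable_EFinP/(itg_measurable hf).
move=> /(ae_eq_integral_abs mu measurableT mf).1 [A [mA A0 sA]].
exists A; split => //; apply: subset_trans sA => x /= fx0; apply: contra_not fx0.
by move=> /(_ I) [].
Qed.

Lemma eq_Rint_ae f g : measurable_fun setT f -> measurable_fun setT g ->
  {ae mu, forall x, f x = g x} -> \int[mu]_x f x = \int[mu]_x g x.
Proof.
move=> mf mg fg; congr fine; apply: ae_eq_integral => //;
  [exact/measurable_EFinP|exact/measurable_EFinP|].
by apply: filterS fg => x -> _.
Qed.

Lemma itg_ae f g : measurable_fun setT g -> {ae mu, forall x, f x = g x} ->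
  itg mu f -> itg mu g.
Proof.
move=> mg fg hf.
have mf := itg_measurable hf.
apply/integrableP; split; first exact/measurable_EFinP.
have /integrableP[_] := hf; congr (_ < _)%E.
apply: ae_eq_integral => //.
- exact/measurableT_comp/measurable_EFinP.
- exact/measurableT_comp/measurable_EFinP.
by apply: filterS fg => x /= -> _.
Qed.

End integrals.

Section product.
Context {d} {T : measurableType d} {R : realType}.
Variable m : {sigma_finite_measure set T -> \bar R}.
Notation P := (m \x m)%E.
Implicit Types f g : T -> R.

Lemma itg_tensor f g : itg m f -> itg m g -> itg P (fun z => f z.1 * g z.2).
Proof.
move=> hf hg; have mf := itg_measurable hf; have mg := itg_measurable hg.
apply/integrable12ltyP; first by apply/measurable_EFinP; mfun.
under eq_integral do under eq_integral do rewrite /= normrM.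
under eq_integral.
  move=> x _; rewrite (EFin_Rint (itgZ `|f x| (itg_norm hg))).
  rewrite (RintZ _ (itg_norm hg)) mulrC; over.
rewrite EFin_Rint ?ltry//.
exact: (itgZ _ (itg_norm hf)).
Qed.

Lemma Rint_tensor f g : itg m f -> itg m g ->
  \int[P]_z (f z.1 * g z.2) = \int[m]_x f x * \int[m]_x g x.
Proof.
move=> hf hg; rewrite /Rintegral -(integral12_prod_meas1 (itg_tensor hf hg)).
rewrite /fubini_F /=.
under eq_integral.
  move=> x _; rewrite (EFin_Rint (itgZ (f x) hg)) (RintZ _ hg) mulrC; over.
by rewrite (EFin_Rint (itgZ _ hf)) (RintZ _ hf) mulrC.
Qed.

Lemma itg_swap (f : T * T -> R) : itg P f -> itg P (fun z => f (z.2, z.1)).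
Proof.
move=> hf; have mf := itg_measurable hf.
apply/integrable21ltyP.
  apply/measurable_EFinP/(measurableT_comp mf).
  exact: (measurable_fun_pair measurable_snd measurable_fst).
by move/integrable12ltyP : hf; apply; apply/measurable_EFinP.
Qed.

Lemma Rint_swap (f : T * T -> R) : itg P f ->
  \int[P]_z f (z.2, z.1) = \int[P]_z f z.
Proof.
move=> hf; rewrite /Rintegral; congr fine.
by rewrite -(integral21_prod_meas1 (itg_swap hf)) -(integral12_prod_meas1 hf).
Qed.

(** Null sets lift to null cylinders in the product. *)
Lemma ae_prod (Q : T -> Prop) : {ae m, forall x, Q x} ->
  {ae P, forall z, Q z.1 /\ Q z.2}.
Proof.
move=> [A [mA A0 sA]].
have nA1 : P.-negligible (A `*` setT).
  exists (A `*` setT); split => //; first exact: measurableX.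
  apply: etrans; first exact: (product_measure1E m m mA measurableT).
  exact: (etrans (congr1 (fun r => r * _)%E A0) (mul0e _)).
have nA2 : P.-negligible (setT `*` A).
  exists (setT `*` A); split => //; first exact: measurableX.
  apply: etrans; first exact: (product_measure1E m m measurableT mA).
  exact: (etrans (congr1 (fun r => _ * r)%E A0) (mule0 _)).
apply: (negligibleS _ (negligibleU nA1 nA2)).
by move=> [x y] /= /not_andP[h|h]; [left|right] => /=; split => //; exact: sA.
Qed.

End product.

(** * Limits almost everywhere *)

Lemma nneseries_geometric_half_le (R : realType) (u : nat -> \bar R) (C : R) :
  (forall n, (0 <= u n)%E) -> (forall n, (u n <= (C * 2^-1 ^+ n)%:E)%E) ->
  (\big[+%E/0%E]_(0 <= n <oo) u n <= (2 * C)%:E)%E.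
Proof.
move=> u0 uC; have C0 : 0 <= C.
  by rewrite -lee_fin -[C]mulr1 -(expr0 2^-1); exact: le_trans (u0 0) (uC 0).
apply: lime_le; first by apply: is_cvg_nneseries => n _ _; exact: u0.
apply: nearW => n; apply: (@le_trans _ _ (\sum_(0 <= k < n) (C * 2^-1 ^+ k)%:E)%E).
  by apply: lee_sum => k _; exact: uC.
rewrite sumEFin lee_fin; case: n => [|n]; first by rewrite big_geq// mulr_ge0.
suff : \sum_(0 <= i < n.+1) C * 2^-1 ^+ i <= 2 * C - 2 * C * 2^-1 ^+ n.+1.
  by move/le_trans; apply; rewrite gerBl !mulr_ge0// exprn_ge0.
elim: n => [|n IH]; first by rewrite big_nat1 expr0 expr1; lra.
rewrite big_nat_recr//=; apply: le_trans (lerD IH (lexx _)) _.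
rewrite [in leRHS]exprS; lra.
Qed.

Section ae_limits.
Context {d} {T : measurableType d} {R : realType}.
Variable mu : {measure set T -> \bar R}.
Implicit Types f g : T -> R.

(** Fatou's lemma, with a bound for the limit inferior of the integrals and with
    convergence almost everywhere only. *)
Lemma fatou_ae (f : nat -> T -> R) g (B : R) :
  (forall n, measurable_fun setT (f n)) -> measurable_fun setT g ->
  (forall n x, 0 <= f n x) ->
  {ae mu, forall x, f n x @[n --> \oo] --> g x} ->
  (forall e, 0 < e -> \forall n \near \oo, (\int[mu]_x (f n x)%:E <= (B + e)%:E)%E) ->
  (\int[mu]_x (g x)%:E <= B%:E)%E.
Proof.
move=> mf mg f0 fg fB; apply/lee_addgt0Pr => e e0.
have mfE n : measurable_fun setT (fun x => (f n x)%:E) by exact/measurable_EFinP.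
have -> : (\int[mu]_x (g x)%:E = \int[mu]_x limn_einf (fun n => (f n x)%:E))%E.
  apply: ae_eq_integral => //.
  - exact/measurable_EFinP.
  - rewrite (_ : (fun x => _) = fun x => (- limn_esup (fun n => - (f n x)%:E))%E).
      apply: measurableT_comp => //; apply: measurable_fun_limn_esup => n.
      by apply: measurableT_comp => //; exact: mfE.
    apply/funext => x; rewrite -limn_einfN; congr limn_einf.
    by apply/funext => n /=; rewrite opprK.
  apply: filterS fg => x fx _; apply/esym.
  have : (f n x)%:E @[n --> \oo] --> (g x)%:E by apply/cvg_EFin; [exact: nearW|].
  by move=> /cvg_limn_einf_sup[].
apply: le_trans; first by apply: fatou => // n x _; rewrite lee_fin.
rewrite limn_einf_lim; apply: lime_le; first exact: is_cvg_einfs.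
have [N _ NB] := fB e e0.
near=> n; apply: ereal_inf_le; exists (\int[mu]_x (f (maxn N n) x)%:E)%E.
  by exists (maxn N n) => //=; rewrite leq_maxr.
by rewrite -EFinD; apply: NB; rewrite /= leq_maxl.
Unshelve. all: by end_near. Qed.

(** The sum of the increments is integrable, hence finite almost everywhere, and
    there the sequence converges. Taking the superior limit as the limit function
    makes measurability automatic. *)
Lemma L1_geometric_cvg (f : nat -> T -> R) (C : R) :
  (forall n, itg mu (f n)) ->
  (forall n, \int[mu]_x `|f n.+1 x - f n x| <= C * 2^-1 ^+ n) ->
  exists g, [/\ measurable_fun setT g,
    {ae mu, forall x, f n x @[n --> \oo] --> g x},
    (forall n, itg mu (fun x => f n x - g x)) &
    forall n, \int[mu]_x `|f n x - g x| <= 2 * C * 2^-1 ^+ n].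
Proof.
move=> fi fC.
have mf n : measurable_fun setT (f n) := itg_measurable (fi n).
have di n : itg mu (fun x => `|f n.+1 x - f n x|) by apply: itg_norm; exact: itgB.
pose g x := fine (limn_esup (fun n => (f n x)%:E)).
have mg : measurable_fun setT g.
  apply: measurableT_comp => //; apply: measurable_fun_limn_esup => n.
  exact/measurable_EFinP.
have C0 : 0 <= C.
  by have := fC 0; rewrite expr0 mulr1; apply: le_trans; exact: Rint_ge0.
have sumd : (\int[mu]_x \big[+%E/0%E]_(0 <= n <oo) `|f n.+1 x - f n x|%:E <= (2 * C)%:E)%E.
  rewrite integral_nneseries//; last by move=> n; apply/measurable_EFinP; mfun.
  apply: nneseries_geometric_half_le => n; first exact: integral_ge0.
  by rewrite EFin_Rint// lee_fin.
have aecvg : {ae mu, forall x, f n x @[n --> \oo] --> g x}.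
  have ie : mu.-integrable setT (fun x => \big[+%E/0%E]_(0 <= n <oo) `|f n.+1 x - f n x|%:E)%E.
    apply/integrableP; split.
      apply: ge0_emeasurable_sum => //.
      by move=> n _; apply/measurable_EFinP; mfun.
    under eq_integral do rewrite gee0_abs ?nneseries_ge0//.
    by apply: le_lt_trans sumd _; exact: ltry.
  have := integrable_ae measurableT ie; apply: filterS => x /(_ I) fx.
  suff cf : cvgn (fun n => f n x).
    have h : (f n x)%:E @[n --> \oo] --> (limn (fun n => f n x))%:E.
      by apply/cvg_EFin => //; exact: nearW.
    by rewrite /g; have [_ ->] := cvg_limn_einf_sup h.
  have cs : cvgn (series (telescope (fun n => f n x))).
    apply: normed_cvg; apply: nondecreasing_is_cvgn.
      by apply: nondecreasing_series => k _ _; exact: normr_ge0.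
    exists (fine (\big[+%E/0%E]_(0 <= n <oo) `|f n.+1 x - f n x|%:E)%E).
    move=> _ [n _ <-]; rewrite -lee_fin fineK//.
    rewrite /series /= -sumEFin.
    apply: (@nneseries_lim_ge _ (fun n => `|f n.+1 x - f n x|%:E) xpredT 0 n).
    by move=> k _ _; rewrite lee_fin.
  rewrite (_ : (fun n => f n x) = fun n => f 0 x + series (telescope (fun n => f n x)) n).
    apply: is_cvgD => //; exact: is_cvg_cst.
  by apply/funext => n; exact: eq_sum_telescope.
have step n k : \int[mu]_x `|f (n + k)%N x - f n x| <=
    2 * C * (2^-1 ^+ n - 2^-1 ^+ (n + k)).
  elim: k => [|k IH].
    rewrite addn0 subrr mulr0; under eq_Rintegral do rewrite subrr normr0.
    by rewrite Rintegral_cst// mul0r.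
  apply: (@le_trans _ _ (\int[mu]_x `|f (n + k)%N x - f n x| +
      \int[mu]_x `|f (n + k).+1 x - f (n + k)%N x|)).
    rewrite -RintD//; last by apply: itg_norm; exact: itgB.
    rewrite addnS; apply: le_Rint => //.
    - by apply: itg_norm; exact: itgB.
    - by apply: itgD => //; apply: itg_norm; exact: itgB.
    move=> x; rewrite [leRHS]addrC; apply: le_trans (ler_normD _ _).
    by rewrite addrA subrK.
  apply: le_trans (lerD IH (fC _)) _.
  by rewrite addnS [in leRHS]exprS; lra.
have key n : (\int[mu]_x `|f n x - g x|%:E <= (2 * C * 2^-1 ^+ n)%:E)%E.
  apply: (@fatou_ae (fun k x => `|f (n + k)%N x - f n x|)) => //.
  - by move=> k; mfun.
  - by mfun.
  - apply: filterS aecvg => x fx.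
    have -> : `|f n x - g x| = `|g x - f n x| by rewrite distrC.
    apply: cvg_norm; apply: cvgB; last exact: cvg_cst.
    rewrite (_ : (fun k => f (n + k)%N x) = [sequence f (k + n)%N x]_k).
      by move: fx; rewrite -(cvg_shiftn n).
    by apply/funext => k; rewrite addnC.
  move=> e e0; apply: nearW => k; rewrite EFin_Rint ?lee_fin.
    apply: le_trans (step n k) _.
    rewrite mulrBr lerBlDr -addrA lerDl addr_ge0//; first exact: ltW.
    by rewrite !mulr_ge0// exprn_ge0.
  by apply: itg_norm; exact: itgB.
have ki n : itg mu (fun x => f n x - g x).
  apply/integrableP; split; first by apply/measurable_EFinP; mfun.
  exact: le_lt_trans (key n) (ltry _).
exists g; split => // n.
by rewrite -lee_fin -EFin_Rint//; exact: itg_norm.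
Qed.

End ae_limits.

(** * The abstract energy space and quadratic form *)

Section energy_space.
Context {d} {T : measurableType d} {R : realType}.
Variable m : {sigma_finite_measure set T -> \bar R}.
Variables (D : set T) (kn kf : T * T -> R) (c rho : R).
Notation P := (m \x m)%E.
Implicit Types u v w : T -> R.

(** What is used of the two kernels obtained by cutting [1 / |x - y| ^ N] at
    distance one: the near kernel may be singular, the far kernel is bounded. *)
Definition admissible_kernels :=
  [/\ measurable D, (m D < +oo)%E,
      measurable_fun setT kn /\ (forall z, 0 <= kn z),
      measurable_fun setT kf /\ (forall z, 0 <= kf z <= 1) &
      forall x y, kf (x, y) = kf (y, x)].

(** Functions vanish everywhere outside [D], not only almost everywhere, so that
    the inequalities between integrands below hold at every point. *)
Definition energy_space u :=
  [/\ measurable_fun setT u, itg m (fun x => u x ^+ 2),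
      (forall x, ~ D x -> u x = 0) &
      itg P (fun z => (u z.1 - u z.2) ^+ 2 * kn z)].

Definition near_form u v := \int[P]_z ((u z.1 - u z.2) * (v z.1 - v z.2) * kn z).
Definition far_form u v := \int[P]_z (u z.1 * v z.2 * kf z).
Definition dot u v := \int[m]_x (u x * v x).
Definition form u v := c / 2 * near_form u v - c * far_form u v + rho * dot u v.

Hypothesis adm : admissible_kernels.

Let mD : measurable D. Proof. by case: adm. Qed.
Let finD : (m D < +oo)%E. Proof. by case: adm. Qed.
Let mkn : measurable_fun setT kn. Proof. by case: adm => ? ? []. Qed.
Let kn0 z : 0 <= kn z. Proof. by case: adm => ? ? []. Qed.
Let mkf : measurable_fun setT kf. Proof. by case: adm => ? ? ? []. Qed.
Let kf01 z : 0 <= kf z <= 1. Proof. by case: adm => ? ? ? []. Qed.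
Let kfC x y : kf (x, y) = kf (y, x). Proof. by case: adm. Qed.

Lemma energy_space_measurable u : energy_space u -> measurable_fun setT u.
Proof. by case. Qed.

(** The support has finite measure, and [`|u| <= 1 + u ^+ 2]. *)
Lemma energy_space_integrable u : energy_space u -> itg m u.
Proof.
move=> [mu u2 u0 _]; apply: (itg_dom (g := fun x => \1_D x + u x ^+ 2)) => //.
  by apply: itgD => //; exact: itg_indic.
move=> x; rewrite indicE; case: (boolP (x \in D)) => [_|xD].
  rewrite -(real_normK (num_real (u x))) /=.
  by have := normr_ge0 (u x); nra.
rewrite (u0 x) ?normr0 ?expr0n/= ?addr0//.
by move=> Dx; rewrite mem_set in xD.
Qed.

Lemma energy_space_mul u v : energy_space u -> energy_space v ->
  itg m (fun x => u x * v x).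
Proof.
move=> [mu u2 _ _] [mv v2 _ _].
apply: (itg_dom (g := fun x => u x ^+ 2 + v x ^+ 2)); [mfun|exact: itgD|].
by move=> x; exact: normr_mul_le_sqr.
Qed.

Lemma energy_space_near u v : energy_space u -> energy_space v ->
  itg P (fun z => (u z.1 - u z.2) * (v z.1 - v z.2) * kn z).
Proof.
move=> [mu _ _ Nu] [mv _ _ Nv].
apply: (itg_dom (g := fun z => (u z.1 - u z.2) ^+ 2 * kn z +
  (v z.1 - v z.2) ^+ 2 * kn z)); [mfun|exact: itgD|].
move=> z; rewrite -mulrDl normrM (ger0_norm (kn0 z)) ler_wpM2r//.
exact: normr_mul_le_sqr.
Qed.

Lemma far_integrable u v : itg m u -> itg m v ->
  itg P (fun z => u z.1 * v z.2 * kf z).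
Proof.
move=> iu iv; have mu := itg_measurable iu; have mv := itg_measurable iv.
apply: (itg_dom (g := fun z => `|u z.1| * `|v z.2|)); [mfun| |].
  exact: (itg_tensor (itg_norm iu) (itg_norm iv)).
move=> z; have /andP[k0 k1] := kf01 z.
by rewrite 2!normrM (ger0_norm k0) ler_piMr.
Qed.

Lemma energy_space_far u v : energy_space u -> energy_space v ->
  itg P (fun z => u z.1 * v z.2 * kf z).
Proof. by move=> hu hv; apply: far_integrable; exact: energy_space_integrable. Qed.

(** Lipschitz functions of two elements of the energy space stay in it. All
    sums, truncations, means and quotients used below are of this kind. *)
Lemma energy_space_lipschitz L w u v : energy_space u -> energy_space v ->
  measurable_fun setT w ->
  (forall x, `|w x| <= L * (`|u x| + `|v x|)) ->
  (forall x y, `|w x - w y| <= L * (`|u x - u y| + `|v x - v y|)) ->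
  energy_space w.
Proof.
move=> [mu u2 u0 Nu] [mv v2 v0 Nv] mw wL wLL.
have key (a p q : R) : `|a| <= L * (`|p| + `|q|) ->
    a ^+ 2 <= (2 * L ^+ 2) * (p ^+ 2 + q ^+ 2).
  move=> h; rewrite -(real_normK (num_real a)) -(real_normK (num_real p)).
  rewrite -(real_normK (num_real q)).
  have : `|a| ^+ 2 <= (L * (`|p| + `|q|)) ^+ 2.
    by rewrite ler_pXn2r// ?nnegrE// (le_trans _ h).
  move/le_trans; apply; rewrite exprMn.
  have -> : 2 * L ^+ 2 * (`|p| ^+ 2 + `|q| ^+ 2) =
    L ^+ 2 * (2 * (`|p| ^+ 2 + `|q| ^+ 2)) by ring.
  by rewrite ler_wpM2l ?sqr_ge0//; have := sqr_ge0 (`|p| - `|q|); lra.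
split => //.
- apply: (itg_dom (g := fun x => (2 * L ^+ 2) * (u x ^+ 2 + v x ^+ 2))); first mfun.
    by apply: itgZ; exact: itgD.
  by move=> x; rewrite ger0_norm ?sqr_ge0//; exact: key.
- move=> x xD; have := wL x; rewrite u0// v0// !normr0 addr0 mulr0.
  by rewrite normr_le0 => /eqP.
- apply: (itg_dom (g := fun z => (2 * L ^+ 2) * ((u z.1 - u z.2) ^+ 2 * kn z +
    (v z.1 - v z.2) ^+ 2 * kn z))); first mfun.
    by apply: itgZ; exact: itgD.
  move=> z; rewrite ger0_norm; last by rewrite mulr_ge0 ?sqr_ge0.
  by rewrite -mulrDl mulrA ler_wpM2r//; exact: key.
Qed.

Lemma energy_space_add t u v : energy_space u -> energy_space v ->
  energy_space (fun x => u x + t * v x).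
Proof.
move=> hu hv; have mu := energy_space_measurable hu.
have mv := energy_space_measurable hv.
apply: (energy_space_lipschitz (L := 1 + `|t|) hu hv); first mfun.
  move=> x; apply: le_trans (ler_normD _ _) _; rewrite normrM.
  have := normr_ge0 t; have := normr_ge0 (u x); have := normr_ge0 (v x); nra.
move=> x y.
have -> : u x + t * v x - (u y + t * v y) = (u x - u y) + t * (v x - v y) by ring.
apply: le_trans (ler_normD _ _) _; rewrite normrM.
have := normr_ge0 t; have := normr_ge0 (u x - u y); have := normr_ge0 (v x - v y).
nra.
Qed.

Lemma far_formC u v : energy_space u -> energy_space v -> far_form u v = far_form v u.
Proof.
move=> hu hv; rewrite /far_form -(Rint_swap (energy_space_far hu hv)) /=.
by congr fine; apply: eq_integral => -[x y] _ /=; rewrite kfC [v x * u y]mulrC.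
Qed.

Lemma form_expand t u v : energy_space u -> energy_space v ->
  form (fun x => u x + t * v x) (fun x => u x + t * v x) =
  form u u + t * (2 * form u v) + t ^+ 2 * form v v.
Proof.
move=> hu hv.
have i1 := energy_space_near hu hu; have i2 := energy_space_near hu hv.
have i3 := energy_space_near hv hv.
have j1 := energy_space_far hu hu; have j2 := energy_space_far hu hv.
have j2' := energy_space_far hv hu.
have j3 := energy_space_far hv hv.
have k1 := energy_space_mul hu hu; have k2 := energy_space_mul hu hv.
have k3 := energy_space_mul hv hv.
have en : near_form (fun x => u x + t * v x) (fun x => u x + t * v x) =
    near_form u u + (2 * t) * near_form u v + t ^+ 2 * near_form v v.
  rewrite /near_form -(RintZ (2 * t) i2) -(RintZ (t ^+ 2) i3).
  rewrite -(RintD i1 (itgZ _ i2)) -(RintD (itgD i1 (itgZ _ i2)) (itgZ _ i3)).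
  by apply: eq_Rintegral => z _ /=; ring.
have ef : far_form (fun x => u x + t * v x) (fun x => u x + t * v x) =
    far_form u u + (2 * t) * far_form u v + t ^+ 2 * far_form v v.
  have -> : (2 * t) * far_form u v = t * far_form u v + t * far_form v u.
    by rewrite (far_formC hv hu); ring.
  rewrite /far_form -(RintZ t j2) -(RintZ t j2') -(RintZ (t ^+ 2) j3).
  rewrite -(RintD (itgZ _ j2) (itgZ _ j2')).
  rewrite -(RintD j1 (itgD (itgZ _ j2) (itgZ _ j2'))).
  rewrite -(RintD (itgD j1 (itgD (itgZ _ j2) (itgZ _ j2'))) (itgZ _ j3)).
  by apply: eq_Rintegral => z _ /=; ring.
have ed : dot (fun x => u x + t * v x) (fun x => u x + t * v x) =
    dot u u + (2 * t) * dot u v + t ^+ 2 * dot v v.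
  rewrite /dot -(RintZ (2 * t) k2) -(RintZ (t ^+ 2) k3).
  rewrite -(RintD k1 (itgZ _ k2)) -(RintD (itgD k1 (itgZ _ k2)) (itgZ _ k3)).
  by apply: eq_Rintegral => z _ /=; ring.
by rewrite /form en ef ed; ring.
Qed.

End energy_space.

(** * The action and its convexity *)

Lemma measurable_entropy d (T : measurableType d) (R : realType) (u : T -> R) :
  measurable_fun setT u -> measurable_fun setT (fun x => entropy (u x)).
Proof.
move=> mu; rewrite /entropy; apply: measurable_funB.
  by apply: measurable_funM; mfun.
by mfun.
Qed.

Section action.
Context {d} {T : measurableType d} {R : realType}.
Variable m : {sigma_finite_measure set T -> \bar R}.
Variables (D : set T) (kn kf : T * T -> R) (c rho mu : R).
Notation P := (m \x m)%E.
Notation energy := (energy_space m D kn).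
Notation E := (form m kn kf c rho).
Notation near := (near_form m kn).
Notation far := (far_form m kf).
Notation G := (potential rho mu).
Notation dG := (dpotential rho mu).
Implicit Types (u v w : T -> R) (M t : R).

(** The functional whose critical points are the weak solutions. *)
Definition action u := E u u / 2 + mu * \int[m]_x entropy (u x).

(** The upper bound makes all terms but the near part trivially finite. *)
Definition competitor M u := energy u /\ forall x, 0 <= u x <= M.

Hypothesis adm : admissible_kernels m D kn kf.
Hypothesis c0 : 0 < c.
Hypothesis mu0 : 0 < mu.

Let mD : measurable D. Proof. by case: adm. Qed.
Let finD : (m D < +oo)%E. Proof. by case: adm. Qed.
Let kn0 z : 0 <= kn z. Proof. by case: adm => ? ? []. Qed.
Let kf01 z : 0 <= kf z <= 1. Proof. by case: adm => ? ? ? []. Qed.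

Let V : R := \int[m]_x \1_D x.
Let V0 : 0 <= V. Proof. exact: Rint_ge0. Qed.
Let i1D : itg m (\1_D : T -> R). Proof. exact: itg_indic. Qed.

Lemma supp_integrable (f : T -> R) B : measurable_fun setT f ->
  (forall x, ~ D x -> f x = 0) -> (forall x, `|f x| <= B) -> itg m f.
Proof.
move=> mf f0 fB; apply: (itg_dom (g := fun x => B * \1_D x)) => //.
  exact: itgZ.
move=> x; rewrite indicE; case: (boolP (x \in D)) => [_|xD].
  by rewrite mulr1.
by rewrite f0 ?normr0 ?mulr0// => Dx; rewrite mem_set in xD.
Qed.

Lemma potential0 : G 0 = 0.
Proof. by rewrite /potential entropy0 expr0n/= !mulr0 addr0. Qed.

Lemma measurable_potential u : measurable_fun setT u ->
  measurable_fun setT (fun x => G (u x)).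
Proof.
move=> mu_; rewrite /potential; apply: measurable_funD; first by mfun.
by apply: measurable_funM; [mfun|exact: measurable_entropy].
Qed.

Lemma competitor_supp M u : competitor M u -> forall x, ~ D x -> u x = 0.
Proof. by move=> [[]]. Qed.

Lemma competitor_entropy M u : competitor M u -> itg m (fun x => entropy (u x)).
Proof.
move=> [hu uM]; have mu_ := energy_space_measurable hu.
apply: (supp_integrable (B := M * (1 + M ^+ 2) + M ^+ 2)).
- exact: measurable_entropy.
- by case: hu => _ _ u0 _ x xD; rewrite u0// entropy0.
move=> x; have /andP[u0 u1] := uM x; apply: le_trans (abs_entropy_le u0) _.
have : u x ^+ 2 <= M ^+ 2 by rewrite ler_pXn2r// nnegrE; lra.
have := sqr_ge0 (u x); nra.
Qed.

Lemma competitor_potential M u : competitor M u -> itg m (fun x => G (u x)).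
Proof.
move=> cu; apply: itgD; last exact/itgZ/(competitor_entropy cu).
by apply: itgZ; case: cu => -[].
Qed.

(** Separates the near part, which is only lower semicontinuous, from the terms
    that are continuous in [L^1] for bounded functions. *)
Lemma actionE M u : competitor M u ->
  action u = c / 4 * near u u + (\int[m]_x G (u x) - c / 2 * far u u).
Proof.
move=> cu; have [hu _] := cu.
have -> : \int[m]_x G (u x) = rho / 2 * dot m u u + mu * \int[m]_x entropy (u x).
  have i1 := energy_space_mul hu hu; have i2 := competitor_entropy cu.
  by rewrite /dot -(RintZ _ i1) -(RintZ _ i2) -(RintD (itgZ _ i1) (itgZ _ i2)).
by rewrite /action /form; field.
Qed.

Lemma far_competitor_le M u : competitor M u -> far u u <= M ^+ 2 * V ^+ 2.
Proof.
move=> cu; have [hu uM] := cu.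
have -> : M ^+ 2 * V ^+ 2 = \int[P]_z ((M * \1_D z.1) * (M * \1_D z.2)).
  rewrite (Rint_tensor (itgZ M i1D) (itgZ M i1D)) (RintZ _ i1D) -/V; ring.
apply: le_Rint.
- exact: (energy_space_far adm hu hu).
- exact: (itg_tensor (itgZ M i1D) (itgZ M i1D)).
have h x : 0 <= u x <= M * \1_D x.
  rewrite indicE; case: (boolP (x \in D)) => [_|xD]; first by rewrite mulr1.
  by rewrite (competitor_supp cu) ?mulr0 ?lexx// => Dx; rewrite mem_set in xD.
move=> z; have /andP[a1 a2] := h z.1; have /andP[b1 b2] := h z.2.
have /andP[k1 k2] := kf01 z.
apply: le_trans (ler_pM a1 b1 a2 b2).
by rewrite ler_piMr// mulr_ge0.
Qed.

Lemma action_bounded_below M : exists B, forall u, competitor M u -> B <= action u.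
Proof.
pose B := `|rho| * M ^+ 2 + mu * (M * (1 + M ^+ 2) + M ^+ 2).
exists (- (B * V) - c / 2 * (M ^+ 2 * V ^+ 2)) => u cu; rewrite (actionE cu).
have h1 : 0 <= near u u.
  by apply: Rint_ge0 => z; rewrite mulr_ge0// -expr2 sqr_ge0.
have h2 := far_competitor_le cu.
have h3 : - (B * V) <= \int[m]_x G (u x).
  rewrite -mulNr -(RintZ _ i1D); apply: le_Rint; first exact: itgZ.
    exact: competitor_potential cu.
  move=> x; rewrite indicE; case: (boolP (x \in D)) => [_|xD].
    have [_ uM] := cu; have := normr_potential_le rho mu0 (uM x).
    by rewrite mulr1 ler_norml -/B => /andP[].
  rewrite (competitor_supp cu) ?potential0 ?mulr0// => Dx.
  by rewrite mem_set in xD.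
have := mulr_ge0 (ltW c0) h1; have := ler_wpM2l (ltW c0) h2; lra.
Qed.

Lemma competitor_sqmean M t u v : 0 <= t <= 1 -> competitor M u -> competitor M v ->
  competitor M (fun x => sqmean t (u x) (v x)).
Proof.
move=> t01 [hu uM] [hv vM]; split; last first.
  by move=> x; rewrite sqmean_ge0 sqmean_le.
have mu_ := energy_space_measurable hu; have mv := energy_space_measurable hv.
have /andP[t0 t1] := t01.
have sq (s a b : R) : 0 <= s -> 0 <= a -> 0 <= b ->
    s ^+ 2 <= (1 - t) * a ^+ 2 + t * b ^+ 2 -> s <= 1 * (a + b).
  move=> s0 a0 b0 h; rewrite mul1r -(@ler_pXn2r _ 2)// ?nnegrE ?addr_ge0//.
  apply: (le_trans h); have := sqr_ge0 a; have := sqr_ge0 b.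
  by have := mulr_ge0 a0 b0; nra.
apply: (energy_space_lipschitz adm (L := 1) hu hv).
- by rewrite /sqmean; mfun.
- move=> x; apply: sq => //; rewrite ?real_normK ?num_real//.
  by rewrite sqr_sqmean.
- move=> x y; apply: sq => //; rewrite ?real_normK ?num_real//.
  have /andP[a1 a2] := uM x; have /andP[a3 a4] := uM y.
  have /andP[b1 b2] := vM x; have /andP[b3 b4] := vM y.
  exact: sqmean_contract.
Qed.

(** The form is convex in [u ^+ 2]: the near part is jointly convex, the far part
    enters with a negative sign and is concave, and the [L^2] part is linear. *)
Lemma form_sqmean_le M t u v : 0 <= t <= 1 -> competitor M u -> competitor M v ->
  E (fun x => sqmean t (u x) (v x)) (fun x => sqmean t (u x) (v x)) <=
  (1 - t) * E u u + t * E v v.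
Proof.
move=> t01 cu cv; have [hs _] := competitor_sqmean t01 cu cv.
have [hu uM] := cu; have [hv vM] := cv.
have u0 x : 0 <= u x by have /andP[] := uM x.
have v0 x : 0 <= v x by have /andP[] := vM x.
have e1 : near (fun x => sqmean t (u x) (v x)) (fun x => sqmean t (u x) (v x)) <=
    (1 - t) * near u u + t * near v v.
  have i1 := energy_space_near adm hu hu; have i2 := energy_space_near adm hv hv.
  rewrite /near_form -(RintZ _ i1) -(RintZ _ i2) -(RintD (itgZ _ i1) (itgZ _ i2)).
  apply: le_Rint; first exact: (energy_space_near adm hs hs).
    exact: (itgD (itgZ _ i1) (itgZ _ i2)).
  move=> z; rewrite !mulrA -mulrDl ler_wpM2r// -!mulrA -!expr2.
  exact: sqmean_contract.
have e2 : (1 - t) * far u u + t * far v v <=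
    far (fun x => sqmean t (u x) (v x)) (fun x => sqmean t (u x) (v x)).
  have i1 := energy_space_far adm hu hu; have i2 := energy_space_far adm hv hv.
  rewrite /far_form -(RintZ _ i1) -(RintZ _ i2) -(RintD (itgZ _ i1) (itgZ _ i2)).
  apply: le_Rint; [exact: (itgD (itgZ _ i1) (itgZ _ i2))|exact: (energy_space_far adm hs hs)|].
  move=> z; have /andP[k0 _] := kf01 z.
  rewrite !mulrA -mulrDl ler_wpM2r// -!mulrA.
  exact: sqmeanM_ge.
have e3 : dot m (fun x => sqmean t (u x) (v x)) (fun x => sqmean t (u x) (v x)) =
    (1 - t) * dot m u u + t * dot m v v.
  have i1 := energy_space_mul hu hu; have i2 := energy_space_mul hv hv.
  rewrite /dot -(RintZ _ i1) -(RintZ _ i2) -(RintD (itgZ _ i1) (itgZ _ i2)).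
  by apply: eq_Rintegral => x _; rewrite -!expr2 sqr_sqmean.
rewrite /form e3.
have := ler_wpM2l (ltW c0) e1; have := ler_wpM2l (ltW c0) e2; lra.
Qed.

(** The form is convex and the entropy strictly so. *)
Lemma action_midpoint M u v : competitor M u -> competitor M v ->
  action (fun x => sqmean 2^-1 (u x) (v x)) +
    mu / 16 * \int[m]_x (u x - v x) ^+ 2 <= (action u + action v) / 2.
Proof.
move=> cu cv; have cs := competitor_sqmean (@half01 R) cu cv.
have [hu uM] := cu; have [hv vM] := cv.
have h1 := form_sqmean_le (@half01 R) cu cv.
have iuv : itg m (fun x => (u x - v x) ^+ 2).
  have [_ + _ _] := energy_space_add adm (-1) hu hv.
  by under eq_fun do rewrite mulN1r.
have iu := competitor_entropy cu; have iv := competitor_entropy cv.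
have ist := competitor_entropy cs.
have h2 : \int[m]_x entropy (sqmean 2^-1 (u x) (v x)) +
    16^-1 * \int[m]_x (u x - v x) ^+ 2 <=
    2^-1 * \int[m]_x entropy (u x) + 2^-1 * \int[m]_x entropy (v x).
  rewrite -(RintZ _ iuv) -(RintZ _ iu) -(RintZ _ iv).
  rewrite -(RintD ist (itgZ _ iuv)) -(RintD (itgZ _ iu) (itgZ _ iv)).
  apply: le_Rint; [exact: (itgD ist (itgZ _ iuv))|exact: (itgD (itgZ _ iu) (itgZ _ iv))|].
  move=> x; have /andP[u0 _] := uM x; have /andP[v0 _] := vM x.
  rewrite /entropy !ger0_norm ?sqmean_ge0//.
  have := sqmean_half_entropy u0 v0; have := sqr_sqmean (@half01 R) (u x) (v x).
  by move: (sqmean _ _ _) => s; lra.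
have := ler_wpM2l (ltW mu0) h2; rewrite /action; lra.
Qed.

End action.

(** * Existence of a minimizer *)

Section minimizer.
Context {d} {T : measurableType d} {R : realType}.
Variable m : {sigma_finite_measure set T -> \bar R}.
Variables (D : set T) (kn kf : T * T -> R) (c rho mu : R).
Notation P := (m \x m)%E.
Notation energy := (energy_space m D kn).
Notation E := (form m kn kf c rho).
Notation near := (near_form m kn).
Notation far := (far_form m kf).
Notation G := (potential rho mu).
Notation dG := (dpotential rho mu).
Notation J := (action m kn kf c rho mu).
Notation competitor := (competitor m D kn).
Implicit Types (u v w : T -> R) (M t : R).

Hypothesis adm : admissible_kernels m D kn kf.
Hypothesis c0 : 0 < c.
Hypothesis mu0 : 0 < mu.

Let mD : measurable D. Proof. by case: adm. Qed.
Let finD : (m D < +oo)%E. Proof. by case: adm. Qed.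
Let mkn : measurable_fun setT kn. Proof. by case: adm => ? ? []. Qed.
Let kn0 z : 0 <= kn z. Proof. by case: adm => ? ? []. Qed.
Let kf01 z : 0 <= kf z <= 1. Proof. by case: adm => ? ? ? []. Qed.

Let V : R := \int[m]_x \1_D x.
Let V0 : 0 <= V. Proof. exact: Rint_ge0. Qed.
Let i1D : itg m (\1_D : T -> R). Proof. exact: itg_indic. Qed.

(** [2 * `|y| <= r + y ^+ 2 / r], integrated over the support. *)
Lemma L1_dist_le r f : 0 < r -> itg m f -> itg m (fun x => f x ^+ 2) ->
  (forall x, ~ D x -> f x = 0) ->
  \int[m]_x `|f x| <= r * V + r^-1 * \int[m]_x (f x ^+ 2).
Proof.
move=> r0 fi f2 fD; rewrite -(RintZ _ i1D) -(RintZ _ f2) -(RintD (itgZ _ i1D) (itgZ _ f2)).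
apply: le_Rint; [exact: itg_norm|exact: (itgD (itgZ _ i1D) (itgZ _ f2))|].
move=> x; rewrite indicE; case: (boolP (x \in D)) => [_|xD]; last first.
  rewrite fD ?normr0 ?expr0n/= ?mulr0 ?addr0//.
  by move=> Dx; rewrite mem_set in xD.
rewrite mulr1 -(real_normK (num_real (f x))); have := normr_ge0 (f x).
move: `|f x| => y y0.
rewrite -subr_ge0; have -> : r + r^-1 * y ^+ 2 - y = ((r - y) ^+ 2 + r * y) / r.
  by field; rewrite gt_eqF.
by rewrite divr_ge0 ?addr_ge0 ?sqr_ge0 ?mulr_ge0// ltW.
Qed.

(** One-sided continuity in [L^1] of the action without its near part. The
    first order expansion of the potential at [u] provides the side on which the
    action of a limit [v] is bounded from above. *)
Lemma potential_rest_le M u v : 1 <= M -> competitor M u ->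
  measurable_fun setT v -> (forall x, ~ D x -> v x = 0) -> (forall x, 0 <= v x <= M) ->
  \int[m]_x G (v x) - c / 2 * \int[P]_z (v z.1 * v z.2 * kf z) <=
  \int[m]_x G (u x) - c / 2 * far u u +
  (`|rho| * M + mu * (1 + M ^+ 2) + (`|rho| + mu * (ln M / 2 + 1)) * M + c * M * V)
   * \int[m]_x `|u x - v x|.
Proof.
move=> M1 cu mv vD vM; have [hu uM] := cu; have mu_ := energy_space_measurable hu.
have u1 := energy_space_integrable adm hu.
have v1 : itg m v.
  apply: (supp_integrable adm (B := M)) => // x.
  by have /andP[v0 v1] := vM x; rewrite ger0_norm.
have dist1 : itg m (fun x => `|u x - v x|) by apply: itg_norm; exact: itgB.
set K0 := `|rho| + mu * (ln M / 2 + 1); set B' := `|rho| * M + mu * (1 + M ^+ 2).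
have K00 : 0 <= K0.
  have := mulr_ge0 (ltW mu0) (ln_ge0 M1); have := normr_ge0 rho; rewrite /K0.
  by have := mu0; lra.
have hp : \int[m]_x G (v x) <=
    \int[m]_x G (u x) + (B' + K0 * M) * \int[m]_x `|u x - v x|.
  have i1 := competitor_potential rho mu adm cu.
  rewrite -(RintZ _ dist1) -(RintD i1 (itgZ _ dist1)); apply: le_Rint.
  - apply: (supp_integrable adm (B := `|rho| * M ^+ 2 + mu * (M * (1 + M ^+ 2) + M ^+ 2))).
    + exact: measurable_potential.
    + by move=> x xD; rewrite vD// potential0.
    + by move=> x; exact: normr_potential_le.
  - exact: (itgD i1 (itgZ _ dist1)).
  move=> x; have /andP[v0 vM'] := vM x; have /andP[u0 uM'] := uM x.
  have vM'' : `|v x| <= M by rewrite ger0_norm.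
  apply: le_trans (potential_bregman rho mu0 M1 (uM x) vM'') _.
  rewrite -/K0 -addrA lerD2l [leRHS]mulrDl; apply: lerD.
    apply: le_trans (ler_norm _) _; rewrite normrM (distrC (v x)) ler_wpM2r//.
    exact: normr_dpotential_le.
  rewrite -(real_normK (num_real (v x - u x))) (distrC (v x)) expr2 -mulrA.
  rewrite ler_wpM2l// ler_wpM2r//.
  by rewrite ler_norml; apply/andP; split; lra.
have hf : far u u <= \int[P]_z (v z.1 * v z.2 * kf z) + 2 * (M * V) * \int[m]_x `|u x - v x|.
  have i1 := far_integrable adm v1 v1.
  have i2 := itg_tensor (itgZ M i1D) dist1.
  have i3 := itg_tensor dist1 (itgZ M i1D).
  have -> : 2 * (M * V) * \int[m]_x `|u x - v x| =
    \int[P]_z ((M * \1_D z.1) * `|u z.2 - v z.2|) +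
    \int[P]_z (`|u z.1 - v z.1| * (M * \1_D z.2)).
    rewrite (Rint_tensor (itgZ M i1D) dist1) (Rint_tensor dist1 (itgZ M i1D)).
    by rewrite (RintZ _ i1D) -/V; ring.
  rewrite -(RintD i2 i3) -(RintD i1 (itgD i2 i3)).
  apply: le_Rint; [exact: (far_integrable adm u1 u1)|exact: (itgD i1 (itgD i2 i3))|].
  have bnd w : (forall x, ~ D x -> w x = 0) -> (forall x, 0 <= w x <= M) ->
      forall x, 0 <= w x <= M * \1_D x.
    move=> wD wM x; rewrite indicE; case: (boolP (x \in D)) => [_|xD].
      by rewrite mulr1.
    by rewrite wD ?mulr0 ?lexx// => Dx; rewrite mem_set in xD.
  move=> z; have /andP[k0 k1] := kf01 z.
  have /andP[a0 a1] := bnd u (competitor_supp cu) uM z.1.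
  have /andP[b0 b1] := bnd v vD vM z.2.
  rewrite -lerBlDl -mulrBl.
  have -> : u z.1 * u z.2 - v z.1 * v z.2 =
    u z.1 * (u z.2 - v z.2) + (u z.1 - v z.1) * v z.2 by ring.
  rewrite mulrDl; apply: lerD.
    apply: le_trans (ler_norm _) _; rewrite 2!normrM (ger0_norm k0) (ger0_norm a0).
    by apply: le_trans (ler_piMr _ k1) _; [exact: mulr_ge0|exact: ler_wpM2r].
  apply: le_trans (ler_norm _) _; rewrite 2!normrM (ger0_norm k0) (ger0_norm b0).
  by apply: le_trans (ler_piMr _ k1) _; [exact: mulr_ge0|exact: ler_wpM2l].
move: hp (ler_wpM2l (ltW c0) hf); clear.
move: (\int[m]_x `|u x - v x|) (far u u) (\int[P]_z (v z.1 * v z.2 * kf z)).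
move: (\int[m]_x G (u x)) (\int[m]_x G (v x)) K0 B' V.
by move=> *; lra.
Qed.

(** A minimizing sequence whose excess decreases like [8^-n] has increments of
    size [2^-n] in [L^1] by midpoint convexity, hence converges almost everywhere
    and in [L^1]; the near part passes to the limit by Fatou's lemma. *)
Lemma exists_minimizer M : 1 <= M -> exists u, competitor M u /\
  forall v, competitor M v -> J u <= J v.
Proof.
move=> M1; have M0 : 0 <= M by lra.
pose S := [set a | exists2 u, competitor M u & a = J u].
have [B HB] := action_bounded_below rho adm c0 mu0 M.
have S0 : has_inf S.
  split; last by exists B => _ [u cu ->]; exact: HB.
  exists (J (fun _ => 0)), (fun _ => 0) => //; split; last by move=> x; rewrite lexx.
  split => //.
  - rewrite (_ : EFin \o _ = cst 0%E); first exact: integrable0.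
    by apply/funext => z /=; rewrite expr0n.
  - rewrite (_ : EFin \o _ = cst 0%E); first exact: integrable0.
    by apply/funext => z /=; rewrite subrr expr0n/= mul0r.
set I := inf S.
have Ile v : competitor M v -> I <= J v.
  by move=> cv; apply: ge_inf; [case: S0|exists v].
pose r n : R := 2^-1 ^+ n.
have r0 n : 0 < r n by rewrite exprn_gt0.
have r1 n : r n <= 1 by rewrite exprn_ile1//; lra.
have /choice[u hu] : forall n, exists u, competitor M u /\ J u <= I + r n ^+ 3.
  move=> n; have [_ [u cu ->] uI] := inf_adherent (exprn_gt0 3 (r0 n)) S0.
  by exists u; split => //; exact: ltW.
have cu n : competitor M (u n) by have [] := hu n.
have eu n : energy (u n) by have [] := cu n.
have du n : energy (fun x => u n.+1 x - u n x).
  by have := energy_space_add adm (-1) (eu n.+1) (eu n); under eq_fun do rewrite mulN1r.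
(* The midpoint of two terms is a competitor, so its action is at least [I]. *)
have d2 n : \int[m]_x ((u n.+1 x - u n x) ^+ 2) <= 16 / mu * r n ^+ 3.
  have h1 := action_midpoint rho adm c0 mu0 (cu n.+1) (cu n).
  have h2 := Ile _ (competitor_sqmean adm (half01) (cu n.+1) (cu n)).
  have [_ h3] := hu n; have [_ h4] := hu n.+1.
  have h5 : r n.+1 ^+ 3 <= r n ^+ 3.
    rewrite ler_pXn2r// ?nnegrE ?(ltW (r0 _))// /r exprS.
    by have := r0 n; rewrite /r; lra.
  have h6 : mu / 16 * \int[m]_x ((u n.+1 x - u n x) ^+ 2) <= r n ^+ 3 by lra.
  have q0 : 0 <= 16 / mu by rewrite divr_ge0// ltW.
  have := ler_wpM2l q0 h6.
  rewrite mulrA (_ : 16 / mu * (mu / 16) = 1) ?mul1r//.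
  by field; rewrite gt_eqF.
pose C := V + 16 / mu.
have C0 : 0 <= C by rewrite addr_ge0// divr_ge0// ltW.
have d1 n : \int[m]_x `|u n.+1 x - u n x| <= C * 2^-1 ^+ n.
  have [_ h2 hD _] := du n.
  apply: le_trans (L1_dist_le (r0 n) (energy_space_integrable adm (du n)) h2 hD) _.
  rewrite mulrDl; apply: lerD; first by rewrite mulrC.
  apply: (@le_trans _ _ ((r n)^-1 * (16 / mu * r n ^+ 3))).
    by rewrite ler_wpM2l// invr_ge0 ltW.
  have -> : (r n)^-1 * (16 / mu * r n ^+ 3) = 16 / mu * r n * r n.
    by field; rewrite !gt_eqF.
  rewrite -/(r n) ler_piMr// mulr_ge0 ?divr_ge0// ltW//.
have [g [mg gcv gi gd]] := L1_geometric_cvg (fun n => energy_space_integrable adm (eu n)) d1.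
(* The clipping changes the limit on a null set only. *)
pose w x := if x \in D then Num.max 0 (Num.min (g x) M) else 0.
have mw : measurable_fun setT w.
  rewrite (_ : w = (fun x => \1_D x * Num.max 0 (Num.min (g x) M))).
    by apply: measurable_funM; [exact: measurable_indic|mfun].
  by apply/funext => x; rewrite /w indicE; case: ifP; rewrite ?mul1r ?mul0r.
have wM x : 0 <= w x <= M.
  rewrite /w; case: ifP => _; last by rewrite lexx.
  by rewrite le_max lexx/= ge_max M0 ge_min lexx orbT.
have wD x : ~ D x -> w x = 0.
  by rewrite /w => xD; rewrite ifN//; apply/negP; rewrite inE.
have uM n x : 0 <= u n x <= M by have [_] := cu n; exact.
have gw : {ae m, forall x, g x = w x}.
  apply: filterS gcv => x xg; rewrite /w; case: ifPn => xD; last first.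
    apply: (cvg_unique _ xg) => //.
    rewrite (_ : (fun n => u n x) = fun=> 0); first exact: cvg_cst.
    apply/funext => n; apply: (competitor_supp (cu n)) => Dx.
    by rewrite mem_set in xD.
  have g0 : 0 <= g x.
    by apply: (cvgr_to_ge xg); apply: nearW => n; have /andP[] := uM n x.
  have gM : g x <= M.
    by apply: (cvgr_to_le xg); apply: nearW => n; have /andP[] := uM n x.
  by rewrite (min_idPl gM) (max_idPr g0).
have wcv : {ae m, forall x, u n x @[n --> \oo] --> w x}.
  by apply: filterS2 gcv gw => x + <-.
have wd n : \int[m]_x `|u n x - w x| <= 2 * C * r n.
  have mun := energy_space_measurable (eu n).
  apply: le_trans (gd n); rewrite le_eqVlt; apply/orP; left; apply/eqP.
  apply: eq_Rint_ae; [mfun|mfun|].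
  by apply: filterS gw => x ->.
pose rest := \int[m]_x G (w x) - c / 2 * \int[P]_z (w z.1 * w z.2 * kf z).
pose K := `|rho| * M + mu * (1 + M ^+ 2) + (`|rho| + mu * (ln M / 2 + 1)) * M + c * M * V.
have K0 : 0 <= K.
  have h1 := mulr_ge0 (ltW mu0) (ln_ge0 M1); have h2 := normr_ge0 rho.
  have h3 := mulr_ge0 (mulr_ge0 (ltW c0) M0) V0.
  have h4 := mulr_ge0 h1 M0; have h5 := mulr_ge0 h2 M0.
  have h6 := mulr_ge0 (ltW mu0) (sqr_ge0 M); have h7 := mulr_ge0 (ltW mu0) M0.
  by rewrite /K; have := mu0; lra.
pose C3 := 4 / c * (1 + K * (2 * C)).
(* The near energies are bounded by a quantity that tends to
   [4 / c * (I - rest)], which is what the limit has to satisfy. *)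
have near_un n : near (u n) (u n) <= 4 / c * (I - rest) + C3 * r n.
  have h1 := potential_rest_le M1 (cu n) mw wD wM; rewrite -/rest -/K in h1.
  have h2 := ler_wpM2l K0 (wd n).
  have [_ h3] := hu n; rewrite (actionE c rho mu adm (cu n)) in h3.
  have h4 : r n ^+ 3 <= r n.
    have rn0 := ltW (r0 n).
    have r2 : r n ^+ 2 <= 1 by rewrite exprn_ile1.
    by rewrite exprS ler_piMr.
  have h5 : c / 4 * near (u n) (u n) <= (I - rest) + (1 + K * (2 * C)) * r n by lra.
  have q0 : 0 <= 4 / c by rewrite divr_ge0// ltW.
  have := ler_wpM2l q0 h5.
  rewrite mulrA (_ : 4 / c * (c / 4) = 1) ?mul1r//; last by field; rewrite gt_eqF.
  by move/le_trans; apply; rewrite /C3; lra.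
have nearw : (\int[P]_z ((w z.1 - w z.2) ^+ 2 * kn z)%:E <= (4 / c * (I - rest))%:E)%E.
  apply: (fatou_ae (f := fun n z => (u n z.1 - u n z.2) ^+ 2 * kn z)).
  - by move=> n; have mun := energy_space_measurable (eu n); mfun.
  - by mfun.
  - by move=> n z; rewrite mulr_ge0 ?sqr_ge0.
  - apply: filterS (ae_prod wcv) => z [z1 z2].
    apply: cvgM; last exact: cvg_cst.
    by apply: (@cvgM _ _ _ _ (fun n => u n z.1 - u n z.2)); exact: cvgB.
  move=> e e0.
  have rcv : C3 * r n @[n --> \oo] --> (0 : R).
    rewrite -(mulr0 C3); apply: cvgMr; apply: cvg_expr.
    by rewrite ger0_norm//; lra.
  move/cvgrPdist_le : rcv => /(_ e e0); apply: filterS => n.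
  rewrite sub0r normrN => h.
  have [_ _ _ iun] := eu n.
  rewrite (EFin_Rint iun) lee_fin; apply: le_trans (near_un n) _.
  by rewrite lerD2l; apply: le_trans (ler_norm _) h.
have ew : energy w.
  split => //.
  - apply: (supp_integrable adm (B := M ^+ 2)); first by mfun.
      by move=> x xD; rewrite wD// expr0n.
    move=> x; have /andP[a b] := wM x.
    by rewrite ger0_norm ?sqr_ge0// ler_pXn2r// nnegrE.
  - apply/itg_ge0P; first by mfun.
      by move=> z; rewrite mulr_ge0 ?sqr_ge0.
    exact: le_lt_trans nearw (ltry _).
have cw : competitor M w by [].
exists w; split => // v cv; apply: le_trans (Ile v cv).
have [_ _ _ iw] := ew.
move: nearw; rewrite (EFin_Rint iw) lee_fin => h.
have q0 : 0 <= c / 4 by rewrite divr_ge0// ltW.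
move: (ler_wpM2l q0 h).
rewrite mulrA (_ : c / 4 * (4 / c) = 1) ?mul1r; last by field; rewrite gt_eqF.
by rewrite (actionE c rho mu adm cw) -/rest /near_form; lra.
Qed.

End minimizer.

(** * The Euler-Lagrange equation *)

Lemma quadratic_ge0_linear0 (R : realFieldType) (t0 L C : R) : 0 < t0 ->
  (forall t, `|t| <= t0 -> 0 <= t * L + t ^+ 2 * C) -> L = 0.
Proof.
move=> t00 h; pose e := t0 / ((`|L| + 1) * (`|C| + 1) * (t0 + 1)).
have L1 : 0 < `|L| + 1 by rewrite ltr_wpDl.
have C1 : 0 < `|C| + 1 by rewrite ltr_wpDl.
have t1 : 0 < t0 + 1 by rewrite addr_gt0.
have e0 : 0 < e by rewrite divr_gt0// !mulr_gt0.
have den : e * ((`|L| + 1) * (`|C| + 1) * (t0 + 1)) = t0.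
  by rewrite /e mulfVK// !mulf_neq0 ?gt_eqF.
have P1 : 1 <= (`|C| + 1) * (t0 + 1) by have := normr_ge0 C; nra.
have eL : e * `|L| <= t0.
  rewrite -[leRHS]den -mulrA; apply: ler_wpM2l; first exact: ltW.
  by have := normr_ge0 L; nra.
have eC : e * `|C| < 1.
  have h1 : e * ((`|C| + 1) * (t0 + 1)) <= t0.
    rewrite -[leRHS]den -mulrA ler_pM2l//; have := normr_ge0 L; nra.
  rewrite -(ltr_pM2r t1); have := mulr_gt0 e0 t1; lra.
have := h (- (e * L)); rewrite normrN normrM (gtr0_norm e0) => /(_ eL).
have -> : - (e * L) * L + (- (e * L)) ^+ 2 * C = e * L ^+ 2 * (e * C - 1) by ring.
have eC' : e * C - 1 < 0.
  by rewrite subr_lt0 (le_lt_trans _ eC)// ler_wpM2l ?ler_norm// ltW.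
rewrite nmulr_lge0// pmulr_rle0// => L2; apply/eqP; rewrite -sqrf_eq0.
by apply/eqP/le_anti; rewrite L2 sqr_ge0.
Qed.

Section euler_lagrange.
Context {d} {T : measurableType d} {R : realType}.
Variable m : {sigma_finite_measure set T -> \bar R}.
Variables (D : set T) (kn kf : T * T -> R) (c rho mu : R).
Notation P := (m \x m)%E.
Notation energy := (energy_space m D kn).
Notation E := (form m kn kf c rho).
Notation near := (near_form m kn).
Notation far := (far_form m kf).
Notation G := (potential rho mu).
Notation dG := (dpotential rho mu).
Notation J := (action m kn kf c rho mu).
Notation competitor := (competitor m D kn).
Implicit Types (u v w : T -> R) (M t : R).

Hypothesis adm : admissible_kernels m D kn kf.
Hypothesis c0 : 0 < c.
Hypothesis mu0 : 0 < mu.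

Let mD : measurable D. Proof. by case: adm. Qed.
Let finD : (m D < +oo)%E. Proof. by case: adm. Qed.
Let kn0 z : 0 <= kn z. Proof. by case: adm => ? ? []. Qed.
Let kf01 z : 0 <= kf z <= 1. Proof. by case: adm => ? ? ? []. Qed.

Let V : R := \int[m]_x \1_D x.
Let V0 : 0 <= V. Proof. exact: Rint_ge0. Qed.
Let i1D : itg m (\1_D : T -> R). Proof. exact: itg_indic. Qed.

Lemma competitor_truncation M b : 0 <= M -> energy b ->
  competitor M (fun x => Num.min `|b x| M).
Proof.
move=> M0 hb; split; last first.
  by move=> x; rewrite le_min normr_ge0 M0 ge_min lexx orbT.
have mb := energy_space_measurable hb.
apply: (energy_space_lipschitz adm (L := 1) hb hb); first by mfun.
  move=> x; rewrite mul1r ger0_norm ?le_min ?normr_ge0//.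
  by rewrite ge_min lerDl normr_ge0.
by move=> x y; rewrite mul1r (le_trans (normr_min_sub _ _ _))// lerDl.
Qed.

Lemma near_truncation_le M b : 0 <= M -> energy b ->
  near (fun x => Num.min `|b x| M) (fun x => Num.min `|b x| M) <= near b b.
Proof.
move=> M0 hb; have [hM _] := competitor_truncation M0 hb.
apply: le_Rint; [exact: (energy_space_near adm hM hM)|exact: (energy_space_near adm hb hb)|].
move=> z; rewrite ler_wpM2r// -!expr2.
rewrite -(real_normK (num_real (_ - _))) -(real_normK (num_real (b _ - _))).
by rewrite ler_pXn2r ?nnegrE// normr_min_sub.
Qed.

(** The excess over [M] interacts with [b] through a kernel bounded by one. *)
Lemma far_truncation_le M b : 0 <= M -> energy b ->
  far b b <= far (fun x => Num.min `|b x| M) (fun x => Num.min `|b x| M) +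
    2 * ((\int[m]_x `|b x|) * \int[m]_x (`|b x| - Num.min `|b x| M)).
Proof.
move=> M0 hb; have [hM _] := competitor_truncation M0 hb.
have b1 := itg_norm (energy_space_integrable adm hb).
have e1 := itgB b1 (energy_space_integrable adm hM).
have i0 := energy_space_far adm hM hM.
have i1 := itg_tensor e1 b1; have i2 := itg_tensor b1 e1.
have -> : 2 * ((\int[m]_x `|b x|) * \int[m]_x (`|b x| - Num.min `|b x| M)) =
    \int[P]_z ((`|b z.1| - Num.min `|b z.1| M) * `|b z.2|) +
    \int[P]_z (`|b z.1| * (`|b z.2| - Num.min `|b z.2| M)).
  by rewrite (Rint_tensor e1 b1) (Rint_tensor b1 e1); ring.
rewrite -(RintD i1 i2) -(RintD i0 (itgD i1 i2)).
apply: le_Rint; [exact: (energy_space_far adm hb hb)|exact: (itgD i0 (itgD i1 i2))|].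
move=> z; have /andP[k0 k1] := kf01 z.
have h := mul_le_min (b z.1) (b z.2) M0.
apply: le_trans (ler_wpM2r k0 h) _; rewrite -addrA mulrDl lerD2l.
rewrite ler_piMr// addr_ge0// mulr_ge0// subr_ge0 ge_min lexx//.
Qed.

(** The competitor is [u + t * phi] truncated at [M]. Since truncation is absorbed
    in a quadratic remainder, the minimality of [u] gives
    [0 <= t * L + t ^+ 2 * C] for all small [t] of either sign, where [L] is the first
    variation; [phi] may be unbounded. *)
Lemma euler_lagrange M u : 2 <= M ->
  (forall a, M - 1 <= a <= M -> c * (M * V + 1) <= dG a) ->
  competitor M u -> (forall v, competitor M v -> J u <= J v) ->
  forall phi, energy phi -> E u phi = - mu * \int[m]_x (u x * phi x * ln (u x)).
Proof.
move=> M2 HM cu minu phi hphi; have M0 : 0 <= M by lra.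
have M1 : 1 <= M by lra.
have [hu uM] := cu; have mu_ := energy_space_measurable hu.
have mphi := energy_space_measurable hphi.
have A0 : 0 <= c * (M * V + 1) by rewrite mulr_ge0 ?addr_ge0 ?mulr_ge0// ltW.
have [K [K0 HK]] := truncated_potential_le mu0 M2 A0 HM.
have u1 := energy_space_integrable adm hu.
have phi1 := energy_space_integrable adm hphi.
have phi2 := energy_space_mul hphi hphi.
pose B := 1 + M ^+ 2.
have iul : itg m (fun x => u x * phi x * ln (u x)).
  apply: (itg_dom (g := fun x => B * `|phi x|)); [mfun|exact/itgZ/itg_norm|].
  move=> x; have /andP[u0 uM'] := uM x; rewrite mulrAC normrM ler_wpM2r//.
  apply: le_trans (abs_mul_ln_le u0) _; rewrite /B lerD2l ler_pXn2r// nnegrE.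
have iup := energy_space_mul hu hphi.
have idp : itg m (fun x => dG (u x) * phi x).
  rewrite (_ : (fun x => _) = (fun x => rho * (u x * phi x) + mu * (u x * phi x * ln (u x)))).
    exact: (itgD (itgZ _ iup) (itgZ _ iul)).
  by apply/funext => x; rewrite /dpotential; ring.
have edp : \int[m]_x (dG (u x) * phi x) =
    rho * dot m u phi + mu * \int[m]_x (u x * phi x * ln (u x)).
  rewrite /dot -(RintZ _ iup) -(RintZ _ iul) -(RintD (itgZ _ iup) (itgZ _ iul)).
  by apply: eq_Rintegral => x _; rewrite /dpotential; ring.
pose E0 := form m kn kf c 0.
have E0E v w : E0 v w = c / 2 * near v w - c * far v w by rewrite /E0 /form mul0r addr0.
pose L := E0 u phi + \int[m]_x (dG (u x) * phi x).
pose C := E0 phi phi / 2 + K * dot m phi phi.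
pose F := \int[m]_x `|phi x|.
have F0 : 0 <= F by exact: Rint_ge0.
suff : L = 0.
  by rewrite /L edp E0E /form; lra.
(* For [`|t| <= (F + 1)^-1] the [L^1] norm of [u + t * phi] is at most
   [M * V + 1]. *)
apply: (@quadratic_ge0_linear0 _ (F + 1)^-1 L C); first by rewrite invr_gt0 ltr_wpDl.
move=> t tF.
pose b x := u x + t * phi x.
have hb : energy b := energy_space_add adm t hu hphi.
have b1 := itg_norm (energy_space_integrable adm hb).
have cb := competitor_truncation M0 hb; have [hbM _] := cb.
have bM1 := energy_space_integrable adm hbM.
have u1V : \int[m]_x `|u x| <= M * V.
  rewrite -(RintZ _ i1D); apply: le_Rint; [exact: itg_norm|exact: itgZ|].
  move=> x; rewrite indicE; case: (boolP (x \in D)) => [_|xD].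
    by have /andP[a1 a2] := uM x; rewrite mulr1 ger0_norm.
  by rewrite (competitor_supp cu) ?normr0 ?mulr0// => Dx; rewrite mem_set in xD.
have bV : \int[m]_x `|b x| <= M * V + 1.
  apply: (@le_trans _ _ (\int[m]_x `|u x| + `|t| * F)).
    have p1 := itg_norm phi1; have uu1 := itg_norm u1.
    rewrite -(RintZ _ p1) -(RintD uu1 (itgZ _ p1)).
    apply: le_Rint; [exact: b1|exact: (itgD uu1 (itgZ _ p1))|].
    by move=> x; rewrite -normrM ler_normD.
  apply: lerD => //; apply: (@le_trans _ _ ((F + 1)^-1 * F)).
    by rewrite ler_wpM2r.
  by rewrite mulrC ler_pdivrMr ?mul1r ?lerDl// ltr_wpDl.
have hmin := minu _ cb; rewrite (actionE c rho mu adm cb) (actionE c rho mu adm cu) in hmin.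
have h1 := near_truncation_le M0 hb.
have h2 := far_truncation_le M0 hb.
pose X := \int[m]_x (`|b x| - Num.min `|b x| M).
have X0 : 0 <= X by apply: Rint_ge0 => x; rewrite subr_ge0 ge_min lexx.
have h3 : (\int[m]_x `|b x|) * X <= (M * V + 1) * X by rewrite ler_wpM2r.
have h4 : \int[m]_x G (Num.min `|b x| M) + c * (M * V + 1) * X <=
    \int[m]_x G (u x) + t * \int[m]_x (dG (u x) * phi x) +
    K * t ^+ 2 * dot m phi phi.
  have j1 := competitor_potential rho mu adm cb.
  have j2 := itgB b1 bM1.
  have j3 := competitor_potential rho mu adm cu.
  rewrite /dot -(RintZ _ j2) -(RintZ _ idp) -(RintZ _ phi2).
  rewrite -(RintD j1 (itgZ _ j2)) -(RintD j3 (itgZ _ idp)).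
  rewrite -(RintD (itgD j3 (itgZ _ idp)) (itgZ _ phi2)).
  apply: le_Rint; [exact: (itgD j1 (itgZ _ j2))
    |exact: (itgD (itgD j3 (itgZ _ idp)) (itgZ _ phi2))|].
  move=> x; apply: le_trans (HK (u x) (b x) (uM x)) _.
  have -> : b x - u x = t * phi x by rewrite /b; ring.
  by rewrite exprMn expr2 ; lra.
have h5 := form_expand c 0 adm t hu hphi; rewrite -/E0 !E0E in h5.
have h6 : E0 u phi = c / 2 * near u phi - c * far u phi := E0E _ _.
have h7 : E0 phi phi = c / 2 * near phi phi - c * far phi phi := E0E _ _.
have h1' := ler_wpM2l (ltW c0) h1; have h2' := ler_wpM2l (ltW c0) h2.
have h3' := ler_wpM2l (ltW c0) h3.
rewrite /L /C h6 h7.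
move: h1' h2' h3' h4 h5 hmin; rewrite -/X -/b.
generalize (near b b) (far b b) (near u u) (near u phi) (near phi phi)
  (far u u) (far u phi) (far phi phi) (\int[m]_x `|b x|) X
  (near (fun x => Num.min `|b x| M) (fun x => Num.min `|b x| M))
  (far (fun x => Num.min `|b x| M) (fun x => Num.min `|b x| M))
  (\int[m]_x G (Num.min `|b x| M)) (dot m phi phi)
  (\int[m]_x G (u x)) (\int[m]_x (dG (u x) * phi x)) V.
by clear=> *; lra.
Qed.

End euler_lagrange.

(** * Positivity, and the Picone inequality for solutions *)

Lemma quotient_le (R : realFieldType) (M e a b : R) : 0 < e -> 0 <= a -> 0 <= b <= M ->
  b ^+ 2 / (a + e) <= M / e * b.
Proof.
move=> e0 a0 /andP[b0 bM]; have ae : 0 < a + e by rewrite ltr_wpDl.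
rewrite ler_pdivrMr// -[leLHS]mul1r -(mulfV (lt0r_neq0 e0)).
have -> : M / e * b * (a + e) = (M * b * (a + e)) / e by ring.
have -> : e / e * b ^+ 2 = (e * b ^+ 2) / e by ring.
rewrite ler_pM2r ?invr_gt0//.
have : 0 <= M * b * a by rewrite !mulr_ge0// (le_trans b0).
have : e * b * b <= e * b * M by rewrite ler_wpM2l// mulr_ge0// ltW.
lra.
Qed.

(** Puts the test function [v ^+ 2 / (u + e)] in the energy space. *)
Lemma quotient_lipschitz (R : realFieldType) (M e a b a' b' : R) : 0 < e ->
  0 <= a -> 0 <= a' -> 0 <= b <= M -> 0 <= b' <= M ->
  `|b ^+ 2 / (a + e) - b' ^+ 2 / (a' + e)| <=
  2 * (M / e) * `|b - b'| + (M / e) ^+ 2 * `|a - a'|.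
Proof.
move=> e0 a0 a'0 bM b'M; have ae : 0 < a + e by rewrite ltr_wpDl.
have ae' : 0 < a' + e by rewrite ltr_wpDl.
have -> : b ^+ 2 / (a + e) - b' ^+ 2 / (a' + e) =
    (b + b') / (a + e) * (b - b') - b' / (a + e) * (b' / (a' + e)) * (a - a').
  by field; rewrite !gt_eqF.
have /andP[b0 bM'] := bM; have /andP[b'0 b'M'] := b'M.
have M0 : 0 <= M := le_trans b0 bM'.
have q (x y K : R) : 0 <= x <= K -> 0 <= y -> 0 <= x / (y + e) <= K / e.
  move=> /andP[x0 xK] y0; have ye : 0 < y + e by rewrite ltr_wpDl.
  rewrite divr_ge0 ?(ltW ye)//=; apply: ler_pM => //; first by rewrite invr_ge0 ltW.
  by rewrite lef_pV2 ?posrE// lerDr.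
apply: le_trans (ler_normB _ _) _.
rewrite (normrM _ (b - b')) (normrM _ (a - a')); apply: lerD.
  rewrite ler_wpM2r//; have /andP[h1 h2] : 0 <= (b + b') / (a + e) <= (2 * M) / e.
    by apply: q => //; rewrite addr_ge0//=; lra.
  by rewrite (ger0_norm h1) mulrA.
rewrite ler_wpM2r//.
have /andP[h1 h2] := q _ _ _ b'M a0; have /andP[h3 h4] := q _ _ _ b'M a'0.
by rewrite (ger0_norm (mulr_ge0 h1 h3)) expr2; exact: ler_pM.
Qed.

Section positivity_uniqueness.
Context {d} {T : measurableType d} {R : realType}.
Variable m : {sigma_finite_measure set T -> \bar R}.
Variables (D : set T) (kn kf : T * T -> R) (c rho mu : R).
Notation P := (m \x m)%E.
Notation energy := (energy_space m D kn).
Notation E := (form m kn kf c rho).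
Notation near := (near_form m kn).
Notation far := (far_form m kf).
Notation J := (action m kn kf c rho mu).
Notation competitor := (competitor m D kn).
Implicit Types (u v w : T -> R) (M t e : R).

Hypothesis adm : admissible_kernels m D kn kf.
Hypothesis c0 : 0 < c.
Hypothesis mu0 : 0 < mu.

Let mD : measurable D. Proof. by case: adm. Qed.
Let finD : (m D < +oo)%E. Proof. by case: adm. Qed.
Let mkn : measurable_fun setT kn. Proof. by case: adm => ? ? []. Qed.
Let kn0 z : 0 <= kn z. Proof. by case: adm => ? ? []. Qed.
Let kf01 z : 0 <= kf z <= 1. Proof. by case: adm => ? ? ? []. Qed.

Let V : R := \int[m]_x \1_D x.
Let V0 : 0 <= V. Proof. exact: Rint_ge0. Qed.
Let i1D : itg m (\1_D : T -> R). Proof. exact: itg_indic. Qed.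

(** Moving from [u ^+ 2] towards [psi ^+ 2] changes the action by at most
    [t * const + (mu / 4) * (t * ln t) * s], where [s] is the integral of [psi ^+ 2] over
    the zero set of [u]. Minimality as [t] tends to [0] forces [s <= 0]. *)
Lemma minimizer_positive M u psi : competitor M u ->
  (forall v, competitor M v -> J u <= J v) ->
  competitor M psi -> (forall x, D x -> 0 < psi x) ->
  {ae m, forall x, D x -> 0 < u x}.
Proof.
move=> cu minu cp psi0.
have [hu uM] := cu; have [hp pM] := cp.
have mu_ := energy_space_measurable hu; have mp := energy_space_measurable hp.
pose Z := [set x | u x = 0].
have mZ : measurable Z.
  rewrite (_ : Z = setT `&` u @^-1` [set 0]); last by rewrite setTI.
  exact: mu_.
pose z x := \1_Z x * psi x ^+ 2.
have z0 x : 0 <= z x by rewrite mulr_ge0 ?sqr_ge0.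
have iz : itg m z.
  apply: (itg_dom (g := fun x => psi x ^+ 2)).
  - by apply: measurable_funM; [exact: measurable_indic|mfun].
  - by case: hp.
  - move=> x; rewrite ger0_norm// /z indicE.
    by case: (_ \in _); rewrite ?mul1r// mul0r sqr_ge0.
have key t : 0 < t < 1 ->
    J u <= (1 - t) * J u + t * J psi + mu / 4 * (t * ln t) * \int[m]_x z x.
  move=> /andP[t0 t1]; have t01 : 0 <= t <= 1 by rewrite !ltW.
  have cs := competitor_sqmean adm t01 cu cp.
  apply: le_trans (minu _ cs) _.
  have h1 := form_sqmean_le rho adm c0 t01 cu cp.
  have iu := competitor_entropy adm cu; have ip := competitor_entropy adm cp.
  have ist := competitor_entropy adm cs.
  have h2 : \int[m]_x entropy (sqmean t (u x) (psi x)) <=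
      (1 - t) * \int[m]_x entropy (u x) + t * \int[m]_x entropy (psi x) +
      (t * ln t / 4) * \int[m]_x z x.
    rewrite -(RintZ _ iu) -(RintZ _ ip) -(RintZ _ iz).
    rewrite -(RintD (itgZ _ iu) (itgZ _ ip)).
    rewrite -(RintD (itgD (itgZ _ iu) (itgZ _ ip)) (itgZ _ iz)).
    apply: le_Rint; [exact: ist|exact: (itgD (itgD (itgZ _ iu) (itgZ _ ip)) (itgZ _ iz))|].
    move=> x; have /andP[u0 _] := uM x; have /andP[p0 _] := pM x.
    rewrite /entropy !ger0_norm ?sqmean_ge0// /z indicE.
    have e1 := sqr_sqmean t01 (u x) (psi x).
    have e2 := sqmean_entropy_ge0 t01 u0 p0.
    case: (boolP (x \in Z)) => [|_]; last by rewrite mul0r mulr0; lra.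
    rewrite inE /Z /= => ux0; rewrite ux0 in e1 e2 *.
    move: p0; rewrite le_eqVlt => /orP[/eqP p0|p0].
      rewrite -p0 in e1 e2 *; rewrite expr0n/= in e1 e2 *; lra.
    have e3 := sqmean_entropy_at0 t01 t0 p0; rewrite expr0n/= in e1 e2 *; lra.
  by have := ler_wpM2l (ltW mu0) h2; rewrite /action; lra.
have zle0 : \int[m]_x z x <= 0.
  rewrite leNgt; apply/negP => s0; move: key; set s := \int[m]_x z x in s0 *.
  set a := J u; set b := J psi => key.
  (* The choice [t = expR (- X)] turns [ln t] into [- X]. *)
  have X0 : 0 < 4 / (mu * s) * (`|b - a| + 1).
    by rewrite mulr_gt0 ?divr_gt0 ?mulr_gt0// ltr_wpDl.
  set X := 4 / (mu * s) * (`|b - a| + 1) in X0.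
  have Xs : mu / 4 * X * s = `|b - a| + 1 by rewrite /X; field; rewrite !gt_eqF.
  have := key (expR (- X)); rewrite expR_gt0 expRK -expR0 ltr_expR oppr_lt0 X0 => /(_ isT).
  rewrite expR0; have := expR_gt0 (- X); set t := expR (- X) => t0 h.
  have h1 : 0 <= t * (b - a - (mu / 4 * X * s)) by lra.
  rewrite pmulr_rge0// Xs in h1.
  by have := ler_norm (b - a); lra.
apply: filterS (Rint_eq0_ae iz z0 zle0) => x zx0 Dx.
have /andP[u0 _] := uM x.
rewrite lt_neqAle u0 andbT eq_sym; apply/negP => /eqP ux0.
move: zx0; rewrite /z indicE mem_set//= mul1r => /eqP.
by rewrite sqrf_eq0 gt_eqF// psi0.
Qed.

(** The abstract weak equation, for nonnegative [u]. *)
Definition solution u := forall phi, energy phi ->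
  E u phi = - mu * \int[m]_x (u x * phi x * ln (u x)).

Lemma energy_space_quotient M e u v : 0 < e -> competitor M u -> competitor M v ->
  energy (fun x => v x ^+ 2 / (u x + e)).
Proof.
move=> e0 [hu uM] [hv vM].
have mu_ := energy_space_measurable hu; have mv := energy_space_measurable hv.
have u0 x : 0 < u x + e by have /andP[u0 _] := uM x; rewrite ltr_wpDl.
have v0 x : 0 <= v x by have /andP[] := vM x.
have uu0 x : 0 <= u x by have /andP[] := uM x.
apply: (energy_space_lipschitz adm (L := 2 * (M / e) + (M / e) ^+ 2) hu hv).
- apply: measurable_funM; first by mfun.
  by apply: measurable_fun_inv; [move=> x; exact: ltW|mfun].
- move=> x; rewrite ger0_norm ?divr_ge0 ?sqr_ge0 ?(ltW (u0 x))//.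
  apply: le_trans (quotient_le e0 (uu0 x) (vM x)) _.
  rewrite (ger0_norm (v0 x)) (ger0_norm (uu0 x)).
  have /andP[_ vM'] := vM x; have : 0 <= M / e.
    by rewrite divr_ge0 ?(ltW e0)// (le_trans (v0 x)).
  have := v0 x; have := uu0 x; move: (M / e) (u x) (v x) => q p r *.
  have : 0 <= q * r by rewrite mulr_ge0.
  have : 0 <= q * p by rewrite mulr_ge0.
  have : 0 <= q ^+ 2 * (p + r) by rewrite mulr_ge0 ?sqr_ge0 ?addr_ge0.
  lra.
- move=> x y.
  apply: le_trans (quotient_lipschitz e0 (uu0 x) (uu0 y) (vM x) (vM y)) _.
  have /andP[_ vM'] := vM x; have : 0 <= M / e.
    by rewrite divr_ge0 ?(ltW e0)// (le_trans (v0 x)).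
  have := normr_ge0 (v x - v y); have := normr_ge0 (u x - u y).
  move: (M / e) `|u x - u y| `|v x - v y| => q p r *.
  have : 0 <= q * p by rewrite mulr_ge0.
  have : 0 <= q ^+ 2 * r by rewrite mulr_ge0 ?sqr_ge0.
  lra.
Qed.

(** The equation of [u] is tested with [v ^+ 2 / (u + e)]. The near part is bounded
    by the Picone inequality. In the far part, after symmetrization, the
    arithmetic-geometric inequality leaves only an error of the size of the integral of
    [e * v ^+ 2 / (u + e)], which tends to [0] with [e] where [u > 0]. *)
Lemma solution_picone M e u v : 0 < e -> competitor M u -> competitor M v ->
  solution u ->
  - ((c * V + `|rho|) * \int[m]_x (e * (v x ^+ 2 / (u x + e)))) <=
  E v v + mu * \int[m]_x (u x * (v x ^+ 2 / (u x + e)) * ln (u x)).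
Proof.
move=> e0 cu cv su; pose phi x := v x ^+ 2 / (u x + e).
have hphi : energy phi := energy_space_quotient e0 cu cv.
have [hu uM] := cu; have [hv vM] := cv.
have mu_ := energy_space_measurable hu; have mv := energy_space_measurable hv.
have u0 x : 0 <= u x by have /andP[] := uM x.
have ue x : 0 < u x + e by rewrite ltr_wpDl.
have v0 x : 0 <= v x by have /andP[] := vM x.
have eqn := su _ hphi; rewrite /form in eqn.
have phi0 x : 0 <= phi x by rewrite divr_ge0 ?sqr_ge0// ltW.
have h1 : near u phi <= near v v.
  apply: le_Rint; [exact: (energy_space_near adm hu hphi)
    |exact: (energy_space_near adm hv hv)|].
  move=> z; rewrite ler_wpM2r//.
  have -> : u z.1 - u z.2 = (u z.1 + e) - (u z.2 + e) by ring.
  by rewrite -expr2; apply: picone.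
have iphi := energy_space_integrable adm hphi.
pose X := \int[m]_x (e * phi x).
have X0 : 0 <= X by apply: Rint_ge0 => x; rewrite mulr_ge0// ltW.
have h2 : dot m v v - dot m u phi = X.
  rewrite /dot -(RintB (energy_space_mul hv hv) (energy_space_mul hu hphi)).
  by apply: eq_Rintegral => x _; rewrite /phi; field; rewrite gt_eqF.
have h3 : 2 * far v v <= far u phi + far phi u + 2 * (V * X).
  have j1 := energy_space_far adm hv hv; have j2 := energy_space_far adm hu hphi.
  have j3 := energy_space_far adm hphi hu.
  have iX := itgZ e iphi.
  have j4 := itg_tensor i1D iX; have j5 := itg_tensor iX i1D.
  have -> : 2 * (V * X) = \int[P]_z (\1_D z.1 * (e * phi z.2)) +
      \int[P]_z ((e * phi z.1) * \1_D z.2).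
    by rewrite (Rint_tensor i1D iX) (Rint_tensor iX i1D) -/V -/X; ring.
  rewrite /far_form -(RintZ 2 j1) -(RintD j2 j3) -(RintD j4 j5).
  rewrite -(RintD (itgD j2 j3) (itgD j4 j5)).
  apply: le_Rint; [exact: itgZ|exact: (itgD (itgD j2 j3) (itgD j4 j5))|].
  move=> [x y] /=; have /andP[k0 k1] := kf01 (x, y); move: (kf (x, y)) k0 k1 => k k0 k1.
  have out w z : competitor M w -> z \notin D -> w z = 0.
    by move=> cw zD; apply: (competitor_supp cw) => Dz; rewrite mem_set in zD.
  have ephi z : 0 <= e * phi z by rewrite mulr_ge0// ltW.
  have pos : 0 <= \1_D x * (e * phi y) + e * phi x * \1_D y :> R.
    by rewrite addr_ge0// mulr_ge0.
  have [xD|xD] := boolP (x \in D); last first.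
    have phix : phi x = 0 by rewrite /phi (out v)// expr0n/= mul0r.
    rewrite (out v x cv xD) (out u x cu xD) phix in pos *.
    by rewrite !mul0r mulr0 !add0r.
  have [yD|yD] := boolP (y \in D); last first.
    have phiy : phi y = 0 by rewrite /phi (out v)// expr0n/= mul0r.
    rewrite (out v y cv yD) (out u y cu yD) phiy in pos *.
    by rewrite !mulr0 !mul0r !mulr0 !add0r; rewrite !mulr0 add0r in pos.
  rewrite !indicE xD yD mul1r mulr1.
  have main : 2 * (v x * v y) - (u x * phi y + phi x * u y) <= e * phi y + e * phi x.
    rewrite -subr_ge0.
    have -> : e * phi y + e * phi x - (2 * (v x * v y) - (u x * phi y + phi x * u y)) =
      ((u x + e) * v y - (u y + e) * v x) ^+ 2 / ((u x + e) * (u y + e)).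
      by rewrite /phi; field; rewrite !gt_eqF.
    by rewrite divr_ge0 ?sqr_ge0// mulr_ge0 ?(ltW (ue _)).
  have := ler_wpM2l k0 main.
  have : k * (e * phi y + e * phi x) <= e * phi y + e * phi x.
    by rewrite ler_piMl// addr_ge0.
  by rewrite -/(phi x) -/(phi y); lra.
rewrite (far_formC adm hphi hu) in h3.
have h4 : - (`|rho| * X) <= rho * X.
  by rewrite -mulNr ler_wpM2r// lerNl -normrN ler_norm.
rewrite -/phi -/X /form; rewrite -/phi in eqn.
have h1' := ler_wpM2l (ltW c0) h1; have h3' := ler_wpM2l (ltW c0) h3.
have h2' : rho * dot m v v - rho * dot m u phi = rho * X by rewrite -mulrBr h2.
rewrite -[\int[m]_x (u x * (v x ^+ 2 / (u x + e)) * ln (u x))]/(\int[m]_x (u x * phi x * ln (u x))).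
move: eqn h1' h3' h2' h4.
generalize (\int[m]_x (u x * phi x * ln (u x))) (near v v) (near u phi) (far u phi)
  (far v v) (dot m v v) (dot m u phi) X V `|rho|.
by move=> *; lra.
Qed.

End positivity_uniqueness.

(** * Uniqueness in the abstract setting *)

(** For two solutions [u] and [v], the integrand left when the equation of [v]
    tested with [v] is combined with [solution_picone], divided by [mu]. The last
    term collects the errors, with [k] equal to [(c * V + `|rho|) / mu]. *)
Definition picone_gap (R : realType) (k e a b : R) : R :=
  b ^+ 2 * ln b - a * (b ^+ 2 / (a + e)) * ln a - k * (e * (b ^+ 2 / (a + e))).

(** A lower bound uniform in [e], as Fatou's lemma requires. *)
Lemma picone_gap_ge (R : realType) (M k e a b : R) : 0 <= k -> 0 < e ->
  0 <= a <= M -> 0 <= b <= M ->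
  - (M * (1 + M ^+ 2) + M ^+ 3 + k * M ^+ 2) <= picone_gap k e a b.
Proof.
move=> k0 e0 /andP[a0 aM] /andP[b0 bM]; rewrite /picone_gap.
have M0 : 0 <= M := le_trans a0 aM.
have ae : 0 < a + e by rewrite ltr_wpDl.
have b2 : b ^+ 2 <= M ^+ 2 by rewrite ler_pXn2r ?nnegrE.
have b20 := sqr_ge0 b.
have h1 : - (M * (1 + M ^+ 2)) <= b ^+ 2 * ln b.
  have := abs_mul_ln_le b0; rewrite ler_norml => /andP[h _].
  rewrite expr2 -mulrA; have h' := ler_wpM2l b0 h; apply: le_trans h'.
  rewrite mulrN lerN2; apply: ler_pM => //; first by rewrite addr_ge0.
  by rewrite lerD2l.
have r1 : 0 <= a / (a + e) <= 1.
  by rewrite divr_ge0 ?(ltW ae)//= ler_pdivrMr// mul1r lerDl ltW.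
have r2 : 0 <= e / (a + e) <= 1.
  by rewrite divr_ge0 ?(ltW ae)// ?(ltW e0)//= ler_pdivrMr// mul1r lerDr.
have h2 : a * (b ^+ 2 / (a + e)) * ln a <= M ^+ 3.
  have -> : a * (b ^+ 2 / (a + e)) * ln a = (a / (a + e)) * b ^+ 2 * ln a by ring.
  have /andP[r10 r11] := r1.
  have lM : ln a <= M.
    move: a0; rewrite le_eqVlt => /orP[/eqP <-|a0]; first by rewrite ln0.
    by apply: le_trans (le_ln_sub1 a0) _; lra.
  apply: le_trans (ler_wpM2l _ lM) _; first exact: mulr_ge0.
  rewrite [leRHS]exprSr ler_wpM2r//.
  apply: le_trans (ler_pM _ _ r11 b2) _ => //.
  by rewrite mul1r.
have h3 : k * (e * (b ^+ 2 / (a + e))) <= k * M ^+ 2.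
  rewrite ler_wpM2l//; have -> : e * (b ^+ 2 / (a + e)) = e / (a + e) * b ^+ 2 by ring.
  have /andP[r20 r21] := r2.
  by apply: le_trans (ler_pM _ _ r21 b2) _ => //; rewrite mul1r.
lra.
Qed.

Lemma picone_gap_cvg (R : realType) (k a b : R) : 0 < a ->
  picone_gap k (n.+1%:R^-1) a b @[n --> \oo] --> b ^+ 2 * ln b - b ^+ 2 * ln a.
Proof.
move=> a0; have ecv : (n.+1%:R^-1 : R) @[n --> \oo] --> (0 : R) by exact: cvg_harmonic.
have qcv : b ^+ 2 / (a + n.+1%:R^-1) @[n --> \oo] --> b ^+ 2 / a.
  apply: cvgMr; apply: cvgV; first by rewrite gt_eqF.
  by rewrite -[X in _ --> X]addr0; apply: cvgD => //; exact: cvg_cst.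
rewrite /picone_gap.
have -> : b ^+ 2 * ln b - b ^+ 2 * ln a =
    b ^+ 2 * ln b - a * (b ^+ 2 / a) * ln a - k * (0 * (b ^+ 2 / a)).
  by field; rewrite gt_eqF.
apply: cvgB; last by apply: cvgMr; exact: cvgM.
apply: cvgB; first exact: cvg_cst.
by apply: cvgMl; exact: cvgMr.
Qed.

Lemma sqr_sub_mul_ln_ge0 (R : realType) (a b : R) : 0 < a -> 0 < b ->
  0 <= (b ^+ 2 - a ^+ 2) * (ln b - ln a) ?= iff (a == b).
Proof.
have pos (x y : R) : 0 < x -> x < y -> 0 < (y ^+ 2 - x ^+ 2) * (ln y - ln x).
  move=> x0 xy; have y0 : 0 < y := lt_trans x0 xy.
  by rewrite mulr_gt0// subr_gt0 ?ltr_pXn2r ?nnegrE ?ltW// ltr_ln ?posrE.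
move=> a0 b0; have [ab|ba|->] := ltgtP a b.
- by split; [apply/ltW/pos|apply/negbTE; rewrite lt_eqF// pos].
- rewrite -mulrNN !opprB.
  by split; [apply/ltW/pos|apply/negbTE; rewrite lt_eqF// pos].
- by rewrite !subrr mulr0; split; rewrite ?eqxx.
Qed.

Section uniqueness.
Context {d} {T : measurableType d} {R : realType}.
Variable m : {sigma_finite_measure set T -> \bar R}.
Variables (D : set T) (kn kf : T * T -> R) (c rho mu : R).
Notation energy := (energy_space m D kn).
Notation E := (form m kn kf c rho).
Notation competitor := (competitor m D kn).
Notation solution := (solution m D kn kf c rho mu).
Implicit Types (u v w : T -> R) (M t e : R).

Hypothesis adm : admissible_kernels m D kn kf.
Hypothesis c0 : 0 < c.
Hypothesis mu0 : 0 < mu.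

Let mD : measurable D. Proof. by case: adm. Qed.
Let finD : (m D < +oo)%E. Proof. by case: adm. Qed.

Let V : R := \int[m]_x \1_D x.
Let V0 : 0 <= V. Proof. exact: Rint_ge0. Qed.
Let i1D : itg m (\1_D : T -> R). Proof. exact: itg_indic. Qed.

Lemma bounded_mul_ln M u phi : competitor M u -> itg m phi ->
  itg m (fun x => u x * phi x * ln (u x)).
Proof.
move=> [hu uM] iphi; have mu_ := energy_space_measurable hu.
have mphi := itg_measurable iphi.
apply: (itg_dom (g := fun x => (1 + M ^+ 2) * `|phi x|)); [mfun|exact/itgZ/itg_norm|].
move=> x; have /andP[u0 uM'] := uM x; rewrite mulrAC normrM ler_wpM2r//.
by apply: le_trans (abs_mul_ln_le u0) _; rewrite lerD2l ler_pXn2r// nnegrE (le_trans u0).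
Qed.

Let k := (c * V + `|rho|) / mu.
Let k0 : 0 <= k.
Proof. by rewrite divr_ge0 ?addr_ge0 ?mulr_ge0// ltW. Qed.

Lemma picone_gap_integrable M e u v : 0 < e -> competitor M u -> competitor M v ->
  itg m (fun x => picone_gap k e (u x) (v x)).
Proof.
move=> e0 cu cv; have hphi := energy_space_quotient adm e0 cu cv.
have iphi := energy_space_integrable adm hphi.
have [hv _] := cv; have iv := energy_space_integrable adm hv.
apply: itgB; last exact: (itgZ _ (itgZ _ iphi)).
apply: itgB; last exact: (bounded_mul_ln cu iphi).
exact: (bounded_mul_ln cv iv).
Qed.

(** The form [E v v] cancels between the two equations. *)
Lemma picone_gap_le0 M e u v : 0 < e -> competitor M u -> competitor M v ->
  solution u -> solution v -> \int[m]_x picone_gap k e (u x) (v x) <= 0.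
Proof.
move=> e0 cu cv su sv; have hphi := energy_space_quotient adm e0 cu cv.
have iphi := energy_space_integrable adm hphi.
have [hv _] := cv; have iv := energy_space_integrable adm hv.
have h := solution_picone adm c0 e0 cu cv su.
rewrite (sv _ hv) in h.
have i1 := bounded_mul_ln cv iv; have i2 := bounded_mul_ln cu iphi.
have i3 := itgZ e iphi.
rewrite /picone_gap (RintB (itgB i1 i2) (itgZ k i3)) (RintB i1 i2) (RintZ k i3).
rewrite -(pmulr_rle0 _ mu0); move: h; rewrite -/V /k.
generalize (\int[m]_x (v x * v x * ln (v x))) (\int[m]_x (e * (v x ^+ 2 / (u x + e))))
 (\int[m]_x (u x * (v x ^+ 2 / (u x + e)) * ln (u x))) => x1 x2 x3.
rewrite !mulrBr [mu * (_ / mu * _)]mulrA [mu * (_ / mu)]mulrC mulfVK ?gt_eqF//; lra.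
Qed.

(** The gap of [(u, v)] plus the gap of [(v, u)] tends to
    [(v ^+ 2 - u ^+ 2) * (ln v - ln u)], which is nonnegative and vanishes only where
    [u = v], while its integral is at most [0]. *)
Lemma solution_unique M u v : 0 <= M -> competitor M u -> competitor M v ->
  (forall x, D x -> 0 < u x) -> (forall x, D x -> 0 < v x) ->
  solution u -> solution v -> {ae m, forall x, u x = v x}.
Proof.
move=> M0 cu cv u0 v0 su sv.
have [hu uM] := cu; have [hv vM] := cv.
have mu_ := energy_space_measurable hu; have mv := energy_space_measurable hv.
pose en n : R := n.+1%:R^-1.
have en0 n : 0 < en n by rewrite invr_gt0.
pose K := 2 * (M * (1 + M ^+ 2) + M ^+ 3 + k * M ^+ 2).
pose A n x := picone_gap k (en n) (u x) (v x) + picone_gap k (en n) (v x) (u x).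
pose A0 x := (v x ^+ 2 - u x ^+ 2) * (ln (v x) - ln (u x)).
have iA n : itg m (A n).
  by apply: itgD; [exact: (picone_gap_integrable _ cu cv)|exact: (picone_gap_integrable _ cv cu)].
have uD x : ~ D x -> u x = 0 := competitor_supp cu (x := x).
have vD x : ~ D x -> v x = 0 := competitor_supp cv (x := x).
have gap0 e : picone_gap k e 0 0 = 0.
  by rewrite /picone_gap expr0n/= !mul0r !mulr0 !subr0.
have A0_ge0 x : 0 <= A0 x.
  have [Dx|nDx] := pselect (D x).
    by have [] := sqr_sub_mul_ln_ge0 (u0 _ Dx) (v0 _ Dx).
  by rewrite /A0 uD// vD// subrr mul0r.
have AK n x : 0 <= A n x + K * \1_D x.
  have [Dx|nDx] := pselect (D x).
    rewrite indicE mem_set// mulr1 /A /K.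
    have := picone_gap_ge k0 (en0 n) (uM x) (vM x).
    have := picone_gap_ge k0 (en0 n) (vM x) (uM x); lra.
  by rewrite /A uD// vD// gap0 indicE memNset// mulr0 !addr0.
have Acv x : A n x @[n --> \oo] --> A0 x.
  have [Dx|nDx] := pselect (D x).
    have -> : A0 x = v x ^+ 2 * ln (v x) - v x ^+ 2 * ln (u x) +
        (u x ^+ 2 * ln (u x) - u x ^+ 2 * ln (v x)) by rewrite /A0; ring.
    by apply: cvgD; apply: picone_gap_cvg; [exact: u0|exact: v0].
  rewrite /A /A0 uD// vD// subrr mul0r; under eq_cvg do rewrite gap0 addr0.
  exact: cvg_cst.
have mA0 : measurable_fun setT A0 by rewrite /A0; mfun.
have m1D : measurable_fun setT (\1_D : T -> R) by exact: measurable_indic.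
have fat : (\int[m]_x (A0 x + K * \1_D x)%:E <= (K * V)%:E)%E.
  apply: (fatou_ae (f := fun n x => A n x + K * \1_D x)).
  - by move=> n; apply: measurable_funD; [exact: (itg_measurable (iA n))|mfun].
  - by mfun.
  - exact: AK.
  - by apply: aeW => x; apply: cvgD; [exact: Acv|exact: cvg_cst].
  move=> e e0; apply: nearW => n.
  rewrite (EFin_Rint (itgD (iA n) (itgZ K i1D))) lee_fin.
  rewrite (RintD (iA n) (itgZ K i1D)) (RintZ K i1D) -/V addrC lerD2l.
  apply: le_trans (ltW e0).
  have h1 := picone_gap_integrable (en0 n) cu cv.
  have h2 := picone_gap_integrable (en0 n) cv cu.
  rewrite /A (RintD h1 h2) -[0]addr0; apply: lerD.
    exact: (picone_gap_le0 (en0 n) cu cv su sv).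
  exact: (picone_gap_le0 (en0 n) cv cu sv su).
have K0 : 0 <= K.
  have := mulr_ge0 k0 (sqr_ge0 M); have := exprn_ge0 3 M0.
  by have := mulr_ge0 M0 (sqr_ge0 M); rewrite /K; lra.
have AK0 x : 0 <= A0 x + K * \1_D x by rewrite addr_ge0// mulr_ge0.
have iAK : itg m (fun x => A0 x + K * \1_D x).
  apply/itg_ge0P => //; first by mfun.
  exact: le_lt_trans fat (ltry _).
have iA0 : itg m A0.
  apply: (itg_dom mA0 iAK) => x; rewrite ger0_norm// lerDl mulr_ge0//.
have A0le : \int[m]_x A0 x <= 0.
  move: fat; rewrite (EFin_Rint iAK) lee_fin (RintD iA0 (itgZ K i1D)) (RintZ K i1D).
  by rewrite -/V gerDr.
apply: filterS (Rint_eq0_ae iA0 A0_ge0 A0le) => x A0x.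
have [Dx|nDx] := pselect (D x); last by rewrite uD// vD.
have [_ h] := sqr_sub_mul_ln_ge0 (u0 _ Dx) (v0 _ Dx).
by apply/eqP; rewrite -h -/(A0 x) A0x.
Qed.

End uniqueness.

(** * Domination by shells; Lebesgue measure on row vectors *)

Section shells.
Context {d} {T : measurableType d} {R : realType}.
Variable mu : {measure set T -> \bar R}.

(** Bounds an integral by a series: [f] is at most [c k] on some [A k], and the
    products of [c k] with the measure of [A k] decrease geometrically. It serves for
    singularities at a point as well as for decay at infinity. *)
Lemma integral_le_shells (f : T -> R) (c : nat -> R) (A : nat -> set T) (B : R) :
  measurable_fun setT f -> (forall x, 0 <= f x) ->
  (forall k, measurable (A k)) -> (forall k, 0 <= c k) ->
  (forall x, f x = 0 \/ exists k, A k x /\ f x <= c k) ->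
  (forall k, ((c k)%:E * mu (A k) <= (B * 2^-1 ^+ k)%:E)%E) ->
  (\int[mu]_x (f x)%:E <= (2 * B)%:E)%E.
Proof.
move=> mf f0 mA c0 fc cB.
pose g k x : \bar R := (c k * \1_(A k) x)%:E.
have mg k : measurable_fun setT (g k).
  by apply/measurable_EFinP; apply: measurable_funM => //; exact: measurable_indic.
have g0 k x : (0 <= g k x)%E by rewrite lee_fin mulr_ge0.
apply: (@le_trans _ _ (\int[mu]_x \big[+%E/0%E]_(0 <= k <oo) g k x)%E).
  apply: ge0_le_integral => //.
  - by move=> x _; rewrite lee_fin.
  - exact/measurable_EFinP.
  - by apply: ge0_emeasurable_sum.
  move=> x _; case: (fc x) => [->|[k [Akx fk]]]; first exact: nneseries_ge0.
  apply: (@le_trans _ _ (g k x)).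
    by rewrite lee_fin indicE mem_set// mulr1.
  apply: le_trans (nneseries_lim_ge k.+1 _) => //.
  by rewrite big_nat_recr//= leeDr// sume_ge0.
rewrite integral_nneseries//; apply: nneseries_geometric_half_le => k.
  exact: integral_ge0.
rewrite /g; under eq_integral do rewrite EFinM.
rewrite ge0_integralZl_EFin//; last first.
  by apply/measurable_EFinP; exact: measurable_indic.
by rewrite integral_indic// setIT.
Qed.

End shells.

Section euclidean.
Context {R : realType} {N : nat}.
Notation leb := (lebesgue_rV R N).
Implicit Types x y : 'rV[R]_N.

Lemma enorm_ge0 x : 0 <= enorm x. Proof. exact: sqrtr_ge0. Qed.

Lemma enorm_sym x y : enorm (x - y) = enorm (y - x).
Proof.
by congr Num.sqrt; apply: eq_bigr => i _; rewrite !mxE -sqrrN opprB.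
Qed.

Lemma coord_le_enorm x i : `|x ord0 i| <= enorm x.
Proof.
rewrite -sqrtr_sqr ler_wsqrtr// (bigD1 i)//= lerDl sumr_ge0// => j _.
exact: sqr_ge0.
Qed.

Lemma mx_norm_le_enorm x : `|x| <= enorm x.
Proof.
rewrite /Num.norm/=; have [->|] := eqVneq (mx_norm x) 0; first exact: enorm_ge0.
by move=> /mx_norm_neq0[[i j] /= ->]; rewrite (ord1 i); exact: coord_le_enorm.
Qed.

Lemma measurable_enorm_sub :
  measurable_fun setT (fun z : 'rV[R]_N * 'rV[R]_N => enorm (z.1 - z.2)).
Proof.
apply: measurable_fun_sqrt; apply: measurable_sum => i; apply: measurable_funX.
rewrite (_ : (fun z => _) = fun z : 'rV[R]_N * 'rV[R]_N => z.1 ord0 i - z.2 ord0 i).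
  apply: measurable_funB.
    exact: (measurable_fun_fst (measurable_coord i)).
  exact: (measurable_fun_snd (measurable_coord i)).
by apply/funext => z; rewrite !mxE.
Qed.

Lemma measurable_box (A : 'I_N -> set R) : (forall i, measurable (A i)) ->
  measurable [set x : 'rV[R]_N | forall i, A i (x ord0 i)].
Proof.
move=> mA; rewrite [X in measurable X](_ : _ = \big[setI/setT]_(i < N)
      ((fun x : 'rV[R]_N => x ord0 i) @^-1` A i)).
  apply: bigsetI_measurable => i _; rewrite -[X in measurable X]setTI.
  exact: measurable_coord.
rewrite -bigcap_seq; apply/seteqP; split => [x Ax i _|x Ax i]; first exact: Ax.
by apply: Ax; rewrite /= mem_index_enum.
Qed.

(** An open set is the union of the countably many open cubes that it
    contains with rational center and radius [1 / (k + 1)]. *)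
Lemma measurable_open_rV (U : set 'rV[R]_N) : open U -> measurable U.
Proof.
move=> oU.
pose B (p : 'rV[rat]_N * nat) := [set x : 'rV[R]_N | forall i,
  `](ratr (p.1 ord0 i) - p.2.+1%:R^-1), (ratr (p.1 ord0 i) + p.2.+1%:R^-1)[%classic (x ord0 i)].
have -> : U = \bigcup_(p in [set p | B p `<=` U]) B p.
  apply/seteqP; split => [x Ux|x [p /= BU Bx]]; last exact: BU.
  have /nbhs_ballP[e /= e0 xU] : nbhs x U by apply: open_nbhs_nbhs.
  have [k _ ke] := near_infty_natSinv_lt (PosNum (divr_gt0 e0 (ltr0n R 2))).
  have {}ke : k.+1%:R^-1 < e / 2 by have := ke k (leqnn k).
  have k0 : 0 < k.+1%:R^-1 :> R by rewrite invr_gt0.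
  have /choice[q Hq] : forall i, exists q : rat,
      x ord0 i - k.+1%:R^-1 < ratr q < x ord0 i + k.+1%:R^-1.
    move=> i; have lt : x ord0 i - k.+1%:R^-1 < x ord0 i + k.+1%:R^-1.
      by rewrite ltrBlDr -addrA ltrDl addr_gt0.
    by have [q] := rat_in_itvoo lt; rewrite in_itv/= => qi; exists q.
  exists (\row_i q i, k) => /=.
    move=> y By; apply: xU; split => // i' i; rewrite (ord1 i') /ball/=.
    move: (By i) (Hq i) ke; rewrite /= in_itv/= mxE ltr_norml.
    move: (k.+1%:R^-1) => h /andP[? ?].
    by move=> /andP[? ?] ?; apply/andP; split; lra.
  move=> i /=; rewrite in_itv/= mxE; move: (Hq i) k0.
  move: (k.+1%:R^-1) => h /andP[? ?] ?.
  by apply/andP; split; lra.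
rewrite bigcup_mkcond; apply: (@countable_bigcupT_measurable _ _ ('rV[rat]_N * nat)%type).
  exact: countableP.
move=> p; case: ifP => _; last exact: measurable0.
apply: (measurable_box (A := fun i => `](ratr (p.1 ord0 i) - p.2.+1%:R^-1),
  (ratr (p.1 ord0 i) + p.2.+1%:R^-1)[%classic)) => i.
exact: measurable_itv.
Qed.

Definition cube x r := [set y : 'rV[R]_N | forall i, `[x ord0 i - r, x ord0 i + r]%classic (y ord0 i)].

Lemma measurable_cube x r : measurable (cube x r).
Proof.
apply: (measurable_box (A := fun i => `[x ord0 i - r, x ord0 i + r]%classic)) => i.
exact: measurable_itv.
Qed.

Lemma measure_cube x r : 0 <= r -> leb (cube x r) = ((2 * r) ^+ N)%:E.
Proof.
move=> r0; rewrite /cube.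
rewrite (lebesgue_rV_box (A := fun i => `[x ord0 i - r, x ord0 i + r]%classic)); last first.
  by move=> i; exact: measurable_itv.
rewrite (eq_bigr (fun=> (2 * r)%:E)).
  by rewrite prodEFin prodr_const card_ord.
move=> i _; rewrite lebesgue_measure_itv/= lte_fin.
case: ltP => h; first by congr EFin; lra.
by congr EFin; lra.
Qed.

Lemma enorm_le_cube x y r : enorm (x - y) <= r -> cube x r y.
Proof.
move=> xyr i /=; rewrite in_itv/=.
have := le_trans (coord_le_enorm (x - y) i) xyr; rewrite !mxE ler_norml.
by move=> /andP[? ?]; apply/andP; split; lra.
Qed.

Lemma bounded_set_cube (A : set 'rV[R]_N) : bounded_set A ->
  exists2 r, 0 <= r & A `<=` cube 0 r.
Proof.
move=> [r [rreal Ar]]; exists (`|r| + 2); first by rewrite addr_ge0.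
move=> x Ax i /=; rewrite in_itv/= !mxE !add0r -ler_norml.
have xr : `|x| <= `|r| + 1 by apply: (Ar (`|r| + 1)) => //; rewrite ltr_pwDr ?ler_norm.
have : ball (0 : 'rV[R]_N) (`|r| + 2) x.
  by rewrite mx_norm_ball /ball_/= sub0r normrN (le_lt_trans xr)// ltrD2l ltr1n.
by move=> [_ /(_ ord0 i)]; rewrite /ball/= mxE sub0r normrN => /ltW.
Qed.

Lemma bounded_set_finite (A : set 'rV[R]_N) : measurable A -> bounded_set A ->
  (leb A < +oo)%E.
Proof.
move=> mA /bounded_set_cube[r r0 Ar].
apply: (@le_lt_trans _ _ (leb (cube 0 r))); last by rewrite measure_cube// ltry.
apply: le_measure => //; rewrite inE//; exact: measurable_cube.
Qed.

End euclidean.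

(** * The near and far kernels *)

Lemma dyadic_scale (R : realType) (r : R) : 0 < r <= 1 ->
  exists k, 2^-1 ^+ k.+1 <= r <= 2^-1 ^+ k.
Proof.
move=> /andP[r0 r1].
have ex : exists k, 2^-1 ^+ k.+1 <= r.
  have : (2^-1 : R) ^+ n @[n --> \oo] --> (0 : R) by apply: cvg_expr; rewrite ger0_norm//; lra.
  move/cvgrPdist_le => /(_ r r0)[n _ /(_ n.+1 (leqnSn n))].
  by rewrite sub0r normrN ger0_norm ?exprn_ge0// => h; exists n.
exists (ex_minn ex); case: ex_minnP => k -> kmin /=.
case: k kmin => [|k] kmin; first by rewrite expr0.
rewrite leNgt; apply/negP => /ltW h.
by have := kmin k h; rewrite ltnn.
Qed.

Section kernels.
Context {R : realType} {N : nat}.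
Notation leb := (lebesgue_rV R N).
Notation P := (leb \x leb)%E.

Definition near_kernel (z : 'rV[R]_N * 'rV[R]_N) : R :=
  \1_[set z | enorm (z.1 - z.2) < 1] z / enorm (z.1 - z.2) ^+ N.

Definition far_kernel (z : 'rV[R]_N * 'rV[R]_N) : R :=
  \1_[set z | 1 <= enorm (z.1 - z.2)] z / enorm (z.1 - z.2) ^+ N.

Lemma measurable_near_set :
  measurable [set z : 'rV[R]_N * 'rV[R]_N | enorm (z.1 - z.2) < 1].
Proof.
rewrite (_ : [set _ | _] = setT `&` (fun z => enorm (z.1 - z.2)) @^-1` `]-oo, 1[).
  by apply: measurable_enorm_sub => //; exact: measurable_itv.
by rewrite setTI; apply/seteqP; split => z /=; rewrite in_itv.
Qed.

Lemma measurable_far_set :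
  measurable [set z : 'rV[R]_N * 'rV[R]_N | 1 <= enorm (z.1 - z.2)].
Proof.
rewrite (_ : [set _ | _] = setT `&` (fun z => enorm (z.1 - z.2)) @^-1` `[1, +oo[).
  by apply: measurable_enorm_sub => //; exact: measurable_itv.
by rewrite setTI; apply/seteqP; split => z /=; rewrite in_itv/= andbT.
Qed.

Lemma measurable_inv_enorm_sub : measurable_fun setT
  (fun z : 'rV[R]_N * 'rV[R]_N => (enorm (z.1 - z.2) ^+ N)^-1).
Proof.
apply: measurable_fun_inv; first by move=> z; rewrite exprn_ge0// enorm_ge0.
by apply: measurable_funX; exact: measurable_enorm_sub.
Qed.

Lemma measurable_near_kernel : measurable_fun setT near_kernel.
Proof.
apply: measurable_funM; last exact: measurable_inv_enorm_sub.
by apply: measurable_indic; exact: measurable_near_set.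
Qed.

Lemma measurable_far_kernel : measurable_fun setT far_kernel.
Proof.
apply: measurable_funM; last exact: measurable_inv_enorm_sub.
by apply: measurable_indic; exact: measurable_far_set.
Qed.

Lemma near_kernel_ge0 z : 0 <= near_kernel z.
Proof. by rewrite divr_ge0// exprn_ge0// enorm_ge0. Qed.

Lemma far_kernel_ge0_le1 z : 0 <= far_kernel z <= 1.
Proof.
rewrite divr_ge0 ?exprn_ge0 ?enorm_ge0//= /far_kernel indicE.
case: (boolP (_ \in _)) => [|_]; last by rewrite mul0r.
by rewrite inE/= => h; rewrite mul1r invf_le1 ?exprn_ege1// exprn_gt0// (lt_le_trans _ h).
Qed.

Lemma near_kernel_sym x y : near_kernel (x, y) = near_kernel (y, x).
Proof.
rewrite /near_kernel !indicE /= enorm_sym; congr (_%:R / _).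
by congr nat_of_bool; apply/idP/idP; rewrite !inE/= enorm_sym.
Qed.

Lemma far_kernel_sym x y : far_kernel (x, y) = far_kernel (y, x).
Proof.
rewrite /far_kernel !indicE /= enorm_sym; congr (_%:R / _).
by congr nat_of_bool; apply/idP/idP; rewrite !inE/= enorm_sym.
Qed.

Lemma admissible_log_kernels (Omega : set 'rV[R]_N) : open Omega -> bounded_set Omega ->
  admissible_kernels leb Omega near_kernel far_kernel.
Proof.
move=> oO bO; have mO := measurable_open_rV oO.
split => //.
- exact: bounded_set_finite.
- by split; [exact: measurable_near_kernel|exact: near_kernel_ge0].
- by split; [exact: measurable_far_kernel|exact: far_kernel_ge0_le1].
- exact: far_kernel_sym.
Qed.

(** On the shell where [|x - y|] is about [2^-k] the integrand is about
    [4^-k * 2 ^ (k N)], and the shell lies in a cube of volume about [2 ^ (- k N)]. *)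
Lemma near_kernel_second_moment x :
  (\int[leb]_y (enorm (x - y) ^+ 2 * near_kernel (x, y))%:E <= (2 * 4 ^+ N)%:E)%E.
Proof.
have mxy (f : 'rV[R]_N * 'rV[R]_N -> R) : measurable_fun setT f ->
    measurable_fun setT (fun y => f (x, y)).
  by move=> mf; exact: measurable_fun_pair2.
apply: (integral_le_shells (c := fun k => (2^-1 ^+ k) ^+ 2 * (2 * 2 ^+ k) ^+ N)
  (A := fun k => cube x (2^-1 ^+ k))).
- apply: measurable_funM.
    by apply: measurable_funX; exact: (mxy _ measurable_enorm_sub).
  exact: (mxy _ measurable_near_kernel).
- by move=> y; rewrite mulr_ge0 ?sqr_ge0// near_kernel_ge0.
- by move=> k; exact: measurable_cube.
- by move=> k; rewrite mulr_ge0 ?sqr_ge0// exprn_ge0// mulr_ge0// exprn_ge0.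
- move=> y; rewrite /near_kernel indicE; have [->|r0] := eqVneq (enorm (x - y)) 0.
    by left; rewrite expr0n/= mul0r.
  case: (boolP (_ \in _)) => [|_]; last by left; rewrite mul0r mulr0.
  rewrite inE/= => r1; right.
  have rp : 0 < enorm (x - y) by rewrite lt_neqAle eq_sym r0 enorm_ge0.
  have [k /andP[kr rk]] : exists k, 2^-1 ^+ k.+1 <= enorm (x - y) <= 2^-1 ^+ k.
    by apply: dyadic_scale; rewrite rp ltW.
  exists k; split; first exact: enorm_le_cube.
  rewrite mul1r; apply: ler_pM.
  + exact: sqr_ge0.
  + by rewrite invr_ge0 exprn_ge0// ltW.
  + by rewrite ler_pXn2r// nnegrE ?ltW// exprn_ge0.
  have p2 : 0 < 2 * 2 ^+ k :> R by rewrite mulr_gt0// exprn_gt0.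
  rewrite -exprVn; apply: lerXn2r; rewrite ?nnegrE ?invr_ge0 ?(ltW rp) ?(ltW p2)//.
  by rewrite -[leRHS]invrK lef_pV2 ?posrE ?invr_gt0// -exprS -exprVn.
- move=> k; have mc : leb (cube x (2^-1 ^+ k)) = ((2 * 2^-1 ^+ k) ^+ N)%:E.
    by rewrite measure_cube// exprn_ge0.
  rewrite (_ : _ (cube x _) = ((2 * 2^-1 ^+ k) ^+ N)%:E); last exact: mc.
  rewrite -EFinM lee_fin -mulrA -exprMn.
  have -> : 2 * 2 ^+ k * (2 * 2^-1 ^+ k) = 4 :> R.
    by rewrite mulrACA -exprMn divff// expr1n; lra.
  rewrite mulrC ler_wpM2l ?exprn_ge0// expr2 ler_piMl ?exprn_ge0//.
  by rewrite exprn_ile1//; lra.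
Qed.

End kernels.

(** * Positivity of the normalizing constant *)

Section gamma.
Context {R : realType}.
Notation lebR := (@lebesgue_measure R).

Let gamma_fun (s : R) : R -> R :=
  (fun t => t `^ (s - 1) * expR (- t)) \_ `]0, +oo[%classic.

Let gamma_funE s t : 0 < t -> gamma_fun s t = expR ((s - 1) * ln t) * expR (- t).
Proof.
move=> t0; rewrite /gamma_fun patchE mem_set; last by rewrite /= in_itv/= t0.
by rewrite /powR gt_eqF.
Qed.

Let gamma_fun0 s t : t <= 0 -> gamma_fun s t = 0.
Proof.
by move=> t0; rewrite /gamma_fun patchE memNset//= in_itv/= andbT; apply/negP; rewrite -leNgt.
Qed.

Let gamma_fun_ge0 s t : 0 <= gamma_fun s t.
Proof.
have [t0|t0] := ltP 0 t; last by rewrite gamma_fun0.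
by rewrite gamma_funE// mulr_ge0 ?expR_ge0.
Qed.

Let measurable_gamma_fun s : measurable_fun setT (gamma_fun s).
Proof.
have mi : measurable (`]0, +oo[%classic : set R) by exact: measurable_itv.
apply: (measurable_restrictT _ mi).1; apply: measurable_funTS.
apply: measurable_funM.
  exact: measurable_powR.
exact: measurableT_comp.
Qed.

Let measure_itv0 (b : R) : 0 <= b -> lebR `[0, b]%classic = b%:E.
Proof.
move=> b0; rewrite lebesgue_measure_itv/= lte_fin; case: ltP => [|h]; first by rewrite oppr0 adde0.
by congr EFin; lra.
Qed.

(** For [t <= 1] the integrand is at most [1 / sqrt t]; the shells are those of
    [sqrt t], so that the exponent [s - 1 >= - 1 / 2] gives a geometric series. *)
Let gamma_fun_small s : 1 / 2 <= s ->
  (\int[lebR]_t (gamma_fun s t * \1_(`]-oo, 1]) t)%:E <= (2 * 2)%:E)%E.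
Proof.
move=> s2; refine (integral_le_shells (mu := lebR)
  (f := fun t => gamma_fun s t * \1_(`]-oo, 1]) t) (c := fun k => 2 * 2 ^+ k)
  (A := fun k => `[0, (2^-1 ^+ k) ^+ 2]%classic) (B := 2) _ _ _ _ _ _).
- apply: measurable_funM; [exact: measurable_gamma_fun|exact: measurable_indic].
- by move=> t; rewrite mulr_ge0// gamma_fun_ge0.
- by move=> k; exact: measurable_itv.
- by move=> k; rewrite mulr_ge0// exprn_ge0.
- move=> t; have [t0|t0] := ltP 0 t; last by left; rewrite gamma_fun0// mul0r.
  rewrite indicE; case: (boolP (_ \in _)) => [|_]; last by left; rewrite mulr0.
  rewrite inE/= in_itv/= => t1; right; rewrite mulr1 gamma_funE//.
  have r0 : 0 < Num.sqrt t by rewrite sqrtr_gt0.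
  have r1 : Num.sqrt t <= 1 by rewrite -sqrtr1 ler_wsqrtr.
  have rt : Num.sqrt t ^+ 2 = t by rewrite sqr_sqrtr// ltW.
  have [k /andP[kr rk]] : exists k, 2^-1 ^+ k.+1 <= Num.sqrt t <= 2^-1 ^+ k.
    by apply: dyadic_scale; rewrite r0.
  exists k; split.
    by rewrite /= in_itv/= (ltW t0)/= -[leLHS]rt ler_pXn2r// nnegrE ?ltW// exprn_ge0.
  have lt : ln t = 2 * ln (Num.sqrt t) by rewrite -{1}rt lnXn// mulr_natl.
  apply: (@le_trans _ _ (Num.sqrt t)^-1).
    rewrite -[leRHS]mulr1; apply: ler_pM; rewrite ?expR_ge0//.
      rewrite -[X in X^-1](lnK (x := Num.sqrt t)) ?posrE// -expRN ler_expR lt.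
      by have := ln_le0 r1; nra.
    by rewrite -expR0 ler_expR oppr_le0 ltW.
  have p2 : 0 < 2 * 2 ^+ k :> R by rewrite mulr_gt0// exprn_gt0.
  by rewrite -[leRHS]invrK lef_pV2 ?posrE ?invr_gt0// -exprS -exprVn.
- move=> k; rewrite (_ : _ (`[0, _]%classic) = ((2^-1 ^+ k) ^+ 2)%:E); last first.
    by apply: measure_itv0; rewrite sqr_ge0.
  rewrite -EFinM lee_fin expr2 mulrA -[2 * _ * _]mulrA -exprMn divff//.
  by rewrite expr1n mulr1.
Qed.

(** For [t >= 1] the exponential beats every power, so that the integrand is at
    most [K / t ^ 2]; the shells are those of [1 / t]. *)
Let gamma_fun_large s : exists B : R,
  (\int[lebR]_t (gamma_fun s t * \1_(`]1, +oo[) t)%:E <= B%:E)%E.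
Proof.
have [n sn] : exists n : nat, s + 1 <= n.+1%:R.
  exists (Num.bound `|s|); rewrite -natr1 lerD2r.
  by apply: le_trans (ler_norm s) _; apply: ltW; apply: archi_boundP.
pose K : R := (n.+1)`!%:R.
have K0 : 0 < K by rewrite ltr0n fact_gt0.
exists (2 * (2 * K)); refine (integral_le_shells (mu := lebR)
  (f := fun t => gamma_fun s t * \1_(`]1, +oo[) t) (c := fun k => K * (2^-1 ^+ k) ^+ 2)
  (A := fun k => `[0, 2 * 2 ^+ k]%classic) (B := 2 * K) _ _ _ _ _ _).
- apply: measurable_funM; [exact: measurable_gamma_fun|exact: measurable_indic].
- by move=> t; rewrite mulr_ge0// gamma_fun_ge0.
- by move=> k; exact: measurable_itv.
- by move=> k; rewrite mulr_ge0 ?sqr_ge0// ltW.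
- move=> t; rewrite indicE; case: (boolP (_ \in _)) => [|_]; last by left; rewrite mulr0.
  rewrite inE/= in_itv/= andbT => t1; right; rewrite mulr1.
  have t0 : 0 < t by lra.
  rewrite gamma_funE//.
  have [k /andP[kr rk]] : exists k, 2^-1 ^+ k.+1 <= t^-1 <= 2^-1 ^+ k.
    by apply: dyadic_scale; rewrite invr_gt0 t0/= invf_le1// ltW.
  have p2 : 0 < 2 * 2 ^+ k :> R by rewrite mulr_gt0// exprn_gt0.
  exists k; split.
    rewrite /= in_itv/= (ltW t0)/= -[leLHS]invrK -[leRHS]invrK.
    by rewrite lef_pV2 ?posrE ?invr_gt0// -exprS -exprVn.
  apply: (@le_trans _ _ (K * t^-1 ^+ 2)); last first.
    by rewrite ler_pM2l// ler_pXn2r// nnegrE ?invr_ge0 ?exprn_ge0// ltW.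
  rewrite exprVn ler_pdivlMr ?exprn_gt0//.
  have te j : t ^+ j = expR (j%:R * ln t) by rewrite expRM_natl lnK// posrE.
  have h1 : expR ((s - 1) * ln t) * t ^+ 2 <= t ^+ n.+1.
    rewrite !te -expRD ler_expR -mulrDl ler_wpM2r ?ln_ge0 ?(ltW t1)//.
    by apply: le_trans sn; lra.
  have h2 : t ^+ n.+1 * expR (- t) <= K.
    rewrite expRN ler_pdivrMr ?expR_gt0// mulrC -ler_pdivrMr//.
    by apply: le_trans (expR_ge1Dxn n (ltW t0)); rewrite lerDr.
  rewrite mulrAC; apply: le_trans h2.
  by rewrite ler_wpM2r ?expR_ge0.
- move=> k; rewrite (_ : _ (`[0, _]%classic) = (2 * 2 ^+ k)%:E); last first.
    by apply: measure_itv0; rewrite mulr_ge0// exprn_ge0.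
  rewrite -EFinM lee_fin.
  have -> : K * (2^-1 ^+ k) ^+ 2 * (2 * 2 ^+ k) = 2 * K * 2^-1 ^+ k * (2 ^+ k * 2^-1 ^+ k) by ring.
  by rewrite -exprMn divff// expr1n mulr1.
Qed.

(** The integral would have the value [0] if it diverged, so integrability is the
    main point; the integrand is positive. *)
Lemma Gamma_gt0 (s : R) : 1 / 2 <= s -> 0 < Gamma s.
Proof.
move=> s2; rewrite /Gamma Rintegral_mkcond -/(gamma_fun s).
have ig : itg lebR (gamma_fun s).
  have i1 : itg lebR (fun t => gamma_fun s t * \1_(`]-oo, 1]) t).
    apply/itg_ge0P; last exact: le_lt_trans (gamma_fun_small s2) (ltry _).
      by apply: measurable_funM; [exact: measurable_gamma_fun|exact: measurable_indic].
    by move=> t; rewrite mulr_ge0// gamma_fun_ge0.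
  have i2 : itg lebR (fun t => gamma_fun s t * \1_(`]1, +oo[) t).
    have [B HB] := gamma_fun_large s.
    apply/itg_ge0P; last exact: le_lt_trans HB (ltry _).
      by apply: measurable_funM; [exact: measurable_gamma_fun|exact: measurable_indic].
    by move=> t; rewrite mulr_ge0// gamma_fun_ge0.
  rewrite (_ : gamma_fun s = fun t => gamma_fun s t * \1_(`]-oo, 1]) t +
    gamma_fun s t * \1_(`]1, +oo[) t); first exact: itgD.
  apply/funext => t; rewrite !indicE -mulrDr.
  have [t1|t1] := leP t 1.
    by rewrite mem_set ?memNset ?addr0 ?mulr1//= in_itv/= ?t1// andbT; apply/negP; rewrite -leNgt.
  by rewrite memNset ?mem_set ?add0r ?mulr1//= in_itv/= ?t1//; apply/negP; rewrite -ltNge.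
rewrite ltNge; apply/negP => h.
have [A [mA A0 sA]] := Rint_eq0_ae ig (gamma_fun_ge0 s) h.
have A0' : lebR A = 0%E := A0.
have : (lebR (`[1%R, 2%R]%classic : set R) <= lebR A)%E.
  apply: le_measure; [by rewrite inE; exact: measurable_itv|by rewrite inE|].
  move=> t; rewrite /= in_itv/= => /andP[t1 t2]; apply: sA => /=.
  rewrite gamma_funE; last lra.
  by apply/eqP; rewrite mulf_neq0// gt_eqF// expR_gt0.
rewrite A0' lebesgue_measure_itv/= lte_fin ltr1n/= -EFinB lee_fin; lra.
Qed.

Lemma c_gt0 (N : nat) : (1 <= N)%N -> 0 < c_ R N.
Proof.
move=> N1; rewrite /c_ mulr_gt0//; first by rewrite powR_gt0// pi_gt0.
by apply: Gamma_gt0; rewrite ler_pM2r ?invr_gt0// ler1n.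
Qed.

End gamma.

(** * A bump function of finite energy *)

Section test_function.
Context {R : realType} {N : nat}.
Notation leb := (lebesgue_rV R N).
Notation P := (leb \x leb)%E.
Implicit Types x y : 'rV[R]_N.

Lemma measurable_lipschitz (f : 'rV[R]_N -> R) :
  (forall x y, `|f x - f y| <= `|x - y|) -> measurable_fun setT f.
Proof.
move=> fl; apply: (measurability _ (RGenOInfty.measurableE R)).
move=> _ [_ [a ->] <-]; rewrite setTI; apply: measurable_open_rV.
rewrite openE => x /=; rewrite in_itv/= andbT => ax.
apply/nbhs_ballP; exists (f x - a) => /=; first by rewrite subr_gt0.
move=> y; rewrite mx_norm_ball /ball_/= in_itv/= andbT => xy.
have := le_lt_trans (fl x y) xy; rewrite ltr_norml => /andP[]; lra.
Qed.

Variable Omega : set 'rV[R]_N.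
Hypotheses (N1 : (1 <= N)%N) (oO : open Omega) (bO : bounded_set Omega).

Let dist x := inf [set `|x - y| | y in ~` Omega].

Let complement_nonempty : exists y, ~ Omega y.
Proof.
have [r r0 Or] := bounded_set_cube bO.
exists (const_mx (r + 1)) => /Or /(_ (Ordinal N1)).
rewrite /= in_itv/= !mxE add0r => /andP[_]; lra.
Qed.

Let dist_lb x : has_lbound [set `|x - y| | y in ~` Omega].
Proof. by exists 0 => _ [y _ <-]. Qed.

Let le_dist x a : (forall y, ~ Omega y -> a <= `|x - y|) -> a <= dist x.
Proof.
move=> h; apply: lb_le_inf; last by move=> _ [y yO <-]; exact: h.
by have [y yO] := complement_nonempty; exists `|x - y|, y.
Qed.

Let dist_le x y : ~ Omega y -> dist x <= `|x - y|.
Proof. by move=> yO; apply: ge_inf => //; exists y. Qed.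

Let dist_lipschitz x y : `|dist x - dist y| <= `|x - y|.
Proof.
have h x' y' : dist x' - `|x' - y'| <= dist y'.
  apply: le_dist => z zO; rewrite lerBlDr; apply: le_trans (dist_le x' zO) _.
  by rewrite [leRHS]addrC; apply: le_trans (ler_normD _ _); rewrite addrA subrK.
have h1 := h x y; have h2 := h y x; rewrite (distrC y) in h2.
by rewrite ler_norml; apply/andP; split; lra.
Qed.

Let dist_gt0 x : Omega x -> 0 < dist x.
Proof.
move=> Ox; have /nbhs_ballP[e /= e0 xO] : nbhs x Omega by apply: open_nbhs_nbhs.
apply: lt_le_trans e0 _; apply: le_dist => y yO; rewrite leNgt; apply/negP => xy.
by apply: yO; apply: xO; rewrite mx_norm_ball.
Qed.

Definition bump x := Num.min 1 (dist x).

Lemma bump_gt0 x : Omega x -> 0 < bump x.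
Proof. by move=> Ox; rewrite lt_min ltr01 dist_gt0. Qed.

Lemma bump_bounds x : 0 <= bump x <= 1.
Proof.
rewrite ge_min lexx/= andbT le_min ler01/=; exact: le_dist.
Qed.

Lemma bump_out x : ~ Omega x -> bump x = 0.
Proof.
move=> xO; have := dist_le x xO; rewrite subrr normr0 => h.
have /andP[h1 _] := bump_bounds x.
by apply/le_anti; rewrite h1 andbT ge_min h orbT.
Qed.

Lemma bump_lipschitz x y : `|bump x - bump y| <= `|x - y|.
Proof.
have := dist_lipschitz x y; have := normr_ge0 (x - y); rewrite !ler_norml /bump.
move=> ? /andP[? ?].
by case: (leP 1 (dist x)) => ?; case: (leP 1 (dist y)) => ?; apply/andP; split; lra.
Qed.

Let mO : measurable Omega := measurable_open_rV oO.
Let fO : (leb Omega < +oo)%E := bounded_set_finite mO bO.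

(** The bump is Lipschitz with bounded support, and its energy is controlled by
    the second moment of the near kernel. *)
Lemma bump_energy : energy_space leb Omega near_kernel bump.
Proof.
have mb := measurable_lipschitz bump_lipschitz.
have adm := admissible_log_kernels oO bO.
split => //.
- apply: (supp_integrable adm (B := 1)); first by mfun.
    by move=> x xO; rewrite bump_out// expr0n.
  move=> x; have /andP[b0 b1] := bump_bounds x.
  by rewrite ger0_norm ?sqr_ge0// expr_le1.
- exact: bump_out.
pose h (z : 'rV[R]_N * 'rV[R]_N) : R := enorm (z.1 - z.2) ^+ 2 * near_kernel z.
have mh : measurable_fun setT h.
  apply: measurable_funM; last exact: measurable_near_kernel.
  by apply: measurable_funX; exact: measurable_enorm_sub.
have h0 z : 0 <= h z by rewrite mulr_ge0 ?sqr_ge0// near_kernel_ge0.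
have hC z : h (z.2, z.1) = h z.
  by case: z => x y; rewrite /h /= near_kernel_sym enorm_sym.
have m1 : measurable_fun setT (fun z : 'rV[R]_N * 'rV[R]_N => \1_Omega z.1 : R).
  by apply: measurable_fun_fst; exact: measurable_indic.
have i1 : itg P (fun z => \1_Omega z.1 * h z).
  apply/itg_ge0P; [exact: measurable_funM|by move=> z; rewrite mulr_ge0|].
  rewrite fubini_tonelli1//; last 2 first.
  - by apply/measurable_EFinP; exact: measurable_funM.
  - by move=> z; rewrite lee_fin mulr_ge0.
  apply: (@le_lt_trans _ _ (\int[leb]_x ((2 * 4 ^+ N) * \1_Omega x)%:E)%E).
    apply: ge0_le_integral => //.
    + by move=> x _; apply: integral_ge0 => y _; rewrite lee_fin mulr_ge0.
    + apply: measurable_fun_fubini_tonelli_F.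
      by apply/measurable_EFinP; exact: measurable_funM.
    + by move=> z; rewrite lee_fin mulr_ge0.
    + by apply/measurable_EFinP; apply: measurable_funM => //; exact: measurable_indic.
    move=> x _; rewrite /fubini_F /=.
    under eq_integral do rewrite EFinM.
    rewrite ge0_integralZl_EFin//; last 2 first.
    + by move=> y _; rewrite lee_fin.
    + by apply/measurable_EFinP; exact: measurable_fun_pair2.
    rewrite mulrC EFinM lee_wpmul2l ?lee_fin//.
    exact: near_kernel_second_moment.
  rewrite (EFin_Rint (itgZ _ (itg_indic mO fO))); exact: ltry.
have i2 : itg P (fun z => \1_Omega z.2 * h z).
  have e : (fun z => \1_Omega z.2 * h z) =
      (fun z : 'rV[R]_N * 'rV[R]_N => \1_Omega (z.2, z.1).1 * h (z.2, z.1)).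
    by apply/funext => z; rewrite hC.
  by rewrite e; exact: (itg_swap i1).
apply: (itg_dom _ (itgD i1 i2)).
  apply: measurable_funM; last exact: measurable_near_kernel.
  apply: measurable_funX; apply: measurable_funB.
    exact: measurable_fun_fst.
  exact: measurable_fun_snd.
move=> z; rewrite -mulrDl (mulrA _ (enorm _ ^+ 2) (near_kernel z)) ger0_norm; last first.
  by rewrite mulr_ge0 ?sqr_ge0 ?near_kernel_ge0.
rewrite ler_wpM2r ?near_kernel_ge0//.
have bump_le : (bump z.1 - bump z.2) ^+ 2 <= enorm (z.1 - z.2) ^+ 2.
  rewrite -(real_normK (num_real (_ - _))) ler_pXn2r ?nnegrE ?enorm_ge0//.
  by apply: le_trans (bump_lipschitz _ _) (mx_norm_le_enorm _).
have e0 := sqr_ge0 (enorm (z.1 - z.2)).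
have [zO1|zO1] := pselect (Omega z.1).
  apply: (le_trans bump_le); rewrite ler_peMl// [X in X + _]indicE mem_set//.
  by rewrite lerDl.
have [zO2|zO2] := pselect (Omega z.2).
  apply: (le_trans bump_le); rewrite ler_peMl// [X in _ + X]indicE mem_set//.
  by rewrite lerDr.
by rewrite !bump_out// subrr expr0n/= mulr_ge0 ?sqr_ge0// addr_ge0.
Qed.

End test_function.

(** * The logarithmic form as an abstract form *)

Lemma Lfun2P d (T : measurableType d) (R : realType)
    (mu : {measure set T -> \bar R}) (f : T -> R) :
  f \in Lfun mu 2%:E <-> measurable_fun setT f /\ itg mu (fun x => f x ^+ 2).
Proof.
split=> [f2|[mf f2]].
  split; last exact: Lfun2_integrable_sqr.
  by move: f2; rewrite inE => /andP[+ _]; rewrite inE.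
rewrite inE; apply/andP; split; rewrite inE//= /finite_norm unlock poweR_lty//.
under eq_integral do rewrite /= powR_mulrn// real_normK ?num_real//.
by rewrite EFin_Rint// ltry.
Qed.

(** The inner real integral is finite for almost every [x] only, where it agrees
    with the extended one. *)
Lemma Rint_fubini d (T : measurableType d) (R : realType)
    (m : {sigma_finite_measure set T -> \bar R}) (F : T * T -> R) :
  itg (m \x m)%E F -> \int[m]_x \int[m]_y F (x, y) = \int[(m \x m)%E]_z F z.
Proof.
move=> iF; rewrite [RHS]/Rintegral -(integral12_prod_meas1 iF).
have mF := measurable_fubini_F iF.
congr fine; apply: ae_eq_integral => //.
  by apply/measurable_EFinP; exact: (measurableT_comp _ mF).
have := integrable_ae measurableT (integrable_fubini_F iF).
by apply: filterS => x /(_ I) h _; rewrite /Rintegral fineK.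
Qed.

Section bridge.
Context {R : realType} {N : nat}.
Notation leb := (lebesgue_rV R N).
Notation P := (leb \x leb)%E.
Notation energy Omega := (energy_space leb Omega near_kernel).
Notation lform := (form leb near_kernel far_kernel (c_ R N) (rho_ R N)).
Implicit Types u v : 'rV[R]_N -> R.

Lemma measurable_le1_set :
  measurable [set z : 'rV[R]_N * 'rV[R]_N | enorm (z.1 - z.2) <= 1].
Proof.
rewrite (_ : [set _ | _] = setT `&` (fun z => enorm (z.1 - z.2)) @^-1` `]-oo, 1]).
  by apply: measurable_enorm_sub => //; exact: measurable_itv.
by rewrite setTI; apply/seteqP; split => z /=; rewrite in_itv.
Qed.

(** The near part of the logarithmic form is an iterated integral; integrability
    of the integrand makes it a double one. *)
Lemma E_LE u v :
  itg P (fun z => (u z.1 - u z.2) * (v z.1 - v z.2) * near_kernel z) ->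
  E_L u v = lform u v.
Proof.
move=> iuv.
have near_eq : \int[leb]_x \int[leb]_(y in [set y | enorm (x - y) < 1])
    ((u x - u y) * (v x - v y) / enorm (x - y) ^+ N) = near_form leb near_kernel u v.
  rewrite /near_form -(Rint_fubini iuv); apply: eq_Rintegral => x _.
  rewrite Rintegral_mkcond; apply: eq_Rintegral => y _.
  rewrite patchE /near_kernel indicE /=.
  rewrite (_ : ((x, y) \in _) = (y \in [set y | enorm (x - y) < 1])); last first.
    by apply/idP/idP; rewrite !inE.
  by case: ifP => _; rewrite ?mul1r// mul0r mulr0.
have far_eq : \int[P]_(z in [set z | 1 <= enorm (z.1 - z.2)])
    (u z.1 * v z.2 / enorm (z.1 - z.2) ^+ N) = far_form leb far_kernel u v.
  rewrite Rintegral_mkcond; apply: eq_Rintegral => z _.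
  rewrite patchE /far_kernel indicE /=.
  by case: ifP => _; rewrite ?mul1r// mul0r mulr0.
by rewrite /E_L near_eq far_eq.
Qed.

Lemma HH_measurable Omega u : HH Omega u -> measurable_fun setT u.
Proof. by case=> /Lfun2P[]. Qed.

Lemma HH_near_integrable Omega u : HH Omega u ->
  itg P (fun z => (u z.1 - u z.2) ^+ 2 * near_kernel z).
Proof.
move=> hu; have mu := HH_measurable hu; case: hu => _ _ h.
have mk := @measurable_near_kernel R N.
apply/itg_ge0P.
- by apply: measurable_funM => //; mfun.
- by move=> z; rewrite mulr_ge0 ?sqr_ge0 ?near_kernel_ge0.
apply: le_lt_trans h; rewrite [leRHS]integral_mkcond.
apply: ge0_le_integral => //.
- by move=> z _; rewrite lee_fin mulr_ge0 ?sqr_ge0 ?near_kernel_ge0.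
- by apply/measurable_EFinP; apply: measurable_funM => //; mfun.
- apply: (measurable_restrictT _ measurable_le1_set).1; apply: measurable_funTS.
  apply/measurable_EFinP; apply: measurable_funM; last exact: measurable_inv_enorm_sub.
  by mfun.
move=> z _; rewrite patchE /near_kernel indicE real_normK ?num_real//.
case: (boolP (z \in [set z | enorm (z.1 - z.2) < 1])) => z1.
  rewrite ifT ?mul1r// inE/=; rewrite inE/= in z1; exact: ltW.
rewrite mul0r mulr0; case: ifP => // _.
by rewrite lee_fin divr_ge0 ?sqr_ge0// exprn_ge0// enorm_ge0.
Qed.

Lemma HH_energy_space Omega u u' : HH Omega u -> measurable_fun setT u' ->
  {ae leb, forall x, u' x = u x} -> (forall x, ~ Omega x -> u' x = 0) ->
  energy Omega u'.
Proof.
move=> hu mu' ae0 u0; have mu := HH_measurable hu.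
have mk := @measurable_near_kernel R N.
have [/Lfun2P[_ u2] _ _] := hu.
split => //.
  apply: itg_ae u2; first by mfun.
  by apply: filterS ae0 => x ->.
apply: itg_ae (HH_near_integrable hu); first by apply: measurable_funM => //; mfun.
by apply: filterS (ae_prod ae0) => z [-> ->].
Qed.

Lemma measure_slice_le1 x :
  (\int[leb]_y (\1_[set z : 'rV[R]_N * 'rV[R]_N | enorm (z.1 - z.2) <= 1] (x, y))%:E
    <= (2 ^+ N)%:E)%E.
Proof.
apply: (@le_trans _ _ (\int[leb]_y (\1_(cube x 1) y : R)%:E)%E).
  apply: ge0_le_integral => //.
  - apply/measurable_EFinP; apply: (@measurable_fun_pair2 _ _ _ _ _ _ _ x).
    by apply: measurable_indic; exact: measurable_le1_set.
  - by apply/measurable_EFinP; apply: measurable_indic; exact: measurable_cube.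
  move=> y _; rewrite lee_fin !indicE.
  case: (boolP ((x, y) \in _)) => // ; rewrite inE/= => /enorm_le_cube h.
  by rewrite mem_set.
rewrite (integral_indic _ measurableT (measurable_cube x 1)) setIT.
have mc : leb (cube x 1) = (2 ^+ N)%:E by rewrite measure_cube// mulr1.
by rewrite -mc.
Qed.

(** The energy in the definition of the function space includes the pairs at
    distance exactly one, where the integrand is at most twice
    [u(x) ^ 2 + u(y) ^ 2] and is summed over a set with bounded sections. *)
Lemma energy_space_HH Omega u : energy Omega u -> HH Omega u.
Proof.
move=> [mu u2 u0 un]; split.
- exact/Lfun2P.
- exact: aeW.
have mk := @measurable_near_kernel R N.
pose b : 'rV[R]_N * 'rV[R]_N -> R := \1_[set z | enorm (z.1 - z.2) <= 1].
have mb : measurable_fun setT b by apply: measurable_indic; exact: measurable_le1_set.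
have b0 z : 0 <= b z by [].
have i1 : itg P (fun z => u z.1 ^+ 2 * b z).
  apply/itg_ge0P; [by apply: measurable_funM => //; mfun|by move=> z; rewrite mulr_ge0 ?sqr_ge0|].
  rewrite fubini_tonelli1//; last 2 first.
  - by apply/measurable_EFinP; apply: measurable_funM => //; mfun.
  - by move=> z; rewrite lee_fin mulr_ge0 ?sqr_ge0.
  apply: (@le_lt_trans _ _ (\int[leb]_x ((2 ^+ N) * u x ^+ 2)%:E)%E).
    apply: ge0_le_integral => //.
    + by move=> x _; apply: integral_ge0 => y _; rewrite lee_fin mulr_ge0 ?sqr_ge0.
    + apply: measurable_fun_fubini_tonelli_F.
      by apply/measurable_EFinP; apply: measurable_funM => //; mfun.
    + by move=> z; rewrite lee_fin mulr_ge0 ?sqr_ge0.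
    + by apply/measurable_EFinP; mfun.
    move=> x _; rewrite /fubini_F /=.
    under eq_integral do rewrite EFinM.
    rewrite ge0_integralZl_EFin//; last 3 first.
    + by move=> y _; rewrite lee_fin.
    + by apply/measurable_EFinP; exact: measurable_fun_pair2.
    + exact: sqr_ge0.
    have -> : (2 ^+ N * u x ^+ 2)%:E = ((u x ^+ 2)%:E * (2 ^+ N)%:E)%E.
      by rewrite -EFinM mulrC.
    rewrite lee_wpmul2l ?lee_fin ?sqr_ge0//.
    exact: measure_slice_le1.
  by rewrite (EFin_Rint (itgZ _ u2)) ltry.
have i2 : itg P (fun z => u z.2 ^+ 2 * b z).
  have e : (fun z => u z.2 ^+ 2 * b z) =
      (fun z : 'rV[R]_N * 'rV[R]_N => u (z.2, z.1).1 ^+ 2 * b (z.2, z.1)).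
    apply/funext => z /=; congr (_ * _); rewrite /b !indicE; congr (nat_of_bool _)%:R.
    by apply/idP/idP; rewrite !inE/= enorm_sym.
  by rewrite e; exact: (itg_swap i1).
have i3 := itgD un (itgZ 2 (itgD i1 i2)).
have : (\int[P]_z ((u z.1 - u z.2) ^+ 2 * near_kernel z +
    2 * (u z.1 ^+ 2 * b z + u z.2 ^+ 2 * b z))%:E < +oo)%E by rewrite (EFin_Rint i3) ltry.
apply: le_lt_trans; rewrite [leLHS]integral_mkcond.
apply: ge0_le_integral => //.
- move=> z _; rewrite patchE; case: ifP => // _.
  by rewrite lee_fin divr_ge0 ?sqr_ge0// exprn_ge0// enorm_ge0.
- apply: (measurable_restrictT _ measurable_le1_set).1; apply: measurable_funTS.
  apply/measurable_EFinP; apply: measurable_funM; last exact: measurable_inv_enorm_sub.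
  by mfun.
- apply/measurable_EFinP; exact: (itg_measurable i3).
move=> z _; rewrite patchE real_normK ?num_real// /b indicE.
case: ifPn => zle; last first.
  by rewrite !mulr0 addr0 mulr0 addr0 lee_fin mulr_ge0 ?sqr_ge0 ?near_kernel_ge0.
rewrite !mulr1 lee_fin /near_kernel indicE.
case: (boolP (z \in _)) => z1.
  by rewrite mul1r lerDl mulr_ge0 ?addr_ge0 ?sqr_ge0.
have -> : enorm (z.1 - z.2) = 1.
  move: z1 zle; rewrite notin_setE inE/= => /negP; rewrite -leNgt => h1 h2.
  by apply/le_anti; rewrite h1 h2.
rewrite mul0r mulr0 add0r expr1n divr1.
by have := sqr_ge0 (u z.1 + u z.2); lra.
Qed.

(** The form does not distinguish functions that agree almost everywhere. *)
Lemma E_L_ae Omega u v u' v' : HH Omega u -> HH Omega v ->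
  measurable_fun setT u' -> measurable_fun setT v' ->
  {ae leb, forall x, u' x = u x} -> {ae leb, forall x, v' x = v x} ->
  E_L u v = lform u' v'.
Proof.
move=> hu hv mu' mv' aeu aev.
have mu := HH_measurable hu; have mv := HH_measurable hv.
have mk := @measurable_near_kernel R N; have mf := @measurable_far_kernel R N.
rewrite E_LE.
  congr (_ * _ - _ * _ + _ * _).
  - apply: eq_Rint_ae; [by apply: measurable_funM => //; mfun|by apply: measurable_funM => //; mfun|].
    by apply: filterS2 (ae_prod aeu) (ae_prod aev) => z [-> ->] [-> ->].
  - apply: eq_Rint_ae; [by apply: measurable_funM => //; mfun|by apply: measurable_funM => //; mfun|].
    by apply: filterS2 (ae_prod aeu) (ae_prod aev) => z [-> _] [_ ->].
  - apply: eq_Rint_ae; [mfun|mfun|].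
    by apply: filterS2 aeu aev => x -> ->.
apply: (itg_dom (g := fun z => (u z.1 - u z.2) ^+ 2 * near_kernel z +
  (v z.1 - v z.2) ^+ 2 * near_kernel z)).
- by apply: measurable_funM => //; mfun.
- exact: (itgD (HH_near_integrable hu) (HH_near_integrable hv)).
move=> z; rewrite -mulrDl normrM (ger0_norm (near_kernel_ge0 _)) ler_wpM2r ?near_kernel_ge0//.
exact: normr_mul_le_sqr.
Qed.

End bridge.

(** * Weak solutions *)

Section weak_solutions.
Context {R : realType} {N : nat}.
Variables (Omega : set 'rV[R]_N) (mu : R).
Notation leb := (lebesgue_rV R N).
Notation energy := (energy_space leb Omega near_kernel).
Notation lform := (form leb near_kernel far_kernel (c_ R N) (rho_ R N)).
Notation competitor := (competitor leb Omega near_kernel).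
Notation solution := (solution leb Omega near_kernel far_kernel (c_ R N) (rho_ R N) mu).
Implicit Types u v w : 'rV[R]_N -> R.

Hypothesis oO : open Omega.

Let mO : measurable Omega := measurable_open_rV oO.

Lemma solution_weak M u : competitor M u -> solution u -> weak_solution Omega mu u.
Proof.
move=> [hu uM] su; have hhu := energy_space_HH hu; split=> // v hv.
have mv := HH_measurable hv; have mu_ := energy_space_measurable hu.
pose v' x := \1_Omega x * v x.
have mv' : measurable_fun setT v' by apply: measurable_funM => //; exact: measurable_indic.
have vv' : {ae leb, forall x, v' x = v x}.
  case: hv => _ + _; apply: filterS => x vx; rewrite /v'.
  have [Ox|nOx] := pselect (Omega x).
    by rewrite indicE mem_set// mul1r.
  by rewrite (vx nOx) mulr0.
have hv' : energy v'.
  apply: (HH_energy_space hv mv' vv') => x nOx.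
  by rewrite /v' indicE memNset// mul0r.
rewrite (E_L_ae hhu hv mu_ mv' (aeW _ _) vv')// (su _ hv').
congr (_ * _); rewrite [RHS]Rintegral_mkcond; apply: eq_Rintegral => x _; rewrite patchE /v' indicE.
have /andP[u0 _] := uM x.
by case: ifP => _; rewrite ?mul1r ?(ger0_norm u0)// !mul0r mulr0 mul0r.
Qed.

(** Changing a weak solution on a null set makes its sign, its bound and its
    support hold at every point. *)
Lemma weak_solution_repr w : weak_solution Omega mu w -> positive_in Omega w ->
  ae_bounded w ->
  exists M w', [/\ 0 <= M, competitor M w', forall x, Omega x -> 0 < w' x, solution w' &
    {ae leb, forall x, w' x = w x}].
Proof.
move=> [hw weakw] posw [M0 wM0].
pose M := Num.max M0 1.
have M1 : 1 <= M by rewrite le_max lexx orbT.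
have mw := HH_measurable hw.
(* The value [1] replaces those of [w] outside the range wanted. *)
pose S := w @^-1` `]0, M]%classic.
have mS : measurable S.
  by rewrite -[S]setTI; apply: mw => //; exact: measurable_itv.
pose w' x := \1_Omega x * (w x * \1_S x + \1_(~` S) x).
have mw' : measurable_fun setT w'.
  apply: measurable_funM; first exact: measurable_indic.
  apply: measurable_funD; last by apply: measurable_indic; exact: measurableC.
  by apply: measurable_funM => //; exact: measurable_indic.
have w'out x : ~ Omega x -> w' x = 0 by move=> nOx; rewrite /w' indicE memNset// mul0r.
have w'S x : Omega x -> S x -> w' x = w x.
  move=> Ox Sx; rewrite /w' !indicE mem_set// mem_set// memNset/=; last by move/(_ Sx).
  by rewrite mul1r mulr1 addr0.
have w'nS x : Omega x -> ~ S x -> w' x = 1.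
  move=> Ox Sx; rewrite /w' !indicE mem_set// memNset// mem_set//.
  by rewrite mul1r mulr0 add0r.
have w'pos x : Omega x -> 0 < w' x.
  move=> Ox; have [Sx|nSx] := pselect (S x); last by rewrite w'nS.
  by rewrite w'S//; move: Sx; rewrite /S/= in_itv/= => /andP[].
have w'M x : 0 <= w' x <= M.
  have [Ox|nOx] := pselect (Omega x); last by rewrite w'out// lexx (le_trans ler01).
  rewrite (ltW (w'pos x Ox))/=; have [Sx|nSx] := pselect (S x); last by rewrite w'nS.
  by rewrite w'S//; move: Sx; rewrite /S/= in_itv/= => /andP[].
have aew : {ae leb, forall x, w' x = w x}.
  have [_ wout _] := hw.
  apply: filterS3 wout posw wM0 => x wx px wMx.
  have [Ox|nOx] := pselect (Omega x); last by rewrite w'out// wx.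
  rewrite w'S// /S /= in_itv/= px//=.
  by apply: le_trans (ler_norm _) (le_trans wMx _); rewrite le_max lexx.
have hw' : energy w' := HH_energy_space hw mw' aew w'out.
have cw' : competitor M w' by [].
exists M, w'; split => //; first exact: le_trans M1.
move=> phi hphi; have hhphi := energy_space_HH hphi.
have mphi := energy_space_measurable hphi.
rewrite -(E_L_ae hw hhphi mw' mphi aew (aeW _ _))// (weakw _ hhphi).
congr (_ * _); rewrite [LHS]Rintegral_mkcond; apply: eq_Rint_ae.
- by apply: (measurable_restrictT _ mO).1; apply: measurable_funTS; mfun.
- by mfun.
apply: filterS aew => x wx; rewrite patchE.
case: (boolP (x \in Omega)) => [|nOx].
  by rewrite inE => Ox; rewrite -wx gtr0_norm// w'pos.
rewrite w'out ?mul0r//; move: nOx; rewrite notin_setE//.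
Qed.

End weak_solutions.

Theorem theorem5p5 (R : realType) (N : nat) (Omega : set 'rV[R]_N) (mu : R) :
  (1 <= N)%N ->
  open Omega -> bounded_set Omega -> class_C2 Omega ->
  0 < mu ->
  exists u : 'rV[R]_N -> R,
    [/\ weak_solution Omega mu u, positive_in Omega u & ae_bounded u] /\
    forall w : 'rV[R]_N -> R,
      [/\ weak_solution Omega mu w, positive_in Omega w & ae_bounded w] ->
      {ae lebesgue_rV R N, forall x, w x = u x}.
Proof.
move=> N1 oO bO _ mu0.
have adm := admissible_log_kernels oO bO.
have c0 := @c_gt0 R N N1.
have V0 : 0 <= \int[lebesgue_rV R N]_x (\1_Omega x : R) by apply: Rint_ge0.
have [M [M2 HM]] := exists_truncation_level (rho_ R N) mu0 (ltW c0) V0.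
have M1 : 1 <= M by lra.
have [u [cu minu]] := exists_minimizer (rho_ R N) adm c0 mu0 M1.
have su := euler_lagrange adm c0 mu0 M2 HM cu minu.
have cb : competitor (lebesgue_rV R N) Omega near_kernel M (bump Omega).
  split; first exact: bump_energy.
  move=> x; have /andP[b0 b1] := bump_bounds N1 bO x.
  by rewrite b0 (le_trans b1).
have posu : positive_in Omega u.
  apply: (minimizer_positive adm c0 mu0 cu minu cb) => x Ox.
  exact: bump_gt0.
have wu := solution_weak oO cu su.
have bu : ae_bounded u.
  exists M; apply: aeW => x; have [_ /(_ x) /andP[u0 uM]] := cu.
  by rewrite ger0_norm.
exists u; split => // w [ww posw bw].
have [Mu [u' [Mu0 cu' u'pos su' uu']]] := weak_solution_repr oO wu posu bu.
have [Mw [w' [Mw0 cw' w'pos sw' ww']]] := weak_solution_repr oO ww posw bw.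
have le_competitor K f : competitor (lebesgue_rV R N) Omega near_kernel K f ->
    K <= Mu + Mw -> competitor (lebesgue_rV R N) Omega near_kernel (Mu + Mw) f.
  move=> [hf fK] KL; split => // x; have /andP[f0 f1] := fK x.
  by rewrite f0 (le_trans f1).
have hu' : competitor (lebesgue_rV R N) Omega near_kernel (Mu + Mw) u'.
  by apply: le_competitor cu' _; rewrite lerDl.
have hw' : competitor (lebesgue_rV R N) Omega near_kernel (Mu + Mw) w'.
  by apply: le_competitor cw' _; rewrite lerDr.
have uw := solution_unique adm c0 mu0 (addr_ge0 Mu0 Mw0) hu' hw' u'pos w'pos su' sw'.
by apply: filterS3 uu' ww' uw => x <- <- ->.
Qed.
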